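(* Let $\Sigma$ be a Riemann surface, let $X:\Sigma\to\mathbb{M}^2(\kappa)\times\mathbb{R}$ be a conformal isometric immersion (space-like if $\varepsilon=-1$), and let $H$ be its mean curvature. Consider the quadratic differential $$Q=2H\,\Psi^1-\varepsilon\,\frac{\epsilon}{r}\,\Psi^2$$ on $\Sigma$. If $H$ is constant, then $Q$ is holomorphic on $\Sigma$. Conversely, suppose that $\Sigma$ is compact (more generally, suppose that $\Sigma$ does not admit a function without critical points, or that $\Sigma$ does not admit a vector field without singularities). Then, if $Q$ is holomorphic, $H$ is constant.
   Context: Fix $\varepsilon\in\{1,-1\}$ and a real number $\kappa\neq0$. Put $\epsilon=\operatorname{sgn}\kappa$ and $r=|\kappa|^{-1/2}$, so $\kappa=\epsilon/r^2$. $\mathbb{M}^2(\kappa)$ is the simply connected complete surface of constant curvature $\kappa$ with metric $d\sigma^2$, realized as the sphere $\{\langle p,p\rangle=r^2\}\subset\mathbb{R}^3$ if $\kappa>0$ and as one sheet of $\{\langle p,p\rangle=-r^2\}$ in Lorentz–Minkowski space $\mathbb{L}^3$ if $\kappa<0$. The product $\mathbb{M}^2(\kappa)\times\mathbb{R}$ carries the metric $d\sigma^2+\varepsilon\,dt^2$ (Riemannian for $\varepsilon=1$, Lorentzian for $\varepsilon=-1$), and is regarded as a submanifold of $\mathbb{E}^4$, which is $\mathbb{R}^3\times\mathbb{R}$ or $\mathbb{L}^3\times\mathbb{R}$ with product metric $\langle\cdot,\cdot\rangle$ whose $\mathbb{R}$ factor has metric $\varepsilon\,dt^2$; $D$ is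 its covariant derivative. When $\varepsilon=-1$ immersions are assumed space-like (the induced metric is Riemannian). Write $X=(p,t)$. Let $n_1$ be a unit normal field to $\Sigma$ in $\mathbb{M}^2(\kappa)\times\mathbb{R}$, with $\langle n_1,n_1\rangle=\varepsilon$, and let $n_2=p/r$. For tangent fields put $h^k(v,w)=\langle D_vw,n_k\rangle$, $k=1,2$. In local conformal coordinates $(u,v)$, with $z=u+iv$ and induced metric $e^{2\omega}(du^2+dv^2)$, the Hopf differentials are $\Psi^k=\psi^k\,dz^2$ with $$\psi^k=\tfrac12\big(h^k(\partial_u,\partial_u)-h^k(\partial_v,\partial_v)\big)-i\,h^k(\partial_u,\partial_v),\quad k=1,2.$$ The mean curvature is $H=\tfrac12(h^1(e_1,e_1)+h^1(e_2,e_2))$ for a local orthonormal tangent frame $e_1,e_2$. ''Holomorphic'' means that the local coefficient of $dz^2$ is a holomorphic function of $z$. Functions and vector fields are smooth; functions are real-valued. *)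

(* Defs.v *)
From HB Require Import structures.
From mathcomp Require Import all_boot all_order all_algebra.
From mathcomp Require Import all_classical all_reals all_analysis.
From mathcomp Require Export complex.

Set Implicit Arguments.
Unset Strict Implicit.
Unset Printing Implicit Defensive.

Import Order.TTheory GRing.Theory Num.Theory.
Import numFieldNormedType.Exports.
Local Open Scope classical_set_scope.
Local Open Scope ring_scope.
Local Open Scope complex_scope.

Section Plane.
Context {R : realType}.

Definition d_u : R * R := (1, 0).
Definition d_v : R * R := (0, 1).

(* F is C^n on U (used for U open): iterated partial derivatives up to order n
   exist and are continuous at every point of U. *)
Fixpoint Cn (V : normedModType R) (n : nat) (U : set (R * R)) (F : R * R -> V)
    : Prop :=
  if n is m.+1 then
    [/\ forall q, U q -> derivable F q d_u /\ derivable F q d_v,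
        Cn m U ('D_d_u F) & Cn m U ('D_d_v F)]
  else forall q, U q -> {for q, continuous F}.

Definition smooth_on (V : normedModType R) (U : set (R * R))
    (F : R * R -> V) : Prop := forall n, Cn n U F.

(* R[i] as a normed space over itself. *)
Definition cplx : numFieldType := R[i].

(* Complex differentiability with respect to z = u + i v. *)
Definition holomorphic_on (U : set (R * R)) (F : R * R -> R[i]) : Prop :=
  forall q, U q ->
    derivable (fun z : cplx => F (complex.Re z, complex.Im z) : cplx)
      (q.1 +i* q.2) 1.

Definition toC (q : R * R) : R[i] := q.1 +i* q.2.

End Plane.

Section RiemannSurface.
Context {R : realType}.

(* A homeomorphism from an open set of T onto an open set of the plane; the
   values of [to_plane] and [from_plane] outside these sets are irrelevant. *)
Record chart (T : topologicalType) := Chart {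
  dom : set T;
  img : set (R * R);
  to_plane : T -> R * R;
  from_plane : R * R -> T;
  open_dom : open dom;
  open_img : open img;
  to_plane_img : forall x, dom x -> img (to_plane x);
  from_plane_dom : forall q, img q -> dom (from_plane q);
  to_planeK : forall x, dom x -> from_plane (to_plane x) = x;
  from_planeK : forall q, img q -> to_plane (from_plane q) = q;
  to_plane_cont : forall x, dom x -> {for x, continuous to_plane};
  from_plane_cont : forall q, img q -> {for q, continuous from_plane}
}.

Definition transition (T : topologicalType) (c d : chart T) : R * R -> R * R :=
  to_plane d \o from_plane c.

Definition overlap (T : topologicalType) (c d : chart T) : set (R * R) :=
  img c `&` from_plane c @^-1` dom d.

Definition compatible (T : topologicalType) (c d : chart T) : Prop :=
  holomorphic_on (overlap c d) (toC \o transition c d) /\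
  holomorphic_on (overlap d c) (toC \o transition d c).

(* The atlas is maximal, so that its charts are all the local conformal
   coordinates z = u + i v of the surface. *)
Record riemannSurface := RiemannSurface {
  carrier :> topologicalType;
  atlas : set (chart carrier);
  carrier_hausdorff : hausdorff_space carrier;
  carrier_connected : connected [set: carrier];
  atlas_cover : forall x : carrier, exists2 c, atlas c & dom c x;
  atlas_compatible : forall c d, atlas c -> atlas d -> compatible c d;
  atlas_maximal : forall c : chart carrier,
    (forall d, atlas d -> compatible c d) -> atlas c
}.

Variable S : riemannSurface.

Definition smooth (V : normedModType R) (f : S -> V) : Prop :=
  forall c, atlas c -> smooth_on (img c) (f \o from_plane c).

Definition critical_point (f : S -> R) (x : S) : Prop :=
  forall c, atlas c -> dom c x ->
    'D_d_u (f \o from_plane c) (to_plane c x) = 0 /\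
    'D_d_v (f \o from_plane c) (to_plane c x) = 0.

(* A vector field is given by its components in every chart: xi c = (a, b)
   stands for a d/du + b d/dv, and components transform by the Jacobian of the
   change of coordinates. *)
Definition smooth_vector_field (xi : chart S -> R * R -> R * R) : Prop :=
  (forall c, atlas c -> smooth_on (img c) (xi c)) /\
  (forall c d, atlas c -> atlas d -> forall q, overlap c d q ->
     xi d (transition c d q) =
       (xi c q).1 *: 'D_d_u (transition c d) q
       + (xi c q).2 *: 'D_d_v (transition c d) q).

Definition singularity (xi : chart S -> R * R -> R * R) (x : S) : Prop :=
  forall c, atlas c -> dom c x -> xi c (to_plane c x) = 0.

Definition admits_function_without_critical_points : Prop :=
  exists f : S -> R, smooth f /\ forall x, ~ critical_point f x.

Definition admits_vector_field_without_singularities : Prop :=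
  exists xi, smooth_vector_field xi /\ forall x, ~ singularity xi x.

End RiemannSurface.

Arguments riemannSurface R : clear implicits.

(* R^3 x R or L^3 x R, a point being written (p, t). *)
Definition E4 (R : realType) : normedModType R := ('rV[R]_3 * R)%type.

Section Ambient.
Context {R : realType}.
Variables (eps kappa : R).

Definition radius : R := `|kappa| `^ (- 2^-1).

(* R^3 if kappa > 0, L^3 with signature (-,+,+) if kappa < 0. *)
Definition inner3 (p q : 'rV[R]_3) : R :=
  Num.sg kappa * p 0 0 * q 0 0 + p 0 1 * q 0 1 + p 0 2 * q 0 2.

Definition inner4 (x y : E4 R) : R := inner3 x.1 y.1 + eps * x.2 * y.2.

Definition M2 : set 'rV[R]_3 :=
  [set p | inner3 p p = Num.sg kappa * radius ^+ 2 /\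
           (kappa < 0 -> 0 < p 0 0)].

Definition M2xR : set (E4 R) := [set x | M2 x.1].

Section Local.
Variable F : R * R -> E4 R. (* an immersion in local coordinates *)

(* dF (w) and D_w G for the tangent field w = w.1 d/du + w.2 d/dv *)
Definition push (w : R * R -> R * R) (q : R * R) : E4 R :=
  (w q).1 *: 'D_d_u F q + (w q).2 *: 'D_d_v F q.

Definition covD (w : R * R -> R * R) (G : R * R -> E4 R) (q : R * R) : E4 R :=
  (w q).1 *: 'D_d_u G q + (w q).2 *: 'D_d_v G q.

Definition ind_metric (v w : R * R -> R * R) (q : R * R) : R :=
  inner4 (push v q) (push w q).

(* h(v, w) = < D_v w, n > *)
Definition second_form (n : R * R -> E4 R) (v w : R * R -> R * R) (q : R * R)
  : R := inner4 (covD v (push w) q) (n q).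

Definition hopf (n : R * R -> E4 R) (q : R * R) : R[i] :=
  (2^-1 * (second_form n (cst d_u) (cst d_u) q
           - second_form n (cst d_v) (cst d_v) q))
  -i* second_form n (cst d_u) (cst d_v) q.

End Local.

Variable S : riemannSurface R.

(* In each z = u + i v, the induced metric is e^{2 omega} (du^2 + dv^2); since
   it is positive definite, X is an immersion, space-like if eps = -1. *)
Definition conformal_immersion (X : S -> E4 R) : Prop :=
  [/\ smooth X,
      forall x, M2xR (X x) &
      forall c, atlas c -> exists omega : R * R -> R, forall q, img c q ->
        let g := ind_metric (X \o from_plane c) in
        [/\ g (cst d_u) (cst d_u) q = expR (2 * omega q),
            g (cst d_v) (cst d_v) q = expR (2 * omega q) &
            g (cst d_u) (cst d_v) q = 0]].

(* (X x).1 is normal to M^2(kappa) x R, so the second condition says that n is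
   tangent to M^2(kappa) x R. *)
Definition unit_normal (X n : S -> E4 R) : Prop :=
  [/\ smooth n,
      forall x, inner4 (n x) ((X x).1, 0) = 0,
      forall x, inner4 (n x) (n x) = eps &
      forall c, atlas c -> forall q, img c q -> forall w,
        inner4 (n (from_plane c q)) (push (X \o from_plane c) w q) = 0].

Definition n2 (X : S -> E4 R) (x : S) : E4 R := (radius^-1 *: (X x).1, 0).

Definition mean_curvature (X n1 : S -> E4 R) (H : S -> R) : Prop :=
  forall c, atlas c -> forall e1 e2 : R * R -> R * R,
    let F := X \o from_plane c in
    let h1 := second_form F (n1 \o from_plane c) in
    smooth_on (img c) e1 -> smooth_on (img c) e2 ->
    (forall q, img c q ->
       [/\ ind_metric F e1 e1 q = 1, ind_metric F e2 e2 q = 1 &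
           ind_metric F e1 e2 q = 0]) ->
    forall q, img c q ->
      H (from_plane c q) = 2^-1 * (h1 e1 e1 q + h1 e2 e2 q).

(* The coefficient of dz^2 in Q = 2 H Psi^1 - eps (sgn kappa / r) Psi^2. *)
Definition Qcoef (X n1 : S -> E4 R) (H : S -> R) (c : chart S) (q : R * R)
  : R[i] :=
  let F := X \o from_plane c in
  (2 * H (from_plane c q))%:C * hopf F (n1 \o from_plane c) q
  - (eps * (Num.sg kappa / radius))%:C * hopf F (n2 X \o from_plane c) q.

Definition Q_holomorphic (X n1 : S -> E4 R) (H : S -> R) : Prop :=
  forall c, atlas c -> holomorphic_on (img c) (Qcoef X n1 H c).

Definition constant_function (f : S -> R) : Prop :=
  exists a, forall x, f x = a.

End Ambient.

(* Main.v *)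
Require Import Defs.
From HB Require Import structures.
From mathcomp Require Import all_boot all_order all_algebra.
From mathcomp Require Import all_classical all_reals all_analysis.
From mathcomp Require Import ring lra.
Set Implicit Arguments.
Unset Strict Implicit.
Unset Printing Implicit Defensive.
Import Order.TTheory GRing.Theory Num.Theory.
Import numFieldNormedType.Exports.
Local Open Scope classical_set_scope.
Local Open Scope ring_scope.

(** In a chart, write psi for the coefficient of Psi^1, lam for the conformal
    factor, t for the height, nu for the R-component of n_1 and kap for the
    curvature. Then [Q = 2 (H psi - kap t_z^2)], and the Codazzi equation
    together with [t_(z zbar) = eps lam H nu / 2] gives
    [Q_zbar = 2 (H_zbar psi + lam H H_z)], which settles the direct statement.
    If Q is holomorphic, this says that the second form II of n_1 satisfies
    II(grad H, .) = 0.

    Where dH <> 0, this forces dH and dt to be parallel. Otherwise H and nu are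
    local coordinates, with grad H and grad nu orthogonal. Let d/dH and d/dnu be
    the coordinate fields and E = |grad H|^2. The Codazzi equations give
    [dt/dnu = -1/(2H)] and [dE/dnu = kap eps nu E / (2 H^2)], and since
    Hess t (grad H, grad H) = 0, E times a function which is cubic in nu equals
    a cubic polynomial in nu. As E is a multiple of exp (c nu^2) with c <> 0, this
    is absurd.

    Hence nu is locally constant where dH <> 0, and the Codazzi equations now
    express |grad H| as a function of H which is O(H - H_0) at a critical value
    H_0. By Gronwall's inequality along a segment, a critical point
    of H has a neighbourhood of critical points. So either H is constant, or H
    has no critical point; in the latter case the surface is not compact, and H
    and its gradient are a function without critical points and a vector field
    without singularities. *)

(** * Smooth functions on open subsets of the plane *)

(** [H] and nu are never made into a chart, so no inverse function theorem is involved: d/dH and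
    d/dnu are the derivations dual to dH and dnu, given by Cramer's rule, and only their commutation
    and their values on H, nu, t and E are used. Likewise E is never integrated to an exponential.
    As d/dnu acts on E as multiplication by a multiple of nu, differentiating a relation E P = p / H
    in nu lowers the degree of P and raises that of p. Four derivatives kill the cubic on the left
    and leave on the right a polynomial of degree seven, with nonzero leading coefficient, that
    would have to vanish.

    The obstacle in the second half is that nu is known to be locally constant only where dH <> 0,
    an open set of unknown shape. On a segment that leaves the critical set, the last critical point
    is followed by regular points only, so nu takes a single value up to the end of the segment. One
    formula for |grad H| then holds on this whole stretch, and its limit at the critical point ties
    the value of nu to H_0. *)

Section SmoothCalculus.
Context {R : realType}.
Implicit Types (U : set (R * R)) (f g : R * R -> R).

Lemma derivable_mul f g (q v : R * R) :
  derivable f q v -> derivable g q v -> derivable (f * g) q v.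
Proof. by move=> df dg; exact: (derivableM df dg). Qed.

Lemma derive_mul f g (q v : R * R) : derivable f q v -> derivable g q v ->
  'D_v (f * g) q = f q * 'D_v g q + g q * 'D_v f q.
Proof. by move=> df dg; exact: (deriveM df dg). Qed.

(* [Cn n.+1 U F] does not assert the continuity of F, so it is not literally
   stronger than [Cn n U F]. *)
Definition Cle (V : normedModType R) n U (F : R * R -> V) :=
  forall k, (k <= n)%N -> Cn k U F.

Lemma smooth_Cle (V : normedModType R) U (F : R * R -> V) :
  smooth_on U F <-> forall n, Cle n U F.
Proof. by split=> [h n k _|h n]; [exact: h|exact: (h n n)]. Qed.

Lemma CleS (V : normedModType R) n U (F : R * R -> V) :
  Cle n.+1 U F <->
  [/\ forall q, U q -> {for q, continuous F},
      forall q, U q -> derivable F q d_u /\ derivable F q d_v,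
      Cle n U ('D_d_u F) & Cle n U ('D_d_v F)].
Proof.
split=> [h|[c d hu hv] [|k] // kn]; last by split=> //; [exact: hu|exact: hv].
split; [exact: (h 0%N)|by have [] := h 1%N isT| |] => k kn;
  by have [] := h k.+1 kn.
Qed.

Lemma Cn_eq (V : normedModType R) n U (F G : R * R -> V) : open U ->
  (forall q, U q -> F q = G q) -> Cn n U F -> Cn n U G.
Proof.
move=> oU; elim: n F G => [|n IH] F G FG.
  move=> h q Uq; have Fq := h q Uq.
  have FGq : \forall x \near q, F x = G x by near do apply: FG; exact: open_nbhs_nbhs.
  rewrite /prop_for /continuous_at -FG //.
  by apply: cvg_trans Fq; exact: near_eq_cvg.
case=> d hu hv.
have nFG q : U q -> \forall x \near q, F x = G x.
  by move=> Uq; near do apply: FG; exact: open_nbhs_nbhs.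
split.
- move=> q Uq; have [h1 h2] := d q Uq.
  by split; apply: near_eq_derivable (nFG q Uq) _.
- by apply: IH hu => q Uq; apply: near_eq_derive; exact: nFG.
- by apply: IH hv => q Uq; apply: near_eq_derive; exact: nFG.
Unshelve. all: by end_near. Qed.

Lemma smooth_eq (V : normedModType R) U (F G : R * R -> V) : open U ->
  (forall q, U q -> F q = G q) -> smooth_on U F -> smooth_on U G.
Proof. by move=> oU FG h n; apply: Cn_eq FG _. Qed.

Lemma Cn_sub (V : normedModType R) n U U' (F : R * R -> V) :
  U' `<=` U -> Cn n U F -> Cn n U' F.
Proof.
move=> sU; elim: n F => [|n IH] F /=; first by move=> h q /sU/h.
by case=> d hu hv; split; [move=> q /sU/d|exact: IH|exact: IH].
Qed.

Lemma smooth_sub (V : normedModType R) U U' (F : R * R -> V) :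
  U' `<=` U -> smooth_on U F -> smooth_on U' F.
Proof. by move=> sU h n; exact: Cn_sub (h n). Qed.

Lemma Cle_eq (V : normedModType R) n U (F G : R * R -> V) : open U ->
  (forall q, U q -> F q = G q) -> Cle n U F -> Cle n U G.
Proof. by move=> oU FG h k kn; apply: Cn_eq FG _ => //; exact: h. Qed.

Lemma CleW (V : normedModType R) n U (F : R * R -> V) : Cle n.+1 U F -> Cle n U F.
Proof. by move=> h k kn; apply: h; exact: leqW. Qed.

Lemma Cle_cst (V : normedModType R) n U (r : V) : Cle n U (cst r).
Proof.
elim: n r => [|n IH] r; first by case=> // _ q _; exact: cst_continuous.
have D0 v : 'D_v (cst r : R * R -> V) = cst 0.
  by apply/funext => q; rewrite derive_cst.
apply/CleS; split; rewrite ?D0; try exact: IH.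
  by move=> q _; exact: cst_continuous.
by move=> q _; split; exact: derivable_cst.
Qed.

Lemma CleD (V : normedModType R) n U (f g : R * R -> V) : open U ->
  Cle n U f -> Cle n U g -> Cle n U (f + g).
Proof.
move=> oU; elim: n f g => [|n IH] f g.
  move=> /(_ 0%N isT) hf /(_ 0%N isT) hg [|//] _ q Uq.
  by apply: continuousD; [exact: hf|exact: hg].
move=> /CleS[cf df fu fv] /CleS[cg dg gu gv]; apply/CleS; split.
- by move=> q Uq; apply: continuousD; [exact: cf|exact: cg].
- move=> q Uq; have [? ?] := df q Uq; have [? ?] := dg q Uq.
  by split; exact: derivableD.
- apply: (Cle_eq oU _ (IH _ _ fu gu)) => q Uq.
  by have [? ?] := df q Uq; have [? ?] := dg q Uq; rewrite [RHS]deriveD.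
- apply: (Cle_eq oU _ (IH _ _ fv gv)) => q Uq.
  by have [? ?] := df q Uq; have [? ?] := dg q Uq; rewrite [RHS]deriveD.
Qed.

Lemma CleM n U f g : open U -> Cle n U f -> Cle n U g -> Cle n U (f * g).
Proof.
move=> oU; elim: n f g => [|n IH] f g.
  move=> /(_ 0%N isT) hf /(_ 0%N isT) hg [|//] _ q Uq.
  by apply: cvgM; [exact: hf|exact: hg].
move=> hf hg; have := hf; have := hg.
move=> /CleS[cg dg gu gv] /CleS[cf df fu fv]; apply/CleS; split.
- by move=> q Uq; apply: cvgM; [exact: cf|exact: cg].
- move=> q Uq; have [? ?] := df q Uq; have [? ?] := dg q Uq.
  by split; exact: derivable_mul.
- apply: (Cle_eq oU _ (CleD oU (IH _ _ (CleW hf) gu) (IH _ _ (CleW hg) fu))).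
  move=> q Uq; have [fu' _] := df q Uq; have [gu' _] := dg q Uq.
  exact: esym (derive_mul fu' gu').
- apply: (Cle_eq oU _ (CleD oU (IH _ _ (CleW hf) gv) (IH _ _ (CleW hg) fv))).
  move=> q Uq; have [_ fv'] := df q Uq; have [_ gv'] := dg q Uq.
  exact: esym (derive_mul fv' gv').
Qed.

Definition finv f : R * R -> R := fun q => (f q)^-1.

(** The derivative of 1/f is -(1/f)^2 Df, so order n of 1/f yields order n of its derivatives. *)
Lemma Cle_inv n U f : open U -> (forall q, U q -> f q != 0) ->
  Cle n U f -> Cle n U (finv f).
Proof.
move=> oU f0; elim: n => [|n IH].
  move=> /(_ 0%N isT) hf [|//] _ q Uq.
  by apply: cvgV; [exact: f0|exact: hf].
move=> hf; have hf' := IH (CleW hf).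
move: hf => /CleS[cf df fu fv]; apply/CleS.
have Dv v (q : R * R) : U q -> derivable f q v ->
    (cst (-1) * (finv f * finv f) * 'D_v f) q = 'D_v (finv f) q.
  move=> Uq dq; rewrite [RHS]deriveV ?f0// !fctE /finv /GRing.scale /=.
  by rewrite -invfM -expr2 mulN1r.
split.
- by move=> q Uq; apply: cvgV; [exact: f0|exact: cf].
- move=> q Uq; have [fu' fv'] := df q Uq.
  by split; [exact: derivableV (f0 q Uq) fu'|exact: derivableV (f0 q Uq) fv'].
- apply: (Cle_eq oU (fun q Uq => Dv _ q Uq (df q Uq).1)).
  by do ![apply: CleM => //]; exact: Cle_cst.
- apply: (Cle_eq oU (fun q Uq => Dv _ q Uq (df q Uq).2)).
  by do ![apply: CleM => //]; exact: Cle_cst.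
Qed.

Lemma smooth_cst U (r : R) : smooth_on U (cst r : R * R -> R).
Proof. by apply/smooth_Cle => n; exact: Cle_cst. Qed.

Lemma smoothD U f g : open U -> smooth_on U f -> smooth_on U g ->
  smooth_on U (f + g).
Proof.
by move=> oU /smooth_Cle hf /smooth_Cle hg; apply/smooth_Cle => n; exact: CleD.
Qed.

Lemma smoothM U f g : open U -> smooth_on U f -> smooth_on U g ->
  smooth_on U (f * g).
Proof.
by move=> oU /smooth_Cle hf /smooth_Cle hg; apply/smooth_Cle => n; exact: CleM.
Qed.

Lemma smoothN U f : open U -> smooth_on U f -> smooth_on U (- f).
Proof.
move=> oU hf; have := smoothM oU (smooth_cst U (-1)) hf.
by apply: smooth_eq => // q _; rewrite !fctE mulN1r.
Qed.

Lemma smoothB U f g : open U -> smooth_on U f -> smooth_on U g ->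
  smooth_on U (f - g).
Proof. by move=> oU hf hg; apply: smoothD => //; exact: smoothN. Qed.

Lemma smoothV U f : open U -> (forall q, U q -> f q != 0) -> smooth_on U f ->
  smooth_on U (finv f).
Proof.
by move=> oU f0 /smooth_Cle hf; apply/smooth_Cle => n; exact: Cle_inv.
Qed.

Lemma smooth_du (V : normedModType R) U (f : R * R -> V) :
  smooth_on U f -> smooth_on U ('D_d_u f).
Proof. by move=> h n; have [] := h n.+1. Qed.

Lemma smooth_dv (V : normedModType R) U (f : R * R -> V) :
  smooth_on U f -> smooth_on U ('D_d_v f).
Proof. by move=> h n; have [] := h n.+1. Qed.

Lemma smooth_derivable_u (V : normedModType R) U (f : R * R -> V) q :
  smooth_on U f -> U q -> derivable f q d_u.
Proof. by move=> /(_ 1%N)[d _ _] /d[]. Qed.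

Lemma smooth_derivable_v (V : normedModType R) U (f : R * R -> V) q :
  smooth_on U f -> U q -> derivable f q d_v.
Proof. by move=> /(_ 1%N)[d _ _] /d[]. Qed.

Lemma smooth_continuous (V : normedModType R) U (f : R * R -> V) q :
  smooth_on U f -> U q -> {for q, continuous f}.
Proof. by move=> /(_ 0%N); exact. Qed.

End SmoothCalculus.

(** * Differentials of smooth functions *)

Section Differentiability.
Context {R : realType}.
Implicit Types (U : set (R * R)) (f g : R * R -> R).

Lemma line_derive f (x v : R * R) (s : R) : derivable f (s *: v + x) v ->
  is_derive s 1 (fun h : R => f (h *: v + x)) ('D_v f (s *: v + x)).
Proof.
have E : (fun h : R => h^-1 *: (((fun h : R => f (h *: v + x)) \o shift s) (h *: (1:R))
   - f (s *: v + x))) = (fun h => h^-1 *: ((f \o shift (s *: v + x)) (h *: v) - f (s *: v + x))).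
  by apply/funext => h /=; rewrite [h *: _]mulr1 scalerDl addrA.
by move=> df; apply: DeriveDef; [rewrite /derivable E|rewrite /derive E].
Qed.

Lemma line_mvt f (x v : R * R) (h : R) :
  (forall s : R, `|s| <= `|h| -> derivable f (s *: v + x) v) ->
  exists2 s : R, `|s| <= `|h| & f (h *: v + x) - f x = h * 'D_v f (s *: v + x).
Proof.
move=> df; have cont a b : (forall s, s \in `[a, b]%R -> `|s| <= `|h|) ->
    {within `[a, b], continuous (fun h : R => f (h *: v + x))}.
  move=> ab; apply: derivable_within_continuous => s /ab/df/line_derive ds.
  exact: ex_derive.
have der a b : (forall s, s \in `[a, b]%R -> `|s| <= `|h|) ->
    forall s, s \in `]a, b[%R ->
    is_derive s 1 (fun h : R => f (h *: v + x)) ('D_v f (s *: v + x)).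
  move=> ab s; rewrite in_itv => /andP[as_ sb]; apply/line_derive/df/ab.
  by rewrite in_itv /= !ltW.
have x0 : f x = f ((0 : R) *: v + x) by rewrite scale0r add0r.
have [h0|h0] := leP 0 h.
  have ab s : s \in `[0, h]%R -> `|s| <= `|h|.
    by rewrite in_itv /= => /andP[s0 sh]; rewrite !ger0_norm.
  have [s /ab sh E] := MVT_segment h0 (der _ _ ab) (cont _ _ ab).
  by exists s => //; rewrite x0 E subr0 mulrC.
have ab s : s \in `[h, 0]%R -> `|s| <= `|h|.
  rewrite in_itv /= => /andP[hs s0].
  by rewrite !ler0_norm// ?lerN2// ltW.
have [s /ab sh E] := MVT_segment (ltW h0) (der _ _ ab) (cont _ _ ab).
by exists s => //; rewrite x0 -opprB E; ring.
Qed.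

Lemma pair_line (k q : R * R) : k + q = k.1 *: d_u + (k.2 *: d_v + q).
Proof.
case: k q => [a b] [x y]; rewrite /d_u /d_v; congr pair => /=;
  rewrite /GRing.scale /=; ring.
Qed.

Lemma open_box U (q : R * R) : open U -> U q ->
  exists2 r : R, 0 < r & forall k : R * R, `|k.1| < r -> `|k.2| < r -> U (k + q).
Proof.
move=> oU Uq; have /nbhs_ballP[r /= r0 hr] : nbhs q U by exact: open_nbhs_nbhs.
exists r => // k k1 k2; apply: hr; rewrite -ball_normE /ball_ /=.
by rewrite opprD addrCA subrr addr0 normrN prod_normE gt_max k1 k2.
Qed.

Lemma cont_box (f : R * R -> R) (q : R * R) (e : R) :
  0 < e -> {for q, continuous f} -> exists2 r : R, 0 < r &
    forall k : R * R, `|k.1| < r -> `|k.2| < r -> `|f (k + q) - f q| < e.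
Proof.
move=> e0 /cvgrPdist_lt /(_ _ e0) /nbhs_ballP[r /= r0 hr].
exists r => // k k1 k2; rewrite distrC; apply: hr; rewrite -ball_normE /ball_ /=.
by rewrite opprD addrCA subrr addr0 normrN prod_normE gt_max k1 k2.
Qed.

(** Going from q to k + q along v and then along u, two mean value theorems reduce the error to the
    oscillation of the partial derivatives, which are continuous. *)
Lemma C1_estimate U f (q : R * R) (e : R) : open U -> smooth_on U f -> U q ->
  0 < e -> exists2 r : R, 0 < r & forall k : R * R, `|k.1| < r -> `|k.2| < r ->
  `|f (k + q) - f q - (k.1 * 'D_d_u f q + k.2 * 'D_d_v f q)|
     <= e * (`|k.1| + `|k.2|).
Proof.
move=> oU sf Uq e0.
have [r1 r10 box] := open_box oU Uq.
have [r2 r20 cu] := cont_box e0 (smooth_continuous (smooth_du sf) Uq).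
have [r3 r30 cv] := cont_box e0 (smooth_continuous (smooth_dv sf) Uq).
exists (Num.min r1 (Num.min r2 r3)).
  by rewrite !lt_min r10 r20 r30.
move=> k; rewrite !lt_min => /and3P[k11 k12 k13] /and3P[k21 k22 k23].
have pt (a b : R) : a *: d_u + (b *: d_v + q) = (a, b) + q :> R * R.
  by rewrite [RHS]pair_line.
have pt0 (b : R) : b *: d_v + q = (0, b) + q :> R * R.
  by rewrite -(pt 0 b) scale0r add0r.
have [|s sk Es] := @line_mvt f (k.2 *: d_v + q) d_u k.1.
  move=> s sk; rewrite pt; apply: (smooth_derivable_u sf).
  by apply: box => //=; exact: le_lt_trans sk _.
have [|t tk Et] := @line_mvt f q d_v k.2.
  move=> w wk; rewrite pt0.
  apply: (smooth_derivable_v sf); apply: box => /=; first by rewrite normr0.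
  exact: le_lt_trans wk _.
rewrite pair_line -(subrK (f (k.2 *: d_v + q)) (f (_ + _))) Es -(addrA _ _ (- f q)) Et.
rewrite pt pt0.
rewrite (_ : _ - _ = k.1 * ('D_d_u f ((s, k.2) + q) - 'D_d_u f q)
   + k.2 * ('D_d_v f ((0, t) + q) - 'D_d_v f q)); last by ring.
apply: le_trans (ler_normD _ _) _; rewrite !normrM mulrDr !(mulrC e).
apply: lerD; apply: ler_wpM2l => //; apply: ltW.
  by apply: cu => //=; exact: le_lt_trans sk _.
by apply: cv => //=; [rewrite normr0|exact: le_lt_trans tk _].
Qed.

Definition gradmap f (q : R * R) (k : R * R) : R :=
  k.1 * 'D_d_u f q + k.2 * 'D_d_v f q.

Lemma gradmap_linear f q : linear (gradmap f q).
Proof.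
by move=> a x y; rewrite /gradmap /= /GRing.scale /=; ring.
Qed.
HB.instance Definition _ f q :=
  GRing.isLinear.Build _ _ _ _ (gradmap f q) (gradmap_linear f q).

Lemma gradmap_continuous f q : continuous (gradmap f q).
Proof.
move=> k; rewrite /gradmap; apply: cvgD; apply: cvgM; try exact: cvg_cst.
  exact: cvg_fst.
exact: cvg_snd.
Qed.

(** Smoothness is defined through two partial derivatives, whereas the chain rule needs the full
    differential. *)
Lemma smooth_diff U f (q : R * R) : open U -> smooth_on U f -> U q ->
  is_diff q f (gradmap f q).
Proof.
move=> oU sf Uq.
pose V := (R * R)%type : normedModType R.
have E : f \o shift q = (cst (f q) : V -> (R : normedModType R)) + (gradmap f q : V ->
  R) +o_ (0 : V) (id : V -> V).
  apply/eqaddoP => _/posnumP[e].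
  (* The bound is halved because |k.1| + |k.2| is at most twice the sup norm of k. *)
  have [r r0 hr] := C1_estimate oU sf Uq (divr_gt0 (gt0 e) (ltr0n _ 2)).
  apply/nbhs_ballP; exists r => //= k; rewrite -ball_normE /ball_ /= sub0r normrN.
  rewrite prod_normE gt_max => /andP[k1 k2].
  rewrite !fctE /= opprD addrA; apply: le_trans (hr k k1 k2) _.
  have a1 : `|k.1| <= `|k| by rewrite prod_normE le_max lexx.
  have a2 : `|k.2| <= `|k| by rewrite prod_normE le_max lexx orbT.
  apply: le_trans (ler_wpM2l _ (lerD a1 a2)) _; first by rewrite divr_ge0.
  by rewrite -mulr2n -(mulr_natl `|k|) mulrA divfK.
have D := diff_unique (@gradmap_continuous f q) E.
apply: DiffDef => //; apply/diff_locallyP; rewrite D; split => //.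
exact: gradmap_continuous.
Qed.
End Differentiability.

(** * Chain rule and symmetry of second derivatives *)

Section ChainRule.
Context {R : realType}.
Implicit Types (U : set (R * R)) (f g : R * R -> R).

Lemma derive_line (V W : normedModType R) (c : V -> W) (x w : V) :
  'D_1 (fun h : R => c (h *: w + x)) 0 = 'D_w c x.
Proof.
rewrite /derive; set g1 := fun h => h^-1 *: _; set g2 := fun h => h^-1 *: _.
suff -> : g1 = g2 by [].
by apply/funext => h; rewrite /g1 /g2 /= addr0 scale0r add0r [_%:A]mulr1.
Qed.

(** Only a directional derivative of c is required: restricted to the line through x along w, c is a
    differentiable curve. This suits the transition maps, whose derivatives are known direction by
    direction from the Cauchy-Riemann equations. *)
Lemma is_derive_comp (W : normedModType R) U (c : W -> R * R) f (x w : W) :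
  open U -> smooth_on U f -> U (c x) -> derivable c x w ->
  is_derive x w (f \o c) (('D_w c x).1 * 'D_d_u f (c x) + ('D_w c x).2 * 'D_d_v f (c x)).
Proof.
move=> oU sf Ux dc.
pose c0 := fun h : R => c (h *: w + x).
have c00 : c0 0 = c x by rewrite /c0 scale0r add0r.
have dc0 : differentiable c0 0 by apply: (derivable1_diffP c0 0).1; apply: (derivable1P c x w).1.
have df : is_diff (c0 0) f (gradmap f (c x)) by rewrite c00; exact: smooth_diff Ux.
have dfc : is_diff (0 : R) (f \o c0) (gradmap f (c x) \o 'd c0 0).
  by apply: is_diff_comp; exact: differentiableP.
have D0 : 'd c0 0 1 = 'D_w c x 
  by apply: etrans (esym (deriveE _ dc0)) _; exact: derive_line.
have [ddfc vdfc] := dfc.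
apply: DeriveDef; first by apply: (derivable1P (f \o c) x w).2;
  apply: (derivable1_diffP (f \o c0) 0).2.
rewrite -derive_line; change (fun h : R => _) with (f \o c0).
by rewrite deriveE // vdfc /= D0.
Qed.

Lemma derive_translate f (c q v : R * R) :
  'D_v (fun p => f (c + p)) q = 'D_v f (c + q).
Proof.
rewrite /derive; set g1 := fun h => h^-1 *: _; set g2 := fun h => h^-1 *: _.
suff -> : g1 = g2 by [].
by apply/funext => h; rewrite /g1 /g2 /= addrCA.
Qed.

Lemma derivable_translate f (c q v : R * R) :
  derivable f (c + q) v -> derivable (fun p => f (c + p)) q v.
Proof.
rewrite /derivable; have -> // : (fun h : R => h^-1 *: (((fun p => f (c + p)) \o
   shift q) (h *: v) - f (c + q))) = fun h => h^-1 *: ((f \o shift (c + q)) (h *: v) - f (c + q)).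
by apply/funext => h /=; rewrite addrCA.
Qed.

(** The double difference is symmetric in v and w. Here it is evaluated as a v-difference of
    w-differences; comparing with the opposite order for small h identifies the mixed
    derivatives. *)
Lemma second_difference f (v w q : R * R) (h : R) :
  (forall a b : R, `|a| <= `|h| -> `|b| <= `|h| ->
     derivable f (a *: v + (b *: w + q)) v /\
     derivable ('D_v f) (a *: v + (b *: w + q)) w) ->
  exists a b : R, [/\ `|a| <= `|h|, `|b| <= `|h| &
    f (h *: v + (h *: w + q)) - f (h *: w + q) - (f (h *: v + q) - f q) =
    h * h * 'D_w ('D_v f) (a *: v + (b *: w + q))].
Proof.
move=> H; pose g p := f (h *: w + p) - f p.
have h0 : `|0 : R| <= `|h| by rewrite normr0.
have E0 (p : R * R) : (0 : R) *: w + p = p by rewrite scale0r add0r.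
have dg1 a : `|a| <= `|h| -> derivable (fun p => f (h *: w + p)) (a *: v + q) v.
  by move=> ah; apply: derivable_translate; rewrite addrCA; have [] := H a h ah (lexx _).
have dg2 a : `|a| <= `|h| -> derivable f (a *: v + q) v.
  by move=> ah; have [] := H a 0 ah h0; rewrite E0.
have [a ah Ea] : exists2 a : R, `|a| <= `|h| & g (h *: v + q) - g q = h * 'D_v g (a *: v + q).
  apply: (line_mvt (f := g)) => a ah; apply: derivableB; [exact: dg1|exact: dg2].
have [b bh Eb] : exists2 b : R, `|b| <= `|h| &
    'D_v f (h *: w + (a *: v + q)) - 'D_v f (a *: v + q) = h * 'D_w ('D_v f) (b *: w + (a *: v +
      q)).
  apply: (line_mvt (f := 'D_v f)) => b bh.
  by have [_ Hd] := H a b ah bh; rewrite addrCA; exact: Hd.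
exists a, b; split; [exact: ah|exact: bh|].
move: Ea; rewrite /g deriveB; [|exact: dg1|exact: dg2].
rewrite derive_translate Eb (addrCA (b *: w)) (addrCA (h *: w)) mulrA => <-.
by rewrite (addrC (f (h *: w + q))); ring.
Qed.

Lemma dist_half (A B x y e : R) :
  A = B -> `|A - x| < e / 2 -> `|B - y| < e / 2 -> `|x - y| <= e.
Proof.
move=> ->; rewrite distrC => H1 H2; rewrite -(subrKA B).
by rewrite (le_trans (ler_normD _ _))// (splitr e) lerD// ltW.
Qed.

Lemma derive_swap U f (q : R * R) : open U -> smooth_on U f -> U q ->
  'D_d_v ('D_d_u f) q = 'D_d_u ('D_d_v f) q.
Proof.
move=> oU sf Uq.
have [r1 r10 box] := open_box oU Uq.
apply/eqP; rewrite -subr_eq0 -normr_le0; apply/ler_addgt0Pr => e e0; rewrite add0r.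
have e20 : 0 < e / 2 by rewrite divr_gt0.
have [r2 r20 c1] := cont_box e20 (smooth_continuous (smooth_dv (smooth_du sf)) Uq).
have [r3 r30 c2] := cont_box e20 (smooth_continuous (smooth_du (smooth_dv sf)) Uq).
pose r := Num.min r1 (Num.min r2 r3); pose h := r / 2.
have r0 : 0 < r by rewrite !lt_min r10 r20 r30.
have h0 : 0 < h by rewrite divr_gt0.
have small (a : R) : `|a| <= `|h| -> [/\ `|a| < r1, `|a| < r2 & `|a| < r3].
  rewrite (gtr0_norm h0) => ah.
  have : `|a| < r by apply: le_lt_trans ah _; rewrite ltr_pdivrMr// ltr_pMr// ltr1n.
  by rewrite !lt_min => /and3P.
have pt (a b : R) : a *: d_u + (b *: d_v + q) = (a, b) + q :> R * R.
  by rewrite [RHS]pair_line.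
have [|a [b [/small[a1 a2 a3] /small[b1 b2 b3] Ea]]] := @second_difference f d_u d_v q h.
  move=> a b /small[a1 a2 a3] /small[b1 b2 b3]; rewrite pt.
  by split; [apply: (smooth_derivable_u sf)|apply: (smooth_derivable_v (smooth_du sf))];
    exact: box.
have [|c [d [/small[c1' c2' c3] /small[d1 d2 d3] Ec]]] := @second_difference f d_v d_u q h.
  move=> c d /small[c1' c2' c3] /small[d1 d2 d3]; rewrite addrCA pt.
  by split; [apply: (smooth_derivable_v sf)|apply: (smooth_derivable_u (smooth_dv sf))];
    exact: box.
have Eac : 'D_d_v ('D_d_u f) (a *: d_u + (b *: d_v + q)) =
   'D_d_u ('D_d_v f) (d *: d_u + (c *: d_v + q)).
  have hh0 : h * h != 0 by rewrite mulf_neq0// gt_eqF.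
  move: Ec; rewrite (addrCA (h *: d_v)) (addrCA (c *: d_v)) => Ec.
  apply: (mulfI hh0 _).
  apply: etrans (esym Ea) _. 
  apply: etrans Ec. 
  have swap (x y z w : R) : x - y - (z - w) = x - z - (y - w) by ring.
  exact: swap.
move: Eac; rewrite !pt => Eac.
exact: dist_half Eac (c1 (a, b) a2 b2) (c2 (d, c) d3 c3).
Qed.

End ChainRule.

(** * Derivations *)

Section Derivations.
Context {R : realType}.
Implicit Types (U V : set (R * R)) (f g : R * R -> R).
Implicit Type D : (R * R -> R) -> R * R -> R.

(** The rules shared by the partial derivatives and by d/dH and d/dnu, which are combinations of
    them with smooth coefficients. All later differential identities are derived from these rules
    alone. *)
Record derivation U D : Prop := Derivation {
  der_smooth : forall f, smooth_on U f -> smooth_on U (D f);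
  der_eq : forall f g q, (forall p, U p -> f p = g p) -> U q -> D f q = D g q;
  der_cst : forall r q, U q -> D (cst r) q = 0;
  derD : forall f g q, smooth_on U f -> smooth_on U g -> U q ->
    D (f + g) q = D f q + D g q;
  derM : forall f g q, smooth_on U f -> smooth_on U g -> U q ->
    D (f * g) q = f q * D g q + g q * D f q }.

Lemma derivation_du U : open U -> derivation U (fun f => 'D_d_u f).
Proof.
move=> oU; split.
- by move=> f; exact: smooth_du.
- move=> f g q fg Uq; apply: near_eq_derive; near do apply: fg.
  exact: open_nbhs_nbhs.
- by move=> r q _; exact: derive_cst.
- move=> f g q sf sg Uq; apply: deriveD; exact: (smooth_derivable_u (U := U)).
- move=> f g q sf sg Uq; apply: derive_mul; exact: (smooth_derivable_u (U := U)).
Unshelve. all: by end_near. Qed.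

Lemma derivation_dv U : open U -> derivation U (fun f => 'D_d_v f).
Proof.
move=> oU; split.
- by move=> f; exact: smooth_dv.
- move=> f g q fg Uq; apply: near_eq_derive; near do apply: fg.
  exact: open_nbhs_nbhs.
- by move=> r q _; exact: derive_cst.
- move=> f g q sf sg Uq; apply: deriveD; exact: (smooth_derivable_v (U := U)).
- move=> f g q sf sg Uq; apply: derive_mul; exact: (smooth_derivable_v (U := U)).
Unshelve. all: by end_near. Qed.

Lemma derivation_comb U D D' (a b : R * R -> R) : open U -> smooth_on U a -> smooth_on U b ->
  derivation U D -> derivation U D' ->
  derivation U (fun f => a * D f + b * D' f).
Proof.
move=> oU sa sb dD dD'; split.
- move=> f sf; apply: smoothD => //; apply: smoothM => //; exact: der_smooth sf.
- by move=> f g q fg Uq; rewrite !fctE (der_eq dD fg Uq) (der_eq dD' fg Uq).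
- by move=> r q Uq; rewrite !fctE (der_cst dD) // (der_cst dD') // !mulr0 addr0.
- move=> f g q sf sg Uq; rewrite !fctE (derD dD) // (derD dD') //; ring.
- move=> f g q sf sg Uq; rewrite !fctE (derM dD) // (derM dD') //; ring.
Qed.

Section Rules.
Variables (U : set (R * R)) (D : (R * R -> R) -> R * R -> R).
Hypotheses (oU : open U) (dD : derivation U D).

Lemma derN f q : smooth_on U f -> U q -> D (- f) q = - D f q.
Proof.
move=> sf Uq; have -> : D (- f) q = D (cst (-1) * f) q.
  by apply: (der_eq dD) => // p _; rewrite !fctE mulN1r.
rewrite (derM dD) ?(der_cst dD) //; last exact: smooth_cst.
by rewrite mulr0 addr0 mulN1r.
Qed.

Lemma derB f g q : smooth_on U f -> smooth_on U g -> U q ->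
  D (f - g) q = D f q - D g q.
Proof. by move=> sf sg Uq; rewrite (derD dD) ?derN //; exact: smoothN. Qed.

Lemma derV f q : (forall p, U p -> f p != 0) -> smooth_on U f -> U q ->
  D (finv f) q = - (f q) ^- 2 * D f q.
Proof.
move=> f0 sf Uq; have sv := smoothV oU f0 sf.
have : D (f * finv f) q = D (cst 1) q.
  by apply: (der_eq dD) => // p Up; rewrite !fctE /finv mulfV ?f0.
rewrite (derM dD) // (der_cst dD) // => /eqP; rewrite addr_eq0 => /eqP E.
apply: (mulfI (f0 q Uq)); rewrite E /finv; field; exact: f0.
Qed.

Lemma smoothX f n : smooth_on U f -> smooth_on U (f ^+ n).
Proof.
move=> sf; elim: n => [|n IH]; first exact: smooth_cst.
by rewrite exprS; exact: smoothM.
Qed.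

Lemma derX f n q : smooth_on U f -> U q ->
  D (f ^+ n) q = n%:R * f q ^+ n.-1 * D f q.
Proof.
move=> sf Uq; elim: n => [|n IH].
  by rewrite !mul0r -[LHS]/(D (cst 1) q) (der_cst dD).
rewrite exprS (derM dD) ?IH //; last exact: smoothX.
have -> : (f ^+ n) q = f q ^+ n by elim: (n) => // m /= ih; rewrite !exprS fctE ih.
case: n IH => [|n] _ /=; rewrite ?exprS -?natr1; ring.
Qed.

Lemma smooth_sum n (F : nat -> R * R -> R) : (forall i, smooth_on U (F i)) ->
  smooth_on U (fun q => \sum_(i < n) F i q).
Proof.
move=> sF; elim: n => [|n IH].
  by apply: smooth_eq (smooth_cst U 0) => // q _; rewrite big_ord0.
apply: smooth_eq (smoothD oU IH (sF n)) => // q _.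
by rewrite big_ord_recr.
Qed.

Lemma der_sum n (F : nat -> R * R -> R) q : (forall i, smooth_on U (F i)) ->
  U q -> D (fun q => \sum_(i < n) F i q) q = \sum_(i < n) D (F i) q.
Proof.
move=> sF Uq; elim: n => [|n IH].
  rewrite big_ord0 -[RHS](der_cst dD 0 Uq); apply: (der_eq dD) => // p _.
  by rewrite big_ord0.
rewrite big_ord_recr /= -IH -(derD dD) //; last exact: smooth_sum.
by apply: (der_eq dD) => // p _; rewrite big_ord_recr.
Qed.

(** Applying D lowers the degree and multiplies the coefficient of x^(j+1) by j + 1, so induction
    kills all coefficients except the constant one, which the relation itself then kills. Neither
    integral curves of D nor a count of roots is involved, so U can be any open set. *)
Lemma poly_indep (x : R * R -> R) n (c : nat -> R * R -> R) :
  smooth_on U x -> (forall q, U q -> D x q = 1) ->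
  (forall i, smooth_on U (c i)) -> (forall i q, U q -> D (c i) q = 0) ->
  (forall q, U q -> \sum_(i < n) c i q * x q ^+ i = 0) ->
  forall i q, (i < n)%N -> U q -> c i q = 0.
Proof.
move=> sx Dx; have xX i q : (x ^+ i) q = x q ^+ i.
  by elim: i => // m /= ih; rewrite !exprS fctE ih.
elim: n c => [|n IH] // c sc Dc c0.
have cS i q : (i < n)%N -> U q -> c i.+1 q = 0.
  have sc' j : smooth_on U (cst j.+1%:R * c j.+1).
    by apply: smoothM => //; exact: smooth_cst.
  move=> ni Uq; have := IH (fun j => cst j.+1%:R * c j.+1) sc' _ _ i q ni Uq.
  rewrite !fctE => H; apply/eqP.
  suff /eqP : i.+1%:R * c i.+1 q = 0 by rewrite mulf_eq0 pnatr_eq0.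
  apply: H.
    move=> j p Up; rewrite (derM dD) //; last exact: smooth_cst.
    by rewrite Dc // (der_cst dD) // !mulr0 addr0.
  move=> p Up.
  have sF j : smooth_on U (c j * x ^+ j) by apply: smoothM => //; exact: smoothX.
  have : \sum_(j < n.+1) D (c j * x ^+ j) p = 0.
    rewrite -(@der_sum n.+1 (fun j => c j * x ^+ j) p sF Up).
    rewrite -[RHS](der_cst dD 0 Up); apply: (der_eq dD) => // r Ur.
    by apply: etrans (c0 r Ur); apply: eq_bigr => j _; rewrite !fctE.
  rewrite big_ord_recl.
  rewrite (derM dD) ?Dc ?derX //; last exact: smoothX.
  rewrite !mul0r !mulr0 !add0r => E; rewrite -[RHS]E; apply: eq_bigr => j _.
  rewrite (derM dD) ?Dc ?derX ?Dx //=; last exact: smoothX.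
  rewrite !fctE mulr0 addr0 mulr1 /bump /=; ring.
case=> [|i] q ni Uq; last exact: cS.
have := c0 q Uq; rewrite big_ord_recl /= expr0 mulr1 big1 ?addr0 // => i _.
by rewrite /bump /= add1n cS ?mul0r.
Qed.
End Rules.
End Derivations.

Ltac smooth_tac := repeat first
  [ assumption | exact: smooth_cst | by apply: der_smooth; eassumption
  | apply: smoothD | apply: smoothB | apply: smoothN | apply: smoothM | apply: smoothX
  | apply: smoothV ].

(** * The coordinates H and nu *)

Ltac derive_tac dD oV :=
  rewrite !(der_cst dD, derD dD, derB oV dD, derN dD, derM dD);
  try by [|smooth_tac].

Section AdaptedDirection.
Context {R : realType}.
Variables (V : set (R * R)) (D : (R * R -> R) -> R * R -> R).
Variables (i nu s l s1 E : R * R -> R) (k a : R).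
Hypotheses (oV : open V) (dD : derivation V D).
Hypotheses (si : smooth_on V i) (snu : smooth_on V nu) (ss : smooth_on V s)
  (sl : smooth_on V l) (ss1 : smooth_on V s1) (sE : smooth_on V E).
Hypotheses (i0 : forall q, V q -> i q != 0) (k0 : k != 0) (a0 : a != 0).
Hypotheses (Di : forall q, V q -> D i q = 0) (Dnu : forall q, V q -> D nu q = 1)
  (Ds : forall q, V q -> D s q = 2^-1 * i q ^+ 2)
  (Dl : forall q, V q -> D l q = - k * nu q * i q ^+ 3)
  (Ds1 : forall q, V q -> D s1 q = - i q ^+ 3)
  (DE : forall q, V q -> D E q = k * i q ^+ 2 * nu q * E q).
Hypothesis geod : forall q, V q ->
  E q * (s1 q + s q * l q - k * nu q * i q * s q ^+ 2) =
  i q * (a * (nu q - nu q ^+ 3)).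

(* D lowers the degree of P in nu, whereas it raises that of p, since D E is a
   multiple of nu E. *)
Let twist (P P' p p' : R * R -> R) : smooth_on V P -> smooth_on V p ->
  (forall q, V q -> D P q = P' q) ->
  (forall q, V q -> D p q - k * i q ^+ 2 * nu q * p q = p' q) ->
  (forall q, V q -> E q * P q = i q * p q) ->
  forall q, V q -> E q * P' q = i q * p' q.
Proof.
move=> sP sp DP Dp EP q Vq.
have : D (E * P) q = D (i * p) q by apply: (der_eq dD).
derive_tac dD oV; rewrite Di // DE // DP // -Dp //.
have := EP q Vq; rewrite mulr0 addr0 => h1 h2.
rewrite mulrBr -h2; apply/eqP; rewrite -subr_eq0; apply/eqP.
transitivity (k * i q ^+ 2 * nu q * (i q * p q - E q * P q)); first by ring.
by rewrite h1 subrr mulr0.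
Qed.

(** In the application D is d/dnu, i is 1/H, s is dt/dH, s1 is ds/dH and l is half of d(log E)/dH.
    By the hypotheses s and s1 are affine in nu and l is quadratic, so the factor of E in [geod] is
    cubic in nu. *)
Lemma adapted_direction_empty q : ~ V q.
Proof.
have sc (r : R) : smooth_on V (cst r : R * R -> R) by exact: smooth_cst.
(* Pj is the j-th derivative of P0 along D, and pj is the j-th iterate of p -> D p - b nu p applied
   to p0, with b = k i^2. P3 is free of nu, so one more step gives 0 = i p4. *)
pose P0 := s1 + s * l - cst k * nu * i * s * s.
pose P1 := - (i * i * i) + cst 2^-1 * l * (i * i) - cst (2 * k) * nu * (i * i * i) * s
  - cst k * i * s * s.
pose P2 := - cst (3 / 2 * k) * nu * (i * i * i * i * i) - cst (3 * k) * i * i * i * s.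
pose P3 := - cst (3 * k) * (i * i * i * i * i).
have [b [sb Db bE]] : exists b : R * R -> R, [/\ smooth_on V b,
    forall p, V p -> D b p = 0 & forall p, b p = k * i p ^+ 2].
  exists (cst k * i * i); split; first by smooth_tac.
    by move=> p Vp; derive_tac dD oV; rewrite Di //; ring.
  by move=> p; rewrite !fctE; ring.
pose p0 := cst a * (nu - nu * nu * nu).
pose p1 := cst a * (cst 1 - cst 3 * nu * nu - b * nu * nu + b * nu * nu * nu * nu).
pose p2 := cst a * (- (cst 6 + cst 3 * b) * nu + (cst 7 * b + b * b) * nu * nu * nu
   - b * b * nu * nu * nu * nu * nu).
pose p3 := cst a * (- (cst 6 + cst 3 * b) + (cst 27 * b + cst 6 * b * b) * nu * nu
   - (cst 12 * b * b + b * b * b) * nu * nu * nu * nu + b * b * b * nu * nu * nu * nu * nu * nu).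
(* The coefficients of p4 / a by degree in nu. The last one is (-b)^4 times -1, the coefficient of
   nu^3 in p0 / a. *)
pose c := [:: cst 0; cst 60 * b + cst 15 * b * b; cst 0;
   - (cst 75 * b * b + cst 10 * b * b * b); cst 0;
   cst 18 * b * b * b + b * b * b * b; cst 0; - (b * b * b * b)] : seq (R * R -> R).
pose p4 := fun q => a * \sum_(j < 8) nth (cst 0) c j q * nu q ^+ j.
have E0 p : V p -> E p * P0 p = i p * p0 p.
  by move=> Vp; rewrite /P0 /p0 !fctE -!(mulrA _ (s p)) -!mulrA -!expr2 -?exprS;
    have := geod Vp; rewrite !mulrA.
have E1 p : V p -> E p * P1 p = i p * p1 p.
  apply: (twist _ _ _ _ E0); rewrite ?/P0 ?/p0; try by smooth_tac.
    move=> r Vr; derive_tac dD oV.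
    rewrite Ds // Dl // Ds1 // Dnu // Di // /P1 !fctE; by field.
  move=> r Vr; rewrite -bE; derive_tac dD oV.
  rewrite Dnu // /p1 !fctE; by field.
have E2 p : V p -> E p * P2 p = i p * p2 p.
  apply: (twist _ _ _ _ E1); rewrite ?/P1 ?/p1; try by smooth_tac.
    move=> r Vr; derive_tac dD oV.
    rewrite Ds // Dl // Dnu // Di // /P2 !fctE; by field.
  move=> r Vr; rewrite -bE; derive_tac dD oV.
  rewrite Dnu // Db // /p2 !fctE; by field.
have E3 p : V p -> E p * P3 p = i p * p3 p.
  apply: (twist _ _ _ _ E2); rewrite ?/P2 ?/p2; try by smooth_tac.
    move=> r Vr; derive_tac dD oV.
    rewrite Ds // Dnu // Di // /P3 !fctE; by field.
  move=> r Vr; rewrite -bE; derive_tac dD oV.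
  rewrite Dnu // Db // /p3 !fctE; by field.
have E4 p : V p -> E p * cst 0 p = i p * p4 p.
  apply: (twist _ _ _ _ E3); rewrite ?/P3 ?/p3; try by smooth_tac.
    by move=> r Vr; derive_tac dD oV; rewrite Di // !fctE; ring.
  move=> r Vr; rewrite -bE; derive_tac dD oV.
  rewrite Dnu // Db // /p4 /c !big_ord_recl big_ord0 /= !fctE /bump /=; by field.
have sc' j : smooth_on V (nth (cst 0) c j).
  by do 8 (case: j => [|j]; first by rewrite /c /=; smooth_tac); rewrite nth_default.
have Dc j p : V p -> D (nth (cst 0) c j) p = 0.
  move=> Vp; do 8 (case: j => [|j]; first by rewrite /c /=; derive_tac dD oV; rewrite ?Db //; ring).
  by rewrite nth_default // (der_cst dD).
move=> Vq; have b4 : nth (cst 0) c 7 q = 0.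
  apply: (poly_indep oV dD snu Dnu sc' Dc (n := 8)) => // p Vp.
  have := E4 p Vp; rewrite mulr0 /p4 => /esym/eqP.
  by rewrite !mulf_eq0 (negbTE a0) (negbTE (i0 Vp)) => /eqP.
move/eqP: b4; rewrite /c /= !fctE oppr_eq0 bE !mulf_eq0 (negbTE k0) (negbTE (i0 Vq)).
by [].
Qed.
End AdaptedDirection.

Section CoordinatePatch.
Context {R : realType}.
Variables (V : set (R * R)) (D1 D2 : (R * R -> R) -> R * R -> R).
Variables (H nu t E : R * R -> R) (k e : R).
Hypotheses (oV : open V) (dD1 : derivation V D1) (dD2 : derivation V D2).
Hypothesis D12 : forall (f : R * R -> R) q, smooth_on V f -> V q -> D2 (D1 f) q = D1 (D2 f) q.
Hypotheses (sH : smooth_on V H) (snu : smooth_on V nu) (st : smooth_on V t)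
  (sE : smooth_on V E).
Hypotheses (H0 : forall q, V q -> H q != 0) (E0 : forall q, V q -> E q != 0).
Hypotheses (k0 : k != 0) (e0 : e != 0).
Hypotheses (D1H : forall q, V q -> D1 H q = 1) (D2H : forall q, V q -> D2 H q = 0)
  (D1nu : forall q, V q -> D1 nu q = 0) (D2nu : forall q, V q -> D2 nu q = 1)
  (D2t : forall q, V q -> D2 t q = - 2^-1 * (H q)^-1)
  (D2E : forall q, V q -> D2 E q = k * (H q)^-1 ^+ 2 * nu q * E q).
Hypothesis geod : forall q, V q -> E q * D1 (D1 t) q + 2^-1 * D1 t q * D1 E q
  + k * nu q * (H q)^-1 * (e * (1 - nu q ^+ 2) - D1 t q ^+ 2 * E q) = 0.

(** D1 and D2 stand for d/dH and d/dnu. Since they commute, the known dependence of t and E on nu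
    passes to their H-derivatives: d/dnu (dt/dH) is d/dH (-1/(2H)). The hypothesis [geod] is Hess t
    (grad H, grad H) = 0, with |grad nu|^2 eliminated through |grad t|^2 = e (1 - nu^2). *)
Lemma coordinate_patch_empty q : ~ V q.
Proof.
have sc (r : R) : smooth_on V (cst r : R * R -> R) by exact: smooth_cst.
have [i [si D1i D2i iE]] : exists i : R * R -> R, [/\ smooth_on V i,
    forall p, V p -> D1 i p = - i p ^+ 2, forall p, V p -> D2 i p = 0 &
    forall p, i p = (H p)^-1].
  exists (finv H); split=> //; first exact: smoothV.
    by move=> p Vp; rewrite (derV oV dD1) // D1H // mulr1 exprVn.
  by move=> p Vp; rewrite (derV oV dD2) // D2H // mulr0.
have [j [sj D2j jE]] : exists j : R * R -> R, [/\ smooth_on V j,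
    forall p, V p -> D2 j p = - j p ^+ 2 * D2 E p & forall p, j p = (E p)^-1].
  exists (finv E); split=> //; first exact: smoothV.
  by move=> p Vp; rewrite (derV oV dD2) // exprVn.
have i0 p : V p -> i p != 0 by move=> Vp; rewrite iE invr_eq0 H0.
have jE1 p : V p -> E p * j p = 1 by move=> Vp; rewrite jE mulfV ?E0.
have [s sE1] : exists s, s = D1 t by exists (D1 t).
have ss : smooth_on V s by rewrite sE1; exact: der_smooth st.
have [m mE] : exists m, m = D1 E by exists (D1 E).
have sm : smooth_on V m by rewrite mE; exact: der_smooth sE.
have [s1 s1E] : exists s1, s1 = D1 s by exists (D1 s).
have ss1 : smooth_on V s1 by rewrite s1E; exact: der_smooth ss.
have D2s p : V p -> D2 s p = 2^-1 * i p ^+ 2.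
  move=> Vp; rewrite sE1 D12 //.
  have -> : D1 (D2 t) p = D1 (cst (- 2^-1) * i) p.
    by apply: (der_eq dD1) => // r Vr; rewrite D2t // !fctE iE.
  by derive_tac dD1 oV; rewrite D1i // !fctE; ring.
have D2s1 p : V p -> D2 s1 p = - i p ^+ 3.
  move=> Vp; rewrite s1E D12 //.
  have -> : D1 (D2 s) p = D1 (cst 2^-1 * (i * i)) p.
    by apply: (der_eq dD1) => // r Vr; rewrite D2s // !fctE; ring.
  by derive_tac dD1 oV; rewrite D1i // !fctE; field.
have D2E' p : V p -> D2 E p = k * i p ^+ 2 * nu p * E p.
  by move=> Vp; rewrite D2E // iE.
have D2m p : V p -> D2 m p = k * nu p * (i p ^+ 2 * m p - 2 * i p ^+ 3 * E p).
  move=> Vp; rewrite mE D12 //.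
  have -> : D1 (D2 E) p = D1 (cst k * (i * i) * nu * E) p.
    by apply: (der_eq dD1) => // r Vr; rewrite D2E' // !fctE; ring.
  by derive_tac dD1 oV; rewrite D1i // D1nu // -mE !fctE; ring.
(* Half the logarithmic derivative of E in H: unlike that of dE/dH, its nu-derivative no longer
   involves E. *)
pose l := cst 2^-1 * m * j.
have D2l p : V p -> D2 l p = - k * nu p * i p ^+ 3.
  move=> Vp; rewrite /l; derive_tac dD2 oV; rewrite D2m // D2j // D2E' // !fctE.
  have jj := jE1 p Vp; transitivity (2^-1 * k * nu p *
    (i p ^+ 2 * m p * j p - 2 * i p ^+ 3 * (E p * j p) - m p * j p * i p ^+ 2 * (E p * j p))).
    by field.
  by rewrite jj; field.
have sl : smooth_on V l by rewrite /l; smooth_tac.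
apply: (adapted_direction_empty (D := D2) (i := i) (nu := nu) (s := s) (l := l)
  (s1 := s1) (E := E) (k := k) (a := - (e * k))) => //.
  by rewrite oppr_eq0 mulf_neq0.
move=> p Vp; have := geod Vp; rewrite -sE1 -s1E -mE -iE => h.
apply/eqP; rewrite -subr_eq0; apply/eqP.
have jj := jE1 p Vp; rewrite /l !fctE; transitivity (E p * s1 p +
  2^-1 * s p * m p * (E p * j p) + k * nu p * i p * (e * (1 - nu p ^+ 2) - s p ^+ 2 * E p)).
  by ring.
by rewrite jj mulr1 -h.
Qed.
End CoordinatePatch.

(** * Structure equations *)

(** Certificates for polynomial consequences: each application subtracts c times a known equation
    from the goal, until an identity for [ring] or [field] remains. When the goal follows only up to
    a nonzero factor, [mulfI] introduces that factor first. *)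
Lemma lin_comb (R : pzRingType) (l r c x y : R) :
  l = r -> x - y - c * (l - r) = 0 -> x = y.
Proof. by move=> ->; rewrite subrr mulr0 subr0 => /eqP; rewrite subr_eq0 => /eqP. Qed.

Lemma open_neq0 {R : realType} (U : set (R * R)) (f : R * R -> R) :
  open U -> smooth_on U f -> open [set q | U q /\ f q != 0].
Proof.
move=> oU sf; rewrite openE => q [Uq fq].
near=> p; split; first by near: p; exact: open_nbhs_nbhs.
near: p; have cf := smooth_continuous sf Uq.
by apply: (cf [set x | x != 0]); exact: (open_nbhs_nbhs (conj (@open_neq _ 0) fq)).
Unshelve. all: by end_near. Qed.

Section SurfaceEquations.
Context {R : realType}.
Variables (Du Dv : (R * R -> R) -> R * R -> R) (eps kap : R).

(* lam is the conformal factor, L, M, N are the coefficients of h^1, t is the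
   height and nu the R-component of n_1. *)
Record surface_equations (U : set (R * R)) (lam L M N t nu H : R * R -> R) : Prop :=
  SurfaceEquations {
  se_open : open U;
  se_du : forall V, open V -> derivation V Du;
  se_dv : forall V, open V -> derivation V Dv;
  se_swap : forall V (f : R * R -> R) q, open V -> smooth_on V f -> V q ->
    Dv (Du f) q = Du (Dv f) q;
  se_lam : smooth_on U lam; se_L : smooth_on U L; se_M : smooth_on U M;
  se_N : smooth_on U N; se_t : smooth_on U t; se_nu : smooth_on U nu;
  se_H : smooth_on U H;
  se_lam0 : forall q, U q -> 0 < lam q;
  se_trace : forall q, U q -> L q + N q = 2 * lam q * H q;
  se_codazzi1 : forall q, U q ->
    Dv L q - Du M q = H q * Dv lam q - kap * eps * nu q * lam q * Dv t q;
  se_codazzi2 : forall q, U q ->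
    Du N q - Dv M q = H q * Du lam q - kap * eps * nu q * lam q * Du t q;
  se_hess_uu : forall q, U q -> 2 * lam q * Du (Du t) q =
    Du lam q * Du t q - Dv lam q * Dv t q + 2 * lam q * eps * nu q * L q;
  se_hess_uv : forall q, U q -> 2 * lam q * Du (Dv t) q =
    Dv lam q * Du t q + Du lam q * Dv t q + 2 * lam q * eps * nu q * M q;
  se_hess_vv : forall q, U q -> 2 * lam q * Dv (Dv t) q =
    - Du lam q * Du t q + Dv lam q * Dv t q + 2 * lam q * eps * nu q * N q;
  se_weingarten_u : forall q, U q -> lam q * Du nu q = - (L q * Du t q + M q * Dv t q);
  se_weingarten_v : forall q, U q -> lam q * Dv nu q = - (M q * Du t q + N q * Dv t q);
  se_norm_t : forall q, U q ->
    Du t q ^+ 2 + Dv t q ^+ 2 = eps * lam q * (1 - nu q ^+ 2) }.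

Lemma surface_equations_sub U V lam L M N t nu H : open V -> V `<=` U ->
  surface_equations U lam L M N t nu H -> surface_equations V lam L M N t nu H.
Proof.
move=> oV VU [oU dDu dDv swap slam sL sM sN st snu sH lam0 tr c1 c2 h1 h2 h3 w1 w2 nt].
by split=> //; (try exact: smooth_sub VU _) => q /VU; auto.
Qed.
End SurfaceEquations.

(** * Consequences of II(grad H, .) = 0 where dH <> 0 *)

Section GradientEquations.
Context {R : realType}.
Variables (U : set (R * R)) (Du Dv : (R * R -> R) -> R * R -> R).
Variables (lam L M N t nu H : R * R -> R) (eps kap : R).
Hypothesis eqs : surface_equations Du Dv eps kap U lam L M N t nu H.
Hypotheses (kernel1 : forall q, U q -> Du H q * L q + Dv H q * M q = 0)
  (kernel2 : forall q, U q -> Du H q * M q + Dv H q * N q = 0).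
Hypothesis dH0 : forall q, U q -> Du H q ^+ 2 + Dv H q ^+ 2 != 0.

Let oU := se_open eqs.
Let dDu : derivation U Du := se_du eqs oU.
Let dDv : derivation U Dv := se_dv eqs oU.
Let Dvu (f : R * R -> R) q (sf : smooth_on U f) (Uq : U q) := se_swap eqs oU sf Uq.
Let slam := se_lam eqs.
Let sL := se_L eqs.
Let sM := se_M eqs.
Let sN := se_N eqs.
Let st := se_t eqs.
Let snu := se_nu eqs.
Let sH := se_H eqs.
Let lam0 q (Uq : U q) : lam q != 0 := lt0r_neq0 (se_lam0 eqs Uq).

(** E is |grad H|^2 and s is <grad t, grad H> / E. They are characterized by equations without
    quotients, so that differentiating them produces polynomial identities. *)
Variables (E s : R * R -> R).
Hypotheses (sE : smooth_on U E) (ss : smooth_on U s).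
Hypotheses (E_def : forall q, U q -> lam q * E q = Du H q ^+ 2 + Dv H q ^+ 2)
  (s_def : forall q, U q -> lam q * E q * s q = Du t q * Du H q + Dv t q * Dv H q).

Let W q := Du H q * Dv t q - Dv H q * Du t q.

Let E0 q : U q -> E q != 0.
Proof. by move=> Uq; apply: contraNneq (dH0 Uq) => E0; rewrite -E_def // E0 mulr0. Qed.

Let sHu : smooth_on U (Du H). Proof. exact: der_smooth. Qed.
Let sHv : smooth_on U (Dv H). Proof. exact: der_smooth. Qed.
Let stu : smooth_on U (Du t). Proof. exact: der_smooth. Qed.
Let stv : smooth_on U (Dv t). Proof. exact: der_smooth. Qed.

(** A form of trace 2 lam H with grad H in its kernel is determined: E h^1 = 2 H (Hv du - Hu dv)^2.
    This identity and the next two are its coefficients. *)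
Let EL q : U q -> E q * L q = 2 * H q * Dv H q ^+ 2.
Proof.
move=> Uq; apply: (mulfI (lam0 Uq)).
apply: (lin_comb (c := L q) (E_def Uq)).
apply: (lin_comb (c := Du H q) (kernel1 Uq)); apply: (lin_comb (c := - Dv H q) (kernel2 Uq)).
apply: (lin_comb (c := Dv H q ^+ 2) (se_trace eqs Uq)); ring.
Qed.

Let EM q : U q -> E q * M q = - 2 * H q * Du H q * Dv H q.
Proof.
move=> Uq; apply: (mulfI (lam0 Uq)).
apply: (lin_comb (c := M q) (E_def Uq)).
apply: (lin_comb (c := Dv H q) (kernel1 Uq)); apply: (lin_comb (c := Du H q) (kernel2 Uq)).
apply: (lin_comb (c := - Du H q * Dv H q) (se_trace eqs Uq)); ring.
Qed.

Let EN q : U q -> E q * N q = 2 * H q * Du H q ^+ 2.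
Proof.
move=> Uq; apply: (mulfI (lam0 Uq)).
apply: (lin_comb (c := N q) (E_def Uq)).
apply: (lin_comb (c := - Du H q) (kernel1 Uq)); apply: (lin_comb (c := Dv H q) (kernel2 Uq)).
apply: (lin_comb (c := Du H q ^+ 2) (se_trace eqs Uq)); ring.
Qed.

Let dE (D : (R * R -> R) -> R * R -> R) q : derivation U D -> U q ->
  D lam q * E q + lam q * D E q = 2 * Du H q * D (Du H) q + 2 * Dv H q * D (Dv H) q.
Proof.
move=> dD Uq; have : D (lam * E) q = D (Du H * Du H + Dv H * Dv H) q.
  by apply: (der_eq dD) => // p Up; rewrite !fctE E_def // !expr2.
derive_tac dD oU => h; apply: (lin_comb (c := 1) h); ring.
Qed.

Let dEL (D : (R * R -> R) -> R * R -> R) q : derivation U D -> U q ->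
  D E q * L q + E q * D L q = 2 * D H q * Dv H q ^+ 2 + 4 * H q * Dv H q * D (Dv H) q.
Proof.
move=> dD Uq; have : D (E * L) q = D (cst 2 * H * Dv H * Dv H) q.
  by apply: (der_eq dD) => // p Up; rewrite !fctE EL // expr2 !mulrA.
derive_tac dD oU => h; apply: (lin_comb (c := 1) h); rewrite !fctE; ring.
Qed.

Let dEM (D : (R * R -> R) -> R * R -> R) q : derivation U D -> U q ->
  D E q * M q + E q * D M q = - 2 * D H q * Du H q * Dv H q
  - 2 * H q * D (Du H) q * Dv H q - 2 * H q * Du H q * D (Dv H) q.
Proof.
move=> dD Uq; have : D (E * M) q = D (cst (- 2) * H * Du H * Dv H) q.
  by apply: (der_eq dD) => // p Up; rewrite !fctE EM.
derive_tac dD oU => h; apply: (lin_comb (c := 1) h); rewrite !fctE; ring.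
Qed.

Let dEN (D : (R * R -> R) -> R * R -> R) q : derivation U D -> U q ->
  D E q * N q + E q * D N q = 2 * D H q * Du H q ^+ 2 + 4 * H q * Du H q * D (Du H) q.
Proof.
move=> dD Uq; have : D (E * N) q = D (cst 2 * H * Du H * Du H) q.
  by apply: (der_eq dD) => // p Up; rewrite !fctE EN // expr2 !mulrA.
derive_tac dD oU => h; apply: (lin_comb (c := 1) h); rewrite !fctE; ring.
Qed.

Let ds (D : (R * R -> R) -> R * R -> R) q : derivation U D -> U q ->
  D lam q * E q * s q + lam q * D E q * s q + lam q * E q * D s q =
  D (Du t) q * Du H q + Du t q * D (Du H) q + D (Dv t) q * Dv H q + Dv t q * D (Dv H) q.
Proof.
move=> dD Uq; have : D (lam * E * s) q = D (Du t * Du H + Dv t * Dv H) q.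
  by apply: (der_eq dD) => // p Up; rewrite !fctE s_def.
derive_tac dD oU => h; apply: (lin_comb (c := 1) h); rewrite !fctE; ring.
Qed.

(** grad nu is minus the shape operator applied to grad t, and the range of that operator is
    orthogonal to its kernel direction grad H. Hence nu varies only across grad H, at a rate
    proportional to H W. *)
Lemma nabla_nu_u q : U q -> lam q * E q * Du nu q = 2 * H q * W q * Dv H q.
Proof.
move=> Uq; apply: (lin_comb (c := E q) (se_weingarten_u eqs Uq)).
apply: (lin_comb (c := - Du t q) (EL Uq)); apply: (lin_comb (c := - Dv t q) (EM Uq)).
rewrite /W; ring.
Qed.

Lemma nabla_nu_v q : U q -> lam q * E q * Dv nu q = - 2 * H q * W q * Du H q.
Proof.
move=> Uq; apply: (lin_comb (c := E q) (se_weingarten_v eqs Uq)).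
apply: (lin_comb (c := - Du t q) (EM Uq)); apply: (lin_comb (c := - Dv t q) (EN Uq)).
rewrite /W; ring.
Qed.

Let codazzi_E1 q : U q ->
  2 * Dv H q * (lam q * E q) + 2 * H q * Dv H q * (Du (Du H) q + Dv (Dv H) q)
  - Dv E q * L q + Du E q * M q + H q * lam q * Dv E q
  = - kap * eps * nu q * lam q * E q * Dv t q.
Proof.
move=> Uq; apply: (lin_comb (c := E q) (se_codazzi1 eqs Uq)).
apply: (lin_comb (c := -1) (dEL dDv Uq)); apply: (lin_comb (c := 1) (dEM dDu Uq)).
apply: (lin_comb (c := H q) (dE dDv Uq)); apply: (lin_comb (c := 2 * Dv H q) (E_def Uq)).
by rewrite (Dvu sH Uq); ring.
Qed.

Let codazzi_E2 q : U q ->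
  2 * Du H q * (lam q * E q) + 2 * H q * Du H q * (Du (Du H) q + Dv (Dv H) q)
  - Du E q * N q + Dv E q * M q + H q * lam q * Du E q
  = - kap * eps * nu q * lam q * E q * Du t q.
Proof.
move=> Uq; apply: (lin_comb (c := E q) (se_codazzi2 eqs Uq)).
apply: (lin_comb (c := -1) (dEN dDu Uq)); apply: (lin_comb (c := 1) (dEM dDv Uq)).
apply: (lin_comb (c := H q) (dE dDu Uq)); apply: (lin_comb (c := 2 * Du H q) (E_def Uq)).
by rewrite (Dvu sH Uq); ring.
Qed.

(** In the combination of the Codazzi equations across grad H, the second derivatives of H cancel.
    This gives dE/dnu. *)
Lemma codazzi_across q : U q ->
  H q * (Du H q * Dv E q - Dv H q * Du E q) = - kap * eps * nu q * E q * W q.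
Proof.
move=> Uq; apply: (mulfI (lam0 Uq)).
apply: (lin_comb (c := Du H q) (codazzi_E1 Uq)).
apply: (lin_comb (c := - Dv H q) (codazzi_E2 Uq)).
apply: (lin_comb (c := Dv E q) (kernel1 Uq)); apply: (lin_comb (c := - Du E q) (kernel2 Uq)).
rewrite /W; ring.
Qed.

(** The combination along grad H keeps the Laplacian of H, which [gradient_norm] will trade for that
    of t. *)
Lemma codazzi_along q : U q ->
  2 * lam q * E q ^+ 2 + 2 * H q * E q * (Du (Du H) q + Dv (Dv H) q)
  - H q * (Du H q * Du E q + Dv H q * Dv E q)
  = - kap * eps * nu q * E q * (Du t q * Du H q + Dv t q * Dv H q).
Proof.
move=> Uq; apply: (mulfI (lam0 Uq)).
apply: (lin_comb (c := Du H q) (codazzi_E2 Uq)).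
apply: (lin_comb (c := Dv H q) (codazzi_E1 Uq)).
apply: (lin_comb (c := 2 * lam q * E q + 2 * H q * (Du (Du H) q + Dv (Dv H) q)) (E_def Uq)).
apply: (lin_comb (c := - Dv E q) (kernel2 Uq)); apply: (lin_comb (c := - Du E q) (kernel1 Uq)).
apply: (lin_comb (c := Dv E q * Dv H q + Du E q * Du H q) (se_trace eqs Uq)).
ring.
Qed.

(** Hess t = eps nu h^1 and h^1(grad H, .) = 0, so Hess t (grad H, grad H) = 0. Differentiate <grad
    t, grad H> = E s along grad H and use Hess H (grad H, .) = dE / 2. *)
Lemma hessian_along q : U q ->
  E q * (Du s q * Du H q + Dv s q * Dv H q) =
  2^-1 * (Du t q * Du E q + Dv t q * Dv E q) - s q * (Du H q * Du E q + Dv H q * Dv E q).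
Proof.
move=> Uq; have two : (2 : R) != 0 by rewrite pnatr_eq0.
apply: (mulfI (lam0 Uq)); apply: (mulfI (lam0 Uq)); apply: (mulfI two).
apply: (lin_comb (c := 2 * lam q * Du H q) (ds dDu Uq)).
apply: (lin_comb (c := 2 * lam q * Dv H q) (ds dDv Uq)).
apply: (lin_comb (c := Du H q ^+ 2) (se_hess_uu eqs Uq)).
apply: (lin_comb (c := 2 * Du H q * Dv H q) (se_hess_uv eqs Uq)).
apply: (lin_comb (c := Dv H q ^+ 2) (se_hess_vv eqs Uq)).
apply: (lin_comb (c := 2 * lam q * eps * nu q * Du H q) (kernel1 Uq)).
apply: (lin_comb (c := 2 * lam q * eps * nu q * Dv H q) (kernel2 Uq)).
apply: (lin_comb (c := - lam q * Du t q) (dE dDu Uq)).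
apply: (lin_comb (c := - lam q * Dv t q) (dE dDv Uq)).
apply: (lin_comb (c := Du lam q * Du t q + Dv lam q * Dv t q) (E_def Uq)).
apply: (lin_comb (c := - 2 * (Du lam q * Du H q + Dv lam q * Dv H q)) (s_def Uq)).
by rewrite (Dvu sH Uq) (Dvu st Uq); field.
Qed.

End GradientEquations.

(** * The derivations dual to two independent differentials *)

Section CoordinateFields.
Context {R : realType}.
Variables (V : set (R * R)) (Du Dv : (R * R -> R) -> R * R -> R) (x y : R * R -> R).
Hypotheses (oV : open V) (dDu : derivation V Du) (dDv : derivation V Dv).
Hypothesis swap : forall (f : R * R -> R) q, smooth_on V f -> V q -> Dv (Du f) q = Du (Dv f) q.
Hypotheses (sx : smooth_on V x) (sy : smooth_on V y).

Let J := Du x * Dv y - Dv x * Du y.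
Hypothesis J0 : forall q, V q -> J q != 0.

Let sxu : smooth_on V (Du x). Proof. exact: der_smooth. Qed.
Let sxv : smooth_on V (Dv x). Proof. exact: der_smooth. Qed.
Let syu : smooth_on V (Du y). Proof. exact: der_smooth. Qed.
Let syv : smooth_on V (Dv y). Proof. exact: der_smooth. Qed.
Let sJ : smooth_on V J. Proof. by rewrite /J; smooth_tac. Qed.

(** Cramer's rule; the two fields commute because mixed derivatives of x, y and f are symmetric. The
    pair (x, y) may fail to be injective on V. *)
Lemma coordinate_fields : exists D1 D2 : (R * R -> R) -> R * R -> R,
  [/\ derivation V D1, derivation V D2,
      forall (f : R * R -> R) q, smooth_on V f -> V q -> D2 (D1 f) q = D1 (D2 f) q,
      forall f q, V q -> J q * D1 f q = Du f q * Dv y q - Dv f q * Du y q &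
      forall f q, V q -> J q * D2 f q = Du x q * Dv f q - Dv x q * Du f q].
Proof.
have [i [si iJ Di]] : exists i : R * R -> R, [/\ smooth_on V i, forall q, V q -> J q * i q = 1 &
    forall D q, derivation V D -> V q -> D i q = - i q ^+ 2 *
      (D (Du x) q * Dv y q + Du x q * D (Dv y) q - D (Dv x) q * Du y q - Dv x q * D (Du y) q)].
  exists (finv J); split; first exact: smoothV.
    by move=> q Vq; rewrite /finv mulfV ?J0.
  move=> D q dD Vq; rewrite (derV oV dD) // exprVn; congr (_ * _).
  by rewrite /J; derive_tac dD oV; ring.
exists (fun f => i * Dv y * Du f + (- (i * Du y)) * Dv f).
exists (fun f => - (i * Dv x) * Du f + i * Du x * Dv f).
split.
- by apply: derivation_comb => //; smooth_tac.
- by apply: derivation_comb => //; smooth_tac.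
- move=> f q sf Vq.
  have sfu : smooth_on V (Du f) by exact: der_smooth sf.
  have sfv : smooth_on V (Dv f) by exact: der_smooth sf.
  rewrite !fctE; derive_tac dDu oV; derive_tac dDv oV.
  rewrite (Di Du) // (Di Dv) // (swap sx Vq) (swap sy Vq) (swap sf Vq).
  have := J0 Vq; have := iJ q Vq; rewrite /J !fctE => iJq Jq.
  have -> : i q = (Du x q * Dv y q - Dv x q * Du y q)^-1.
    by apply: (mulfI Jq); rewrite iJq mulfV.
  field; exact: Jq.
- move=> f q Vq; rewrite !fctE.
  by apply: (lin_comb (c := Du f q * Dv y q - Dv f q * Du y q) (iJ q Vq)); ring.
- move=> f q Vq; rewrite !fctE.
  by apply: (lin_comb (c := Du x q * Dv f q - Dv x q * Du f q) (iJ q Vq)); ring.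
Qed.
End CoordinateFields.

(** * Parallel gradients and the norm of grad H *)

Section Kernel.
Context {R : realType}.
Variables (U : set (R * R)) (Du Dv : (R * R -> R) -> R * R -> R).
Variables (lam L M N t nu H : R * R -> R) (eps kap : R).
Hypotheses (eps2 : eps ^+ 2 = 1) (kap0 : kap != 0).
Hypothesis eqs : surface_equations Du Dv eps kap U lam L M N t nu H.
Hypotheses (kernel1 : forall q, U q -> Du H q * L q + Dv H q * M q = 0)
  (kernel2 : forall q, U q -> Du H q * M q + Dv H q * N q = 0).

Let Wf := Du H * Dv t - Dv H * Du t.

(** The Jacobian of (H, nu) is -2 H W, so where H W <> 0 the fields d/dH and d/dnu exist, and they
    meet the hypotheses refuted in [coordinate_patch_empty]. The zeros of H are dealt with
    afterwards. *)
Let gradients_parallel_aux q : ~ [/\ U q, Wf q != 0 & H q != 0].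
Proof.
pose V := [set q | ([set q | U q /\ Wf q != 0]) q /\ H q != 0].
have oU := se_open eqs; have dDuU := se_du eqs oU; have dDvU := se_dv eqs oU.
have sH := se_H eqs; have st := se_t eqs.
have sWf : smooth_on U Wf.
  rewrite /Wf; apply: smoothB => //; apply: smoothM => //;
  first [exact: der_smooth dDuU _ _ | exact: der_smooth dDvU _ _].
have oV0 : open [set q | U q /\ Wf q != 0] by exact: open_neq0.
have oV : open V.
  by apply: open_neq0 => //; apply: smooth_sub sH => p [].
have VU : V `<=` U by move=> p [[]].
have eV := surface_equations_sub oV VU eqs.
have W0 p : V p -> Du H p * Dv t p - Dv H p * Du t p != 0 by case=> -[].
have H0 p : V p -> H p != 0 by case.
have k1 p : V p -> Du H p * L p + Dv H p * M p = 0 by move/VU/kernel1.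
have k2 p : V p -> Du H p * M p + Dv H p * N p = 0 by move/VU/kernel2.
suff nV p : ~ V p by case=> Uq Wq Hq; apply: (nV q).
have dDu := se_du eqs oV; have dDv := se_dv eqs oV.
have swap := fun f q sf Vq => @se_swap _ _ _ _ _ _ _ _ _ _ _ _ _ eqs V f q oV sf Vq.
have dH0 r : V r -> Du H r ^+ 2 + Dv H r ^+ 2 != 0.
  move=> Vr; have := W0 r Vr; apply: contraNneq.
  by move/eqP; rewrite paddr_eq0 ?sqr_ge0// !sqrf_eq0 => /andP[/eqP -> /eqP ->];
    rewrite !mul0r subrr.
have lam0 r : V r -> lam r != 0 by move=> Vr; exact: lt0r_neq0 (se_lam0 eV Vr).
have slam := se_lam eV.
have sHu : smooth_on V (Du H) by exact: der_smooth (se_H eV).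
have sHv : smooth_on V (Dv H) by exact: der_smooth (se_H eV).
have [E [sE E_def]] : exists E : R * R -> R, smooth_on V E /\ forall r, V r ->
  lam r * E r = Du H r ^+ 2 + Dv H r ^+ 2.
  exists ((Du H * Du H + Dv H * Dv H) * finv lam); split.
    by apply: smoothM => //; [smooth_tac|exact: smoothV].
  by move=> r Vr; rewrite !fctE /finv mulrC divfK ?lam0 // !expr2.
have E0 r : V r -> E r != 0.
  by move=> Vr; apply: contraNneq (dH0 r Vr) => E0; rewrite -E_def // E0 mulr0.
have nuu := nabla_nu_u eV k1 k2 E_def.
have nuv := nabla_nu_v eV k1 k2 E_def.
have JE r : V r -> Du H r * Dv nu r - Dv H r * Du nu r =
    - 2 * H r * (Du H r * Dv t r - Dv H r * Du t r).
  move=> Vr; apply: (mulfI (mulf_neq0 (lam0 r Vr) (E0 r Vr))).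
  apply: (lin_comb (c := Du H r) (nuv r Vr)); apply: (lin_comb (c := - Dv H r) (nuu r Vr)).
  apply: (lin_comb (c := 2 * H r * (Du H r * Dv t r - Dv H r * Du t r)) (E_def r Vr)); ring.
have two : (2 : R) != 0 by rewrite pnatr_eq0.
have m2 : - (2 : R) != 0 by rewrite oppr_eq0.
have J0 r : V r -> (Du H * Dv nu - Dv H * Du nu) r != 0.
  by move=> Vr; rewrite !fctE JE // !mulf_neq0 ?oppr_eq0 ?H0 ?W0.
have [D1 [D2 [dD1 dD2 D12 D1E D2E]]] := coordinate_fields oV dDu dDv swap (se_H eV) (se_nu eV) J0.
(* As grad nu is orthogonal to grad H, d/dH is grad H / |grad H|^2. *)
have D1S f r : V r -> lam r * E r * D1 f r = Du H r * Du f r + Dv H r * Dv f r.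
  move=> Vr; have := D1E f r Vr; rewrite !fctE JE // => h.
  have c0 : - 2 * H r * (Du H r * Dv t r - Dv H r * Du t r) != 0.
    by rewrite !mulf_neq0 ?oppr_eq0 ?H0 ?W0.
  apply: (mulfI c0); apply: (lin_comb (c := lam r * E r) h).
  apply: (lin_comb (c := Du f r) (nuv r Vr)); apply: (lin_comb (c := - Dv f r) (nuu r Vr)); ring.
have D2W f r : V r -> - 2 * H r * (Du H r * Dv t r - Dv H r * Du t r) * D2 f r =
    Du H r * Dv f r - Dv H r * Du f r.
  by move=> Vr; have := D2E f r Vr; rewrite !fctE JE.
have [s sE1] : exists s, s = D1 t by exists (D1 t).
have ss : smooth_on V s by rewrite sE1; exact: der_smooth (se_t eV).
have s_def r : V r -> lam r * E r * s r = Du t r * Du H r + Dv t r * Dv H r.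
  by move=> Vr; rewrite sE1 D1S // !(mulrC (_ H r)).
have across := codazzi_across eV k1 k2 sE E_def.
have along := hessian_along eV k1 k2 sE ss E_def s_def.
apply: (coordinate_patch_empty (V := V) (D1 := D1) (D2 := D2) (H := H) (nu := nu)
  (t := t) (E := E) (k := kap * eps / 2) (e := eps)) => //; try by case: eV.
- by rewrite !mulf_neq0 ?invr_eq0 //; apply: contra_eq_neq eps2 => ->;
  rewrite expr0n eq_sym oner_eq0.
- by apply: contra_eq_neq eps2 => ->; rewrite expr0n eq_sym oner_eq0.
- move=> r Vr; apply: (mulfI (mulf_neq0 (lam0 r Vr) (E0 r Vr))).
  by rewrite D1S // mulr1 E_def.
- move=> r Vr; apply: (mulfI (mulf_neq0 (mulf_neq0 m2 (H0 r Vr)) (W0 r Vr))).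
  by rewrite D2W //; ring.
- move=> r Vr; apply: (mulfI (mulf_neq0 (lam0 r Vr) (E0 r Vr))).
  rewrite D1S //; apply: (mulfI (mulf_neq0 (lam0 r Vr) (E0 r Vr))).
  apply: (lin_comb (c := Du H r) (nuu r Vr)); apply: (lin_comb (c := Dv H r) (nuv r Vr)); ring.
- move=> r Vr; have := D2E nu r Vr; have := J0 r Vr; rewrite !fctE => h1 h2.
  by apply: (mulfI h1); rewrite h2 mulr1.
- move=> r Vr; have HH : (H r)^-1 * H r = 1 by rewrite mulVf ?H0.
  apply: (mulfI (mulf_neq0 (mulf_neq0 m2 (H0 r Vr)) (W0 r Vr))).
  rewrite D2W //; apply: (lin_comb (c := - (Du H r * Dv t r - Dv H r * Du t r)) HH);
    move: (H r)^-1 => hi; by field.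
- move=> r Vr; have HH : (H r)^-1 * H r = 1 by rewrite mulVf ?H0.
  apply: (mulfI (H0 r Vr)).
  apply: (mulfI (mulf_neq0 (mulf_neq0 m2 (H0 r Vr)) (W0 r Vr))).
  apply: (lin_comb (c := H r) (D2W E r Vr)); apply: (lin_comb (c := 1) (across r Vr)).
  apply: (lin_comb (c := (kap * eps * nu r * E r) * (Du H r * Dv t r - Dv H r * Du t r) *
    ((H r)^-1 * H r + 1)) HH); move: (H r)^-1 => hi; by field.
(* This is [hessian_along], with <grad t, grad E> split along and across grad H. By [codazzi_across]
   the part across brings in W^2, which Lagrange's identity expresses through |grad t|^2, |grad H|^2
   and <grad t, grad H>. *)
move=> r Vr; rewrite -sE1; have HH : (H r)^-1 * H r = 1 by rewrite mulVf ?H0.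
apply: (mulfI (mulf_neq0 (mulf_neq0 two (H0 r Vr)) (mulf_neq0 (mulf_neq0 (lam0 r Vr) (E0 r Vr))
  (mulf_neq0 (lam0 r Vr) (E0 r Vr))))).
pose X := Du t r * Du E r + Dv t r * Dv E r; pose Y := Du H r * Du E r + Dv H r * Dv E r.
pose T := Du t r ^+ 2 + Dv t r ^+ 2; pose P := Du t r * Du H r + Dv t r * Dv H r.
pose k := kap * eps / 2.
apply: (lin_comb (c := 2 * H r * lam r * E r * E r) (D1S s r Vr)).
apply: (lin_comb (c := H r * lam r * E r * s r) (D1S E r Vr)).
apply: (lin_comb (c := 2 * k * nu r * (lam r * E r) ^+ 2 *
  (eps * (1 - nu r ^+ 2) - s r ^+ 2 * E r)) HH).
apply: (lin_comb (c := 2 * H r * lam r * E r) (along r Vr)).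
apply: (lin_comb (c := H r * X) (E_def r Vr)).
apply: (lin_comb (c := - H r * Y) (s_def r Vr)).
apply: (lin_comb (c := Du H r * Dv t r - Dv H r * Du t r) (across r Vr)).
apply: (lin_comb (c := - 2 * k * nu r * E r * (lam r * E r * s r + P)) (s_def r Vr)).
apply: (lin_comb (c := - 2 * k * nu r * lam r * E r ^+ 2) (se_norm_t eV Vr)).
apply: (lin_comb (c := 2 * k * nu r * E r * T) (E_def r Vr)).
rewrite /X /Y /T /P /k; move: (H r)^-1 => hi; by field.
Qed.

(** On the open set where W <> 0, the auxiliary result forces H = 0, hence dH = 0, hence W = 0. *)
Lemma gradients_parallel q : U q -> Du H q * Dv t q - Dv H q * Du t q = 0.
Proof.
move=> Uq; apply/eqP; apply: contraT => Wq.
have oU := se_open eqs; have dDuU := se_du eqs oU; have dDvU := se_dv eqs oU.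
have sWf : smooth_on U Wf.
  rewrite /Wf; apply: smoothB => //; apply: smoothM => //;
  first [exact: der_smooth dDuU _ (se_H eqs) | exact: der_smooth dDvU _ (se_H eqs)
    | exact: der_smooth dDuU _ (se_t eqs) | exact: der_smooth dDvU _ (se_t eqs)].
have oV : open [set q | U q /\ Wf q != 0] by exact: open_neq0.
have H0 p : U p /\ Wf p != 0 -> H p = cst 0 p.
  move=> [Up Wp]; apply/eqP; apply: contraT => Hp.
  by case: (@gradients_parallel_aux p).
have Hu : Du H q = 0.
  by rewrite (der_eq (se_du eqs oV) H0) // (der_cst (se_du eqs oV)).
have Hv : Dv H q = 0.
  by rewrite (der_eq (se_dv eqs oV) H0) // (der_cst (se_dv eqs oV)).
by rewrite Hu Hv !mul0r subrr eqxx in Wq.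
Qed.

(** grad t is a multiple of grad H, which the shape operator kills, and grad nu is minus the shape
    operator applied to grad t. *)
Lemma nu_stationary q : U q -> Du H q ^+ 2 + Dv H q ^+ 2 != 0 ->
  Du nu q = 0 /\ Dv nu q = 0.
Proof.
move=> Uq S0; have W0 := gradients_parallel Uq.
have lam0 := lt0r_neq0 (se_lam0 eqs Uq).
pose S := Du H q ^+ 2 + Dv H q ^+ 2.
have T := se_trace eqs Uq; have k1 := kernel1 Uq; have k2 := kernel2 Uq.
split; apply: (mulfI S0); apply: (mulfI lam0); rewrite !mulr0.
  apply: (lin_comb (c := S) (se_weingarten_u eqs Uq)).
  apply: (lin_comb (c := Dv H q * (L q + N q)) W0).
  apply: (lin_comb (c := - Du t q * Du H q - Dv t q * Dv H q) k1).
  apply: (lin_comb (c := Du t q * Dv H q - Dv t q * Du H q) k2).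
  rewrite /S; ring.
apply: (lin_comb (c := S) (se_weingarten_v eqs Uq)).
apply: (lin_comb (c := - Du H q * (L q + N q)) W0).
apply: (lin_comb (c := - Du t q * Dv H q + Dv t q * Du H q) k1).
apply: (lin_comb (c := - Du t q * Du H q - Dv t q * Dv H q) k2).
rewrite /S; ring.
Qed.

(** With grad t = s grad H, the Laplacian of t is s times that of H plus ds(grad H). Eliminating the
    second derivatives between this, [codazzi_along] and [hessian_along] gives [PE] for P = lam
    <grad t, grad H>. Squaring brings in |grad H|^2, because parallel gradients are the equality
    case [P2] of Cauchy-Schwarz. *)
Lemma gradient_norm q : U q -> Du H q ^+ 2 + Dv H q ^+ 2 != 0 ->
  nu q ^+ 2 != 1 /\ 4 * eps * (1 - nu q ^+ 2) * (Du H q ^+ 2 + Dv H q ^+ 2) =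
  lam q * nu q ^+ 2 * (4 * eps * H q ^+ 2 + kap * (1 - nu q ^+ 2)) ^+ 2.
Proof.
move=> Uq Sq; have oU := se_open eqs; have dDuU := se_du eqs oU.
have dDvU := se_dv eqs oU; have sH := se_H eqs; have st := se_t eqs.
have sHuU : smooth_on U (Du H) by exact: der_smooth sH.
have sHvU : smooth_on U (Dv H) by exact: der_smooth sH.
pose V := [set q | U q /\ (Du H * Du H + Dv H * Dv H) q != 0].
have oV : open V by apply: open_neq0 => //; smooth_tac.
have VU : V `<=` U by move=> p [].
have Vq : V q by split=> //; rewrite !fctE -!expr2.
have eV := surface_equations_sub oV VU eqs.
have S0 p : V p -> Du H p ^+ 2 + Dv H p ^+ 2 != 0 by case=> _; rewrite !fctE -!expr2.
have k1 p : V p -> Du H p * L p + Dv H p * M p = 0 by move/VU/kernel1.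
have k2 p : V p -> Du H p * M p + Dv H p * N p = 0 by move/VU/kernel2.
have dDu := se_du eqs oV; have dDv := se_dv eqs oV.
have lam0 r : V r -> lam r != 0 by move=> Vr; exact: lt0r_neq0 (se_lam0 eV Vr).
have slam := se_lam eV; have stV := se_t eV.
have sHu : smooth_on V (Du H) by exact: der_smooth (se_H eV).
have sHv : smooth_on V (Dv H) by exact: der_smooth (se_H eV).
have stu : smooth_on V (Du t) by exact: der_smooth (se_t eV).
have stv : smooth_on V (Dv t) by exact: der_smooth (se_t eV).
have [E [sE E_def]] : exists E : R * R -> R, smooth_on V E /\
    forall r, V r -> lam r * E r = Du H r ^+ 2 + Dv H r ^+ 2.
  exists ((Du H * Du H + Dv H * Dv H) * finv lam); split.
    by apply: smoothM => //; [smooth_tac|exact: smoothV].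
  by move=> r Vr; rewrite !fctE /finv mulrC divfK ?lam0 // !expr2.
have [s [ss s_def]] : exists s : R * R -> R, smooth_on V s /\
    forall r, V r -> lam r * E r * s r = Du t r * Du H r + Dv t r * Dv H r.
  exists ((Du t * Du H + Dv t * Dv H) * finv (Du H * Du H + Dv H * Dv H)); split.
    by apply: smoothM => //; [smooth_tac|apply: smoothV => //; smooth_tac].
  by move=> r Vr; rewrite E_def // !fctE /finv mulrC !expr2 divfK // -!expr2 S0.
have sHs r : V r -> Du t r = s r * Du H r /\ Dv t r = s r * Dv H r.
  move=> Vr; have W0 := gradients_parallel (VU _ Vr).
  split; apply: (mulfI (S0 r Vr)).
    apply: (lin_comb (c := Du H r * s r) (E_def r Vr)).
    apply: (lin_comb (c := - Du H r) (s_def r Vr)); apply: (lin_comb (c := - Dv H r) W0); ring.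
  apply: (lin_comb (c := Dv H r * s r) (E_def r Vr)).
  apply: (lin_comb (c := - Dv H r) (s_def r Vr)); apply: (lin_comb (c := Du H r) W0); ring.
have tuu : Du (Du t) q = Du s q * Du H q + s q * Du (Du H) q.
  have -> : Du (Du t) q = Du (s * Du H) q by apply: (der_eq dDu) => // r /sHs[].
  by derive_tac dDu oV; ring.
have tvv : Dv (Dv t) q = Dv s q * Dv H q + s q * Dv (Dv H) q.
  have -> : Dv (Dv t) q = Dv (s * Dv H) q by apply: (der_eq dDv) => // r /sHs[].
  by derive_tac dDv oV; ring.
have [tu tv] := sHs q Vq.
have along := codazzi_along eV k1 k2 sE E_def Vq.
have hess := hessian_along eV k1 k2 sE ss E_def s_def Vq.
have two : (2 : R) != 0 by rewrite pnatr_eq0.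
have lam0q := lam0 q Vq.
have E0 : E q != 0 by apply: contraNneq Sq => E0; rewrite -E_def // E0 mulr0.
pose P := Du t q * Du H q + Dv t q * Dv H q.
have lap : Du (Du t) q + Dv (Dv t) q = 2 * eps * lam q * H q * nu q.
  apply: (mulfI two); apply: (mulfI lam0q).
  apply: (lin_comb (c := 1) (se_hess_uu eqs Uq)); apply: (lin_comb (c := 1) (se_hess_vv eqs Uq)).
  apply: (lin_comb (c := 2 * lam q * eps * nu q) (se_trace eqs Uq)); ring.
have PE : 2 * P = - lam q * nu q * (4 * eps * H q ^+ 2 + kap * (1 - nu q ^+ 2)).
  apply: (mulfI E0).
  apply: (lin_comb (c := s q) along).
  apply: (lin_comb (c := 2 * H q) hess).
  apply: (lin_comb (c := - 2 * E q) (s_def q Vq)).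
  move: lap; rewrite tuu tvv => lap; apply: (lin_comb (c := - 2 * H q * E q) lap).
  apply: (lin_comb (c := - kap * eps * nu q * E q) (se_norm_t eqs Uq)).
  apply: (lin_comb (c := - kap * nu q * E q * lam q * (1 - nu q ^+ 2)) eps2).
  rewrite /P tu tv; by field.
have P2 : P ^+ 2 = eps * lam q * (1 - nu q ^+ 2) * (Du H q ^+ 2 + Dv H q ^+ 2).
  rewrite -(se_norm_t eqs Uq) /P tu tv; ring.
split.
  (* If nu^2 = 1, then P = 0 by [P2], so [PE] forces H = 0, and [along] reduces to 2 lam E^2 = 0. *)
  have P2' := P2; apply: contra_eq_neq along => nu1.
  move: P2'; rewrite nu1 subrr mulr0 mul0r => /eqP; rewrite sqrf_eq0 => /eqP P0.
  move: PE; rewrite P0 nu1 subrr !mulr0 addr0 => /esym/eqP.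
  have nu0 : nu q != 0 by rewrite -sqrf_eq0 nu1 oner_eq0.
  have eps0 : eps != 0 by rewrite -sqrf_eq0 eps2 oner_eq0.
  rewrite !mulf_eq0 oppr_eq0 (negbTE lam0q) (negbTE nu0) (negbTE eps0) pnatr_eq0 /=.
  rewrite orbb => /eqP ->; rewrite -/P P0 mulr0 !mulr0 !mul0r addr0 subr0.
  by rewrite !mulf_neq0 // expf_neq0.
apply: (mulfI lam0q).
apply: (lin_comb (c := -4) P2).
apply: (lin_comb (c := (2 * P - lam q * nu q * (4 * eps * H q ^+ 2 + kap * (1 - nu q ^+ 2))))
  PE); ring.
Qed.
End Kernel.

(** * Critical points of the mean curvature *)

Section CriticalSet.
Context {R : realType}.

Lemma smooth_line (U : set (R * R)) (f : R * R -> R) (k q : R * R) (x : R) :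
  open U -> smooth_on U f -> U (x *: k + q) ->
  is_derive x 1 (fun h : R => f (h *: k + q))
    (k.1 * 'D_d_u f (x *: k + q) + k.2 * 'D_d_v f (x *: k + q)).
Proof.
move=> oU sf Ux; have [df vdf] := smooth_diff oU sf Ux.
have -> : k.1 * 'D_d_u f (x *: k + q) + k.2 * 'D_d_v f (x *: k + q) = 'D_k f (x *: k + q).
  by rewrite [RHS]deriveE // vdf.
by apply: line_derive; exact: diff_derivable.
Qed.

(** y^2 exp (-2 K x) is nonnegative, nonincreasing and zero at a. *)
Lemma gronwall_zero (y dy : R -> R) (a b K : R) : a < b ->
  {within `[a, b], continuous y} ->
  (forall x, x \in `]a, b[%R -> is_derive x 1 y (dy x) /\ `|dy x| <= K * `|y x|) ->
  y a = 0 -> y b = 0.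
Proof.
move=> ab cy Dy ya.
pose c := - (2 * K); pose w := fun x : R => expR (c * x).
have dw (x : R) : is_derive x 1 w (expR (c * x) * c).
  have h1 : is_derive x 1 (fun x : R => c * x) c.
    by apply: is_derive_eq (mulr1 c); exact: (is_deriveZ c (is_derive_id x (1 : R))).
  exact: (is_derive1_comp (is_derive_expR _) h1).
pose z := y * y * w.
have dz (x : R) : x \in `]a, b[%R -> is_derive x 1 z
    (w x * (2 * (y x * dy x) + c * (y x * y x))).
  move=> xab; have [dyx _] := Dy x xab; have dwx := dw x.
  apply: is_derive_eq; rewrite !fctE /GRing.scale /= /w; ring.
have cw : continuous w by move=> x; apply/differentiable_continuous/derivable1_diffP;
  exact: ex_derive.
have cz : {within `[a, b], continuous z}.
  by move=> x; apply: continuousM; [apply: continuousM; exact: cy|exact: continuous_subspaceT].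
suff : z b <= z a.
  rewrite /z !fctE ya !mul0r => h.
  have : y b * y b <= 0 by rewrite -(pmulr_lle0 _ (expR_gt0 (c * b))).
  by rewrite -expr2 => h2; apply/eqP; rewrite -sqrf_eq0 eq_le h2 sqr_ge0.
apply: (ler0_derive1_le_cc _ _ cz); rewrite ?bound_itvE ?ltW //.
  by move=> x xab; have := dz x xab => h; exact: ex_derive.
move=> x xab; have h := dz x xab; rewrite derive1E derive_val.
rewrite pmulr_rle0 ?expR_gt0 // /c.
have [_ Kx] := Dy x xab.
have : y x * dy x <= K * (y x * y x).
  apply: le_trans (ler_norm _) _; rewrite normrM.
  have -> : y x * y x = `|y x| * `|y x| by rewrite -normrM ger0_norm // -expr2 sqr_ge0.
  by rewrite mulrCA ler_wpM2l.
by move=> ?; lra.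
Qed.

Lemma cont_neq0 (f : R -> R) (x : R) : {for x, continuous f} -> f x != 0 ->
  exists2 d : R, 0 < d & forall y, `|y - x| < d -> f y != 0.
Proof.
move=> cf fx; have fx0 : 0 < `|f x| by rewrite normr_gt0.
have /cvgrPdist_lt /(_ _ fx0) /nbhs_ballP[d /= d0 hd] := cf.
exists d => // y yx; have /hd /= : ball x d y by rewrite /ball /= distrC.
by apply: contraTneq => ->; rewrite subr0 ltxx.
Qed.

Lemma last_zero (f : R -> R) : (forall x, 0 <= x <= 1 -> {for x, continuous f}) ->
  f 0 = 0 -> f 1 != 0 ->
  exists a, [/\ 0 <= a < 1, f a = 0 & forall x, a < x <= 1 -> f x != 0].
Proof.
move=> cf f0 f1; pose A := [set x | 0 <= x <= 1 /\ f x = 0].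
have A0 : A 0 by split=> //; rewrite lexx ler01.
have ubA : ubound A 1 by move=> x [/andP[]].
have hsA : has_sup A by split; [exists 0|exists 1].
have a0 : 0 <= sup A by exact: (ub_le_sup hsA.2 A0).
have a1 : sup A <= 1 by apply: ge_sup => //; exists 0.
have fa : f (sup A) = 0.
  apply/eqP; apply: contraT => fa.
  have [d d0 hd] := cont_neq0 (cf _ (introT andP (conj a0 a1))) fa.
  have [x Ax xd] := sup_adherent d0 hsA.
  have xa : x <= sup A by exact: (ub_le_sup hsA.2 Ax).
  have := hd x; rewrite ler0_norm ?subr_le0 // opprB ltrBlDl -ltrBlDr xd => /(_ isT).
  by rewrite Ax.2 eqxx.
exists (sup A); split=> //.
  by rewrite a0 lt_neqAle a1 andbT; apply: contraNneq f1 => <-; apply/eqP.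
move=> x /andP[ax x1]; apply/negP => /eqP fx.
have : x <= sup A by apply: (ub_le_sup hsA.2); split=> //; rewrite x1 (le_trans a0 (ltW ax)).
by rewrite leNgt ax.
Qed.

Lemma zero_at_left (f : R -> R) (a b : R) : a < b -> {for a, continuous f} ->
  (forall x, a < x <= b -> f x = 0) -> f a = 0.
Proof.
move=> ab cf f0; apply/eqP; apply: contraT => fa.
have [d d0 hd] := cont_neq0 cf fa.
pose x := Num.min (a + d / 2) b.
have d2 : 0 < d / 2 by rewrite divr_gt0.
have ax : a < x by rewrite lt_min ab ltrDl d2.
have xb : x <= b by rewrite ge_min lexx orbT.
have := hd x; rewrite f0 ?ax // eqxx; apply.
rewrite gtr0_norm ?subr_gt0 // ltrBlDl gt_min ltrD2l.
by rewrite ltr_pdivrMr // ltr_pMr // ltr1n.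
Qed.

Section Persistence.
Variables (U : set (R * R)) (lam L M N t nu H : R * R -> R) (eps kap : R).
Local Notation Du := (fun f => 'D_d_u f).
Local Notation Dv := (fun f => 'D_d_v f).
Hypotheses (eps2 : eps ^+ 2 = 1) (kap0 : kap != 0).
Hypothesis eqs : surface_equations Du Dv eps kap U lam L M N t nu H.
Hypotheses (kernel1 : forall q, U q -> 'D_d_u H q * L q + 'D_d_v H q * M q = 0)
  (kernel2 : forall q, U q -> 'D_d_u H q * M q + 'D_d_v H q * N q = 0).

Let S := 'D_d_u H * 'D_d_u H + 'D_d_v H * 'D_d_v H.

(** Otherwise let a be the last zero of S on the segment. Beyond a, nu has a constant value n0 and
    [gradient_norm] applies; in the limit at a it gives kap (1 - n0^2) = -4 eps H(a)^2, so S becomes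
    C lam (H^2 - H(a)^2)^2. Then H - H(a) obeys a linear differential inequality with value 0 at a,
    so it is 0 at the endpoint, and S is 0 there too. *)
Lemma critical_persists (q k : R * R) :
  (forall x : R, 0 <= x <= 1 -> U (x *: k + q)) ->
  S q = 0 -> S (k + q) = 0.
Proof.
move=> segU Sq; have oU := se_open eqs.
have sHu := smooth_du (se_H eqs); have sHv := smooth_dv (se_H eqs).
have sS : smooth_on U S by rewrite /S; smooth_tac.
have line (f : R * R -> R) : smooth_on U f -> forall x : R, 0 <= x <= 1 ->
    {for x, continuous (fun h : R => f (h *: k + q))}.
  move=> sf x x01; apply/differentiable_continuous/derivable1_diffP.
  by have D := smooth_line oU sf (segU x x01); exact: ex_derive.
have lineW (f : R * R -> R) (a : R) : smooth_on U f -> 0 <= a ->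
    {within `[a, 1], continuous (fun h : R => f (h *: k + q))}.
  move=> sf a0; apply: continuous_in_subspaceT => x; rewrite inE /= in_itv /= => /andP[ax x1].
  by apply: line => //; rewrite x1 (le_trans a0 ax).
have S0 : S (0 *: k + q) = 0 by rewrite scale0r add0r.
apply/eqP; apply: contraT; rewrite -(scale1r k) => S1.
have [a [/andP[a0 a1] Sa Sx]] := last_zero (line S sS) S0 S1.
have in01 x : a < x <= 1 -> 0 <= x <= 1.
  by move=> /andP[ax ->]; rewrite (le_trans a0 (ltW ax)).
have Sx' x : a < x <= 1 -> Du H (x *: k + q) ^+ 2 + Dv H (x *: k + q) ^+ 2 != 0.
  by move=> /Sx; rewrite /S !fctE -!expr2.
pose n0 := nu (1 *: k + q).
have nu_const x : a <= x <= 1 -> nu (x *: k + q) = n0.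
  move=> /andP[ax]; rewrite le_eqVlt => /predU1P[->//|x1].
  have [z|c] := MVT (df := cst 0) x1 _ (lineW nu x (se_nu eqs) (le_trans a0 ax)).
    rewrite in_itv /= => /andP[xz z1].
    have az : a < z <= 1 by rewrite (le_lt_trans ax xz) (ltW z1).
    have D := smooth_line oU (se_nu eqs) (segU z (in01 z az)).
    have [h1 h2] := nu_stationary eps2 kap0 eqs kernel1 kernel2 (segU z (in01 z az)) (Sx' z az).
    by apply: is_derive_eq D _; rewrite h1 h2 !mulr0 addr0.
  by rewrite mul0r => _ /eqP; rewrite subr_eq0 => /eqP.
have ident x : a < x <= 1 -> n0 ^+ 2 != 1 /\ 4 * eps * (1 - n0 ^+ 2) * S (x *: k + q) =
    lam (x *: k + q) * n0 ^+ 2 * (4 * eps * H (x *: k + q) ^+ 2 + kap * (1 - n0 ^+ 2)) ^+ 2.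
  move=> ax; have ax' : a <= x <= 1 by case/andP: ax => /ltW -> ->.
  have := gradient_norm eps2 kap0 eqs kernel1 kernel2 (segU x (in01 x ax)) (Sx' x ax).
  by rewrite nu_const // /S !fctE -!expr2.
have a11 : a < (1 : R) <= 1 by rewrite a1 lexx.
have [n1 id1] := ident 1 a11.
have eps0 : eps != 0 by rewrite -sqrf_eq0 eps2 oner_eq0.
have n1' : 1 - n0 ^+ 2 != 0 by rewrite subr_eq0 eq_sym.
have c0 : 4 * eps * (1 - n0 ^+ 2) != 0 by rewrite !mulf_neq0 // pnatr_eq0.
have n00 : n0 != 0.
  apply: contraNneq S1 => n00; move: id1; rewrite {2}n00 expr0n mulr0 mul0r.
  by move/eqP; rewrite mulf_eq0 (negbTE c0).
have lam_gt0 x : a <= x <= 1 -> 0 < lam (x *: k + q).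
  by move=> /andP[ax x1]; apply: (se_lam0 eqs); apply: segU; rewrite x1 (le_trans a0 ax).
pose Ha := H (a *: k + q).
have a01 : a <= a <= 1 by rewrite lexx ltW.
(* F is the difference of the two sides of [ident]: it vanishes beyond a, hence at a by continuity.
   There S = 0 while lam and n0 are nonzero, so Phi = 0. *)
have Phia : 4 * eps * Ha ^+ 2 + kap * (1 - n0 ^+ 2) = 0.
  pose Phi : R * R -> R := cst (4 * eps) * (H * H) + cst (kap * (1 - n0 ^+ 2)).
  pose F : R * R -> R := cst (4 * eps * (1 - n0 ^+ 2)) * S - lam * cst (n0 ^+ 2) * (Phi * Phi).
  have sH := se_H eqs; have slam := se_lam eqs.
  have sF : smooth_on U F by rewrite /F /Phi; smooth_tac.
  have F0 x : a < x <= 1 -> F (x *: k + q) = 0.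
    move=> /ident[_ h]; rewrite /F /Phi !fctE; apply: (lin_comb (c := 1) h); ring.
  have := zero_at_left a1 (line F sF a (introT andP (conj a0 (ltW a1)))) F0.
  rewrite /F !fctE Sa mulr0 sub0r => /eqP; rewrite oppr_eq0 !mulf_eq0.
  by rewrite (negbTE n00) gt_eqF ?lam_gt0 //= !orbb /Phi !fctE -expr2 => /eqP.
have [m m0 mP] : exists2 m : R, 0 <= m & forall x, a <= x <= 1 ->
    lam (x *: k + q) * (H (x *: k + q) + Ha) ^+ 2 <= m.
  pose B : R * R -> R := lam * ((H + cst Ha) * (H + cst Ha)).
  have sH := se_H eqs; have slam := se_lam eqs.
  have sB : smooth_on U B by rewrite /B; smooth_tac.
  have [c] := EVT_max (ltW a1) (lineW B a sB a0).
  rewrite in_itv /= => ac cP; exists (B (c *: k + q)).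
    by rewrite /B !fctE -expr2 mulr_ge0 ?sqr_ge0 // ltW ?lam_gt0.
  by move=> x ax; have := cP x; rewrite in_itv /= => /(_ ax); rewrite /B !fctE -!expr2.
pose C := 4 * n0 ^+ 2 * eps / (1 - n0 ^+ 2).
have SC x : a < x <= 1 -> S (x *: k + q) =
    C * (lam (x *: k + q) * (H (x *: k + q) + Ha) ^+ 2) * (H (x *: k + q) - Ha) ^+ 2.
  move=> /ident[_ h]; apply: (mulfI c0); rewrite h /C.
  have -> : kap * (1 - n0 ^+ 2) = - (4 * eps * Ha ^+ 2) by apply/eqP; rewrite -addr_eq0 addrC Phia.
  by field.
(* The summand 1 ensures K <= K^2, so the bound on the squared derivative can be compared with K^2
   without a square root. *)
pose K := 1 + (k.1 ^+ 2 + k.2 ^+ 2) * `|C| * m.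
have HH : H (1 *: k + q) - Ha = 0.
  pose y x := H (x *: k + q) - Ha.
  apply: (@gronwall_zero y (fun x => k.1 * 'D_d_u H (x *: k + q) + k.2 * 'D_d_v H (x *: k + q))
    a 1 K) => //.
  - move=> x; apply: continuousB; last exact: cst_continuous.
    exact: (lineW H a (se_H eqs) a0).
  - move=> x; rewrite in_itv /= => /andP[ax x1].
    have ax1 : a < x <= 1 by rewrite ax ltW.
    split.
      have D := smooth_line oU (se_H eqs) (segU x (in01 x ax1)).
      by rewrite -[X in is_derive _ _ _ X]subr0; apply: is_deriveB.
    have SCx := SC x ax1; have mx := mP x (introT andP (conj (ltW ax) (ltW x1))).
    have b0 : 0 <= lam (x *: k + q) * (H (x *: k + q) + Ha) ^+ 2.
      by rewrite mulr_ge0 ?sqr_ge0 // ltW // lam_gt0 // !ltW.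
    move: SCx mx b0; rewrite /S !fctE -/(y x).
    move: (lam _ * _) ('D_d_u H _) ('D_d_v H _) (y x) => b Hu Hv Y SCx bm b0.
    have k0 : 0 <= k.1 ^+ 2 + k.2 ^+ 2 by rewrite addr_ge0 ?sqr_ge0.
    have K0 : 0 <= (k.1 ^+ 2 + k.2 ^+ 2) * `|C| * m by rewrite !mulr_ge0.
    have Y0 : 0 <= Y ^+ 2 by exact: sqr_ge0.
    rewrite -ler_sqr ?nnegrE ?mulr_ge0 // ?addr_ge0 // exprMn !real_normK ?num_real //.
    apply: (@le_trans _ _ ((k.1 ^+ 2 + k.2 ^+ 2) * (Hu * Hu + Hv * Hv))).
      rewrite -subr_ge0 [leRHS](_ : _ = (k.1 * Hv - k.2 * Hu) ^+ 2) ?sqr_ge0 //; ring.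
    rewrite SCx; apply: (@le_trans _ _ ((k.1 ^+ 2 + k.2 ^+ 2) * (`|C| * m * Y ^+ 2))).
      apply: ler_wpM2l => //; apply: ler_wpM2r => //.
      apply: le_trans (ler_wpM2r b0 (ler_norm C)) _; exact: ler_wpM2l.
    rewrite (mulrA _ _ (Y ^+ 2)) (mulrA _ `|C|); apply: ler_wpM2r => //.
    have K1 : 1 <= K by rewrite /K lerDl.
    apply: (@le_trans _ _ K); first by rewrite /K lerDr.
    by rewrite expr2 ler_peMr // (le_trans ler01).
  - by rewrite /y subrr.
move: id1; rewrite (_ : H _ ^+ 2 = Ha ^+ 2); last by move/eqP: HH; rewrite subr_eq0 => /eqP ->.
rewrite Phia expr0n mulr0 => /eqP; rewrite mulf_eq0 (negbTE c0) /= => h.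
by rewrite h in S1.
Qed.
End Persistence.
End CriticalSet.

(** * The ambient space *)

Section LinearFunctionals.
Context {R : realType}.

Lemma derive_linear (V W W' : normedModType R) (l : W -> W') (F : V -> W) (q v : V) :
  linear l -> continuous l -> derivable F q v ->
  derivable (l \o F) q v /\ 'D_v (l \o F) q = l ('D_v F q).
Proof.
move=> ll cl dF.
have E : (fun h : R => h^-1 *: (((l \o F) \o shift q) (h *: v) - (l \o F) q)) =
    l \o (fun h : R => h^-1 *: ((F \o shift q) (h *: v) - F q)).
  have lB x y : l (x - y) = l x - l y.
    by rewrite addrC -scaleN1r ll scaleN1r addrC.
  have l0 : l 0 = 0 by have := lB 0 0; rewrite !subrr.
  have lZ a x : l (a *: x) = a *: l x by have := ll a x 0; rewrite !addr0 l0 addr0.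
  by apply/funext => h /=; rewrite lZ lB.
have cv : (fun h : R => h^-1 *: (((l \o F) \o shift q) (h *: v) - (l \o F) q)) @ 0^' --> l ('D_v
  F q).
  rewrite E; apply: continuous_cvg; [exact: cl|exact: dF].
by split; [apply/cvg_ex; exists (l ('D_v F q))|apply/cvg_lim].
Qed.

Lemma smooth_linear (W W' : normedModType R) (U : set (R * R)) (l : W -> W') (F : R * R -> W) :
  open U -> linear l -> continuous l -> smooth_on U F -> smooth_on U (l \o F).
Proof.
move=> oU ll cl /smooth_Cle sF; apply/smooth_Cle => n; elim: n F sF => [|n IH] F sF.
  move: (sF 0%N 0%N isT) => cF [|//] _ q Uq.
  by apply: continuous_comp; [exact: cF|exact: cl].
move: (sF n.+1) => /CleS[cF dF _ _]; apply/CleS.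
have D v q : derivable F q v -> derivable (l \o F) q v /\ 'D_v (l \o F) q = (l \o 'D_v F) q.
  by move=> d; exact: derive_linear.
split.
- by move=> q Uq; apply: continuous_comp; [exact: cF|exact: cl].
- by move=> q Uq; have [/D[]? _ /D[]] := dF q Uq.
- apply: (Cle_eq (F := l \o 'D_d_u F)) => //.
    by move=> q /dF[/D[_ ->]].
  by apply: IH => m; have /CleS[] := sF m.+1.
- apply: (Cle_eq (F := l \o 'D_d_v F)) => //.
    by move=> q /dF[_ /D[_ ->]].
  by apply: IH => m; have /CleS[] := sF m.+1.
Qed.
End LinearFunctionals.

Section SmoothExamples.
Context {R : realType}.

Lemma smooth_pair (U : set (R * R)) (f g : R * R -> R) : open U -> smooth_on U f ->
  smooth_on U g -> smooth_on U (fun q => (f q, g q)).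
Proof.
move=> oU sf sg.
have lin (w : R * R) : linear (fun a : R => a *: w).
  by move=> a x y; rewrite scalerDl scalerA.
have cont (w : R * R) : continuous (fun a : R => a *: w) by exact: scalel_continuous.
have s1 := smooth_linear oU (lin d_u) (cont d_u) sf.
have s2 := smooth_linear oU (lin d_v) (cont d_v) sg.
apply: (smooth_eq (F := ((fun a : R => a *: d_u) \o f) + ((fun a : R => a *: d_v) \o g))) => //.
  by move=> q Uq; rewrite fctE /=; congr pair; rewrite /d_u /d_v /= /GRing.scale /=; ring.
apply/smooth_Cle => n; apply: CleD => //; exact/smooth_Cle.
Qed.

Lemma derive_sqrt_comp (f : R * R -> R) (q v : R * R) : 0 < f q -> derivable f q v ->
  derivable (Num.sqrt \o f) q v /\
  'D_v (Num.sqrt \o f) q = (2 * Num.sqrt (f q))^-1 * 'D_v f q.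
Proof.
move=> f0 df; pose g := fun h : R => f (h *: v + q).
have dg : is_derive (0 : R) 1 g ('D_v f q).
  by apply: DeriveDef; [exact: (derivable1P f q v).1|exact: derive_line].
have ds : is_derive (g 0) 1 Num.sqrt (2 * Num.sqrt (g 0))^-1.
  by apply: is_derive1_sqrt; rewrite /g scale0r add0r.
have [d1 d2] := is_derive1_comp ds dg.
split; first by apply: (derivable1P (Num.sqrt \o f) q v).2.
by rewrite -derive_line; apply: etrans d2 _; rewrite /g scale0r add0r.
Qed.

(** The derivative of sqrt f is Df / (2 sqrt f), so order n of sqrt f feeds order n of its
    derivatives. *)
Lemma smooth_sqrt (U : set (R * R)) (f : R * R -> R) : open U ->
  (forall q, U q -> 0 < f q) -> smooth_on U f -> smooth_on U (Num.sqrt \o f).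
Proof.
move=> oU f0 /smooth_Cle sf; apply/smooth_Cle => n.
have cs q : U q -> {for q, continuous (Num.sqrt \o f)}.
  move=> Uq; apply: continuous_comp; first exact: (sf 0%N 0%N isT).
  exact: sqrt_continuous.
elim: n => [|n IH]; first by case=> // _ q; exact: cs.
have /CleS[_ df fu fv] := sf n.+1; apply/CleS.
have s0 q : U q -> Num.sqrt (f q) != 0 by move=> /f0; rewrite -sqrtr_gt0 => /lt0r_neq0.
have E v : Cle n U ('D_v f) -> (forall q, U q -> derivable f q v) ->
    Cle n U ('D_v (Num.sqrt \o f)).
  move=> cf dv; apply: (Cle_eq (F := cst 2^-1 * finv (Num.sqrt \o f) * 'D_v f)) => //.
    move=> q Uq; have [_ ->] := derive_sqrt_comp (f0 q Uq) (dv q Uq).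
    by rewrite !fctE /finv /= invfM.
  apply: CleM => //; apply: CleM => //; [exact: Cle_cst|exact: Cle_inv].
split.
- exact: cs.
- by move=> q Uq; have [d1 d2] := df q Uq;
    split; [case: (derive_sqrt_comp (f0 q Uq) d1)|case: (derive_sqrt_comp (f0 q Uq) d2)].
- by apply: E => // q /df[].
- by apply: E => // q /df[].
Qed.

End SmoothExamples.

Lemma parseval (F : fieldType) n (g : 'I_n -> F) (e : 'I_n -> 'I_n -> F) (d : 'I_n -> F) :
  (forall i j, \sum_k g k * e i k * e j k = (i == j)%:R * d i) ->
  (forall i, d i != 0) -> forall x y : 'I_n -> F,
  \sum_k g k * x k * y k =
  \sum_i (\sum_k g k * x k * e i k) * (\sum_k g k * y k * e i k) / d i.
Proof.
move=> orth d0 x y.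
pose B := \matrix_(i, j) e i j.
pose C := \matrix_(k, i) (g k * e i k / d i).
have BC : B *m C = 1%:M.
  apply/matrixP => i j; rewrite !mxE; under eq_bigr do rewrite !mxE.
  have -> : \sum_k e i k * (g k * e j k / d j) = (\sum_k g k * e i k * e j k) / d j.
    by rewrite mulr_suml; apply: eq_bigr => k _; ring.
  rewrite orth; case: eqP => [->|_]; last by rewrite !mul0r.
  by rewrite mul1r divff.
have CB := mulmx1C BC.
have key k m : \sum_i g k * e i k / d i * e i m = (k == m)%:R.
  have := congr1 (fun M : 'M[F]_n => M k m) CB; rewrite !mxE => <-.
  by apply: eq_bigr => i _; rewrite !mxE.
transitivity (\sum_k \sum_m x k * y m * g m * (\sum_i g k * e i k / d i * e i m)).
  apply: eq_bigr => k _; rewrite (bigD1 k) //= key eqxx big1 ?addr0 ?mulr1.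
    by ring.
  by move=> m mk; rewrite key eq_sym (negbTE mk) mulr0.
under eq_bigr do under eq_bigr do rewrite mulr_sumr.
under eq_bigr do rewrite exchange_big /=.
rewrite exchange_big; apply: eq_bigr => i _ /=.
rewrite -mulrA mulr_suml; apply: eq_bigr => k _.
rewrite mulr_suml mulr_sumr; apply: eq_bigr => m _; ring.
Qed.

Section Ambient4.
Context {R : realType}.
Variables (eps kap : R).
Local Notation ip := (inner4 eps kap).

(** One index for the components of p and for t, so that [inner4] is a diagonal form with weights
    [sign4] and [parseval] applies. *)
Definition coord4 (j : 'I_4) (x : E4 R) : R :=
  if (j < 3)%N then x.1 0 (inord j) else x.2.

Definition sign4 (j : 'I_4) : R :=
  if j == 0 then Num.sg kap else if (j < 3)%N then 1 else eps.

Lemma inner4E x y : ip x y = \sum_j sign4 j * coord4 j x * coord4 j y.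
Proof.
rewrite !big_ord_recl big_ord0 /sign4 /coord4 /= /inner4 /inner3.
have -> : inord 0 = 0 :> 'I_3 by apply: val_inj; rewrite /= inordK.
have -> : inord 1 = 1 :> 'I_3 by apply: val_inj; rewrite /= inordK.
have -> : inord 2 = 2 :> 'I_3 by apply: val_inj; rewrite /= inordK.
by rewrite addr0 !addrA !mul1r.
Qed.

Lemma coord4_inj x y : (forall j, coord4 j x = coord4 j y) -> x = y.
Proof.
case: x y => [p a] [r b] h; congr pair; last exact: (h ord_max).
apply/rowP => i; have := h (inord i); rewrite /coord4 /=.
have i4 : (i < 4)%N by apply: leq_trans (ltn_ord i) _.
by rewrite inordK // ltn_ord inord_val.
Qed.

Lemma coord4_linear j : linear (coord4 j).
Proof. by move=> a x y; rewrite /coord4; case: ifP => // _;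
  rewrite -[(a *: x + y).1]/(a *: x.1 + y.1) mxE mxE. Qed.

Lemma coord4_continuous j : continuous (coord4 j).
Proof.
have [h|/negbTE h] := boolP (j < 3)%N; rewrite /coord4 h => x; last exact: cvg_snd.
apply: (@continuous_comp _ _ _ (fst : E4 R -> _) (fun p : 'rV[R]_3 => p 0 (inord j))).
  exact: cvg_fst.
exact: coord_continuous.
Qed.

Lemma inner4C x y : ip x y = ip y x.
Proof. by rewrite !inner4E; apply: eq_bigr => j _; ring. Qed.

Lemma inner4Dl x y z : ip (x + y) z = ip x z + ip y z.
Proof.
rewrite !inner4E -big_split; apply: eq_bigr => j _ /=.
by have := coord4_linear j 1 x y; rewrite !scale1r => ->; ring.
Qed.

Lemma inner4Zl a x z : ip (a *: x) z = a * ip x z.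
Proof.
have c0 j : coord4 j 0 = 0 by rewrite /coord4; case: ifP => //=; rewrite mxE.
rewrite !inner4E mulr_sumr; apply: eq_bigr => j _ /=.
by have := coord4_linear j a x 0; rewrite !addr0 c0 addr0 => ->; rewrite /GRing.scale /=; ring.
Qed.

Section Calculus.
Variable U : set (R * R).
Hypothesis oU : open U.
Implicit Types A B : R * R -> E4 R.

Lemma smooth_coord4 A j : smooth_on U A -> smooth_on U (coord4 j \o A).
Proof. by apply: smooth_linear => //; [exact: coord4_linear|exact: coord4_continuous]. Qed.

Lemma derive_coord4 A j q v : derivable A q v ->
  derivable (coord4 j \o A) q v /\ 'D_v (coord4 j \o A) q = coord4 j ('D_v A q).
Proof. by apply: derive_linear; [exact: coord4_linear|exact: coord4_continuous]. Qed.

Lemma smooth_inner4 A B : smooth_on U A -> smooth_on U B ->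
  smooth_on U (fun q => ip (A q) (B q)).
Proof.
move=> sA sB; pose F j := cst (sign4 j) * (coord4 j \o A) * (coord4 j \o B).
apply: (smooth_eq (F := F 0 + F 1 + F 2 + F 3)) => //.
  move=> q _; rewrite inner4E !big_ord_recl big_ord0 addr0 !addrA /F !fctE.
  by congr (_ + _ + _ + _); do ![congr (_ * _)]; congr coord4; apply: val_inj.
have sF j : smooth_on U (F j).
  by rewrite /F; do ![apply: smoothM => //]; [exact: smooth_cst|exact: smooth_coord4..].
by do ![apply: smoothD => //].
Qed.

Lemma derive_inner4 A B q v : derivable A q v -> derivable B q v ->
  'D_v (fun q => ip (A q) (B q)) q = ip ('D_v A q) (B q) + ip (A q) ('D_v B q).
Proof.
move=> dA dB; pose F j := cst (sign4 j) * ((coord4 j \o A) * (coord4 j \o B)).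
have dF j : derivable (F j) q v.
  have [a _] := derive_coord4 j dA; have [b _] := derive_coord4 j dB.
  by apply: derivable_mul; [exact: derivable_cst|exact: derivable_mul].
have -> : (fun q => ip (A q) (B q)) = \sum_j F j.
  apply/funext => p; rewrite inner4E fct_sumE; apply: eq_bigr => j _.
  by rewrite /F !fctE mulrA.
rewrite derive_sum // !inner4E -big_split; apply: eq_bigr => j _ /=.
have [a a'] := derive_coord4 j dA; have [b b'] := derive_coord4 j dB.
have h1 := derive_mul (derivable_cst (sign4 j) q v) (derivable_mul a b).
have h2 := derive_mul a b; have h3 := derive_cst (sign4 j) q v.
apply: etrans h1 _; rewrite h2 h3 a' b' mulr0 addr0 /=.
have scalar (g x y z w : R) : g * (x * w + y * z) = g * z * y + g * x * w by ring.
exact: scalar.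
Qed.

Lemma derive4_swap A q : smooth_on U A -> U q ->
  'D_d_v ('D_d_u A) q = 'D_d_u ('D_d_v A) q.
Proof.
move=> sA Uq; apply: coord4_inj => j.
have nb (f g : R * R -> R) v : (forall p, U p -> f p = g p) -> 'D_v f q = 'D_v g q.
  by move=> fg; apply: near_eq_derive; near do apply: fg; exact: open_nbhs_nbhs.
have du p : U p -> 'D_d_u (coord4 j \o A) p = (coord4 j \o 'D_d_u A) p.
  by move=> Up; case: (derive_coord4 j (smooth_derivable_u sA Up)).
have dv p : U p -> 'D_d_v (coord4 j \o A) p = (coord4 j \o 'D_d_v A) p.
  by move=> Up; case: (derive_coord4 j (smooth_derivable_v sA Up)).
have [_ e1] := derive_coord4 (A := 'D_d_u A) j (smooth_derivable_v (smooth_du sA) Uq).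
have [_ e2] := derive_coord4 (A := 'D_d_v A) j (smooth_derivable_u (smooth_dv sA) Uq).
apply: etrans (esym e1) _; apply: etrans e2.
apply: etrans (esym (nb _ _ d_v du)) _; apply: etrans (nb _ _ d_u dv).
by apply: derive_swap Uq => //; exact: smooth_coord4.
Unshelve. all: by end_near. Qed.
End Calculus.

Lemma inner4_parseval (a b c d : E4 R) (na nb nc nd : R) :
  ip a a = na -> ip b b = nb -> ip c c = nc -> ip d d = nd ->
  ip a b = 0 -> ip a c = 0 -> ip a d = 0 -> ip b c = 0 -> ip b d = 0 -> ip c d = 0 ->
  na != 0 -> nb != 0 -> nc != 0 -> nd != 0 -> forall x y,
  ip x y = ip x a * ip y a / na + ip x b * ip y b / nb
    + ip x c * ip y c / nc + ip x d * ip y d / nd.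
Proof.
move=> aa bb cc dd ab ac ad bc bd cd a0 b0 c0 d0 x y.
pose e (i : 'I_4) := nth 0 [:: a; b; c; d] i; pose n (i : 'I_4) := nth 0 [:: na; nb; nc; nd] i.
have := @parseval R 4 sign4 (fun i j => coord4 j (e i)) n _ _ (fun j => coord4 j x) (fun j =>
  coord4 j y).
rewrite -inner4E => -> //.
- rewrite (big_ord_recl 3) (big_ord_recl 2) (big_ord_recl 1) (big_ord_recl 0) big_ord0 addr0 /=
  -!inner4E.
  by rewrite /e /n /= !addrA.
- move=> i j; rewrite -inner4E /e /n.
  case: i => -[|[|[|[|//]]]] i4; case: j => -[|[|[|[|//]]]] j4 /=;
  by rewrite ?mul1r ?mul0r // inner4C.
- by case=> -[|[|[|[|//]]]] i4.
Qed.
End Ambient4.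

(** * Structure equations of an immersion *)

Section Immersion.
Context {R : realType}.
Variables (eps kap : R).
Hypotheses (eps_pm1 : eps = 1 \/ eps = -1) (kap0 : kap != 0).
Local Notation ip := (inner4 eps kap).

Let eps2 : eps ^+ 2 = 1.
Proof. by case: eps_pm1 => ->; rewrite ?sqrrN expr1n. Qed.

Let eps0 : eps != 0.
Proof. by rewrite -sqrf_eq0 eps2 oner_eq0. Qed.

Lemma radius_sqr : Defs.radius kap ^+ 2 = `|kap|^-1.
Proof.
rewrite /Defs.radius -powR_mulrn ?powR_ge0 // -powRrM mulNr mulVf ?pnatr_eq0 //.
by rewrite powR_inv1.
Qed.

Lemma curvature_radius : Num.sg kap * Defs.radius kap ^+ 2 = kap^-1.
Proof.
rewrite radius_sqr; apply: (mulfI kap0); rewrite mulfV // mulrCA.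
by rewrite {2}[kap]numEsg -mulrA mulfV ?normr_eq0 // mulr1 -expr2 sqr_sg kap0.
Qed.

(** Applied to X = (p, t) it gives r n_2, the normal direction of M^2(kappa) x R. *)
Definition horizontal (x : E4 R) : E4 R := (x.1, 0).

Lemma horizontal_linear : linear horizontal.
Proof. by move=> a x y; rewrite /horizontal; congr pair; rewrite /= scaler0 addr0. Qed.

Lemma horizontal_continuous : continuous horizontal.
Proof.
move=> [p a]; rewrite /horizontal; apply: (@cvg_pair _ _ _ _ (nbhs p) (nbhs (0 : R))).
  exact: cvg_fst.
exact: cvg_cst.
Qed.

Lemma inner4_horizontal x y : ip x (horizontal y) = ip x y - eps * x.2 * y.2.
Proof. by rewrite /inner4 /horizontal /= mulr0 addr0 addrK. Qed.

Lemma horizontal_horizontal x y : ip (horizontal x) (horizontal y) = ip x (horizontal y).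
Proof. by rewrite /inner4 /horizontal /= !mulr0. Qed.

Variables (U : set (R * R)) (F n : R * R -> E4 R) (H : R * R -> R).
Hypotheses (oU : open U) (sF : smooth_on U F) (sn : smooth_on U n).
Variables (Fu Fv Fuu Fuv Fvv nU nV m : R * R -> E4 R) (lam L M N t nu : R * R -> R).
Hypotheses (FuE : Fu = 'D_d_u F) (FvE : Fv = 'D_d_v F) (FuuE : Fuu = 'D_d_u Fu)
  (FuvE : Fuv = 'D_d_u Fv) (FvvE : Fvv = 'D_d_v Fv) (nUE : nU = 'D_d_u n)
  (nVE : nV = 'D_d_v n) (mE : m = fun q => horizontal (F q))
  (lamE : lam = fun q => ip (Fu q) (Fu q)) (LE : L = fun q => ip (Fuu q) (n q))
  (ME : M = fun q => ip (Fuv q) (n q)) (NE : N = fun q => ip (Fvv q) (n q))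
  (tE : t = fun q => (F q).2) (nuE : nu = fun q => (n q).2).
Hypotheses (sphere : forall q, U q ->
  inner3 kap (F q).1 (F q).1 = Num.sg kap * Defs.radius kap ^+ 2)
  (lam_gt0 : forall q, U q -> 0 < lam q)
  (conf_v : forall q, U q -> ip (Fv q) (Fv q) = lam q)
  (conf_uv : forall q, U q -> ip (Fu q) (Fv q) = 0)
  (n_m : forall q, U q -> ip (n q) (m q) = 0)
  (n_n : forall q, U q -> ip (n q) (n q) = eps)
  (n_u : forall q, U q -> ip (n q) (Fu q) = 0)
  (n_v : forall q, U q -> ip (n q) (Fv q) = 0).
Hypothesis trace : forall q, U q -> L q + N q = 2 * lam q * H q.
Hypothesis sH : smooth_on U H.

Let sFu : smooth_on U Fu. Proof. by rewrite FuE; exact: smooth_du. Qed.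
Let sFv : smooth_on U Fv. Proof. by rewrite FvE; exact: smooth_dv. Qed.
Let sFuu : smooth_on U Fuu. Proof. by rewrite FuuE; exact: smooth_du. Qed.
Let sFuv : smooth_on U Fuv. Proof. by rewrite FuvE; exact: smooth_du. Qed.
Let sFvv : smooth_on U Fvv. Proof. by rewrite FvvE; exact: smooth_dv. Qed.
Let sm : smooth_on U m.
Proof. by rewrite mE; apply: (smooth_linear oU horizontal_linear horizontal_continuous). Qed.

Let near_eqD (V : normedModType R) (f g : R * R -> V) q w : (forall p, U p -> f p = g p) -> U q ->
  'D_w f q = 'D_w g q.
Proof.
move=> fg Uq; apply: near_eq_derive; near do apply: fg; exact: open_nbhs_nbhs.
Unshelve. all: by end_near. Qed.

Let dip (A B : R * R -> E4 R) (f : R * R -> R) q w : derivable A q w -> derivable B q w ->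
  (forall p, U p -> ip (A p) (B p) = f p) -> U q ->
  ip ('D_w A q) (B q) + ip (A q) ('D_w B q) = 'D_w f q.
Proof. by move=> dA dB ABf Uq; rewrite -derive_inner4 //; exact: near_eqD. Qed.

Let dip_u (A B : R * R -> E4 R) (f : R * R -> R) q : smooth_on U A -> smooth_on U B ->
  (forall p, U p -> ip (A p) (B p) = f p) -> U q ->
  ip ('D_d_u A q) (B q) + ip (A q) ('D_d_u B q) = 'D_d_u f q.
Proof. by move=> sA sB AB Uq; apply: dip => //; exact: smooth_derivable_u Uq. Qed.

Let dip_v (A B : R * R -> E4 R) (f : R * R -> R) q : smooth_on U A -> smooth_on U B ->
  (forall p, U p -> ip (A p) (B p) = f p) -> U q ->
  ip ('D_d_v A q) (B q) + ip (A q) ('D_d_v B q) = 'D_d_v f q.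
Proof. by move=> sA sB AB Uq; apply: dip => //; exact: smooth_derivable_v Uq. Qed.

Let orth_u (A B : R * R -> E4 R) c q : smooth_on U A -> smooth_on U B ->
  (forall p, U p -> ip (A p) (B p) = c) -> U q ->
  ip ('D_d_u A q) (B q) = - ip (A q) ('D_d_u B q).
Proof.
by move=> sA sB AB Uq; apply/eqP; rewrite -addr_eq0 (dip_u (f := cst c)) // derive_cst.
Qed.

Let orth_v (A B : R * R -> E4 R) c q : smooth_on U A -> smooth_on U B ->
  (forall p, U p -> ip (A p) (B p) = c) -> U q ->
  ip ('D_d_v A q) (B q) = - ip (A q) ('D_d_v B q).
Proof.
by move=> sA sB AB Uq; apply/eqP; rewrite -addr_eq0 (dip_v (f := cst c)) // derive_cst.
Qed.

Let half (x y : R) : x + x = y -> x = 2^-1 * y.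
Proof. by move=> <-; field. Qed.

Let selforth (x : R) : x + x = 0 -> x = 0.
Proof. by move=> /half ->; rewrite mulr0. Qed.

Let u_u q : U q -> ip (Fu q) (Fu q) = lam q. Proof. by rewrite lamE. Qed.

Let Fvu q : U q -> 'D_d_v Fu q = Fuv q.
Proof. by move=> Uq; rewrite FuE FuvE FvE; exact: (derive4_swap oU sF Uq). Qed.

Let uu_u q : U q -> ip (Fuu q) (Fu q) = 2^-1 * 'D_d_u lam q.
Proof.
move=> Uq; apply: half; rewrite -(dip_u sFu sFu u_u Uq) FuuE.
by rewrite [ip (Fu q) _]inner4C.
Qed.

Let uv_u q : U q -> ip (Fuv q) (Fu q) = 2^-1 * 'D_d_v lam q.
Proof.
move=> Uq; apply: half; rewrite -(dip_v sFu sFu u_u Uq) Fvu //.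
by rewrite [ip (Fu q) _]inner4C.
Qed.

Let uv_v q : U q -> ip (Fuv q) (Fv q) = 2^-1 * 'D_d_u lam q.
Proof.
move=> Uq; apply: half; rewrite -(dip_u sFv sFv conf_v Uq) FuvE.
by rewrite [ip (Fv q) _]inner4C.
Qed.

Let vv_v q : U q -> ip (Fvv q) (Fv q) = 2^-1 * 'D_d_v lam q.
Proof.
move=> Uq; apply: half; rewrite -(dip_v sFv sFv conf_v Uq) FvvE.
by rewrite [ip (Fv q) _]inner4C.
Qed.

Let uu_v q : U q -> ip (Fuu q) (Fv q) = - (2^-1 * 'D_d_v lam q).
Proof.
move=> Uq; rewrite -uv_u // [ip (Fuv q) _]inner4C FuuE FuvE.
exact: (orth_u sFu sFv conf_uv Uq).
Qed.

Let vv_u q : U q -> ip (Fvv q) (Fu q) = - (2^-1 * 'D_d_u lam q).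
Proof.
move=> Uq; rewrite -uv_v // [ip (Fuv q) _]inner4C -Fvu // FvvE.
by apply: (orth_v (c := 0) sFv sFu _ Uq) => p Up; rewrite inner4C conf_uv.
Qed.

Let nU_u q : U q -> ip (nU q) (Fu q) = - L q.
Proof.
move=> Uq; rewrite nUE; apply: etrans (orth_u sn sFu n_u Uq) _.
by congr (- _); rewrite LE FuuE; exact: inner4C.
Qed.

Let nU_v q : U q -> ip (nU q) (Fv q) = - M q.
Proof.
move=> Uq; rewrite nUE; apply: etrans (orth_u sn sFv n_v Uq) _.
by congr (- _); rewrite ME FuvE; exact: inner4C.
Qed.

Let nV_u q : U q -> ip (nV q) (Fu q) = - M q.
Proof.
move=> Uq; rewrite nVE; apply: etrans (orth_v sn sFu n_u Uq) _.
by congr (- _); rewrite ME -Fvu //; exact: inner4C.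
Qed.

Let nV_v q : U q -> ip (nV q) (Fv q) = - N q.
Proof.
move=> Uq; rewrite nVE; apply: etrans (orth_v sn sFv n_v Uq) _.
by congr (- _); rewrite NE FvvE; exact: inner4C.
Qed.

Let nU_n q : U q -> ip (nU q) (n q) = 0.
Proof.
move=> Uq; apply: selforth; rewrite {2}inner4C nUE.
by rewrite (dip_u (f := cst eps) sn sn n_n Uq) derive_cst.
Qed.

Let nV_n q : U q -> ip (nV q) (n q) = 0.
Proof.
move=> Uq; apply: selforth; rewrite {2}inner4C nVE.
by rewrite (dip_v (f := cst eps) sn sn n_n Uq) derive_cst.
Qed.

Let m_m q : U q -> ip (m q) (m q) = kap^-1.
Proof.
by move=> Uq; rewrite -curvature_radius -(sphere Uq) mE horizontal_horizontal /inner4 /= mulr0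
  addr0.
Qed.

Let dm_u q : U q -> 'D_d_u m q = horizontal (Fu q).
Proof.
move=> Uq; have dF := smooth_derivable_u sF Uq; rewrite mE FuE.
by have [_] := derive_linear horizontal_linear horizontal_continuous dF.
Qed.

Let dm_v q : U q -> 'D_d_v m q = horizontal (Fv q).
Proof.
move=> Uq; have dF := smooth_derivable_v sF Uq; rewrite mE FvE.
by have [_] := derive_linear horizontal_linear horizontal_continuous dF.
Qed.

Let u_m q : U q -> ip (Fu q) (m q) = 0.
Proof.
move=> Uq; rewrite mE -horizontal_horizontal -dm_u //; apply: selforth.
rewrite {2}inner4C -[horizontal (F q)]/((fun q => horizontal (F q)) q) -mE.
by rewrite (dip_u (f := cst kap^-1) sm sm m_m Uq) derive_cst.
Qed.

Let v_m q : U q -> ip (Fv q) (m q) = 0.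
Proof.
move=> Uq; rewrite mE -horizontal_horizontal -dm_v //; apply: selforth.
rewrite {2}inner4C -[horizontal (F q)]/((fun q => horizontal (F q)) q) -mE.
by rewrite (dip_v (f := cst kap^-1) sm sm m_m Uq) derive_cst.
Qed.

Let snd_linear : linear (fun x : E4 R => x.2). Proof. by []. Qed.
Let snd_cont : continuous (fun x : E4 R => x.2).
Proof. by move=> [p a]; exact: cvg_snd. Qed.

Let st : smooth_on U t.
Proof. by rewrite tE; exact: (smooth_linear oU snd_linear snd_cont sF). Qed.
Let snu : smooth_on U nu.
Proof. by rewrite nuE; exact: (smooth_linear oU snd_linear snd_cont sn). Qed.

Let height (A : R * R -> E4 R) (f : R * R -> R) q w : derivable A q w ->
  (forall p, U p -> (A p).2 = f p) -> U q -> ('D_w A q).2 = 'D_w f q.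
Proof.
move=> dA Af Uq; rewrite -(near_eqD w Af Uq).
by have [_ <-] := derive_linear snd_linear snd_cont dA.
Qed.

Let tu q : U q -> (Fu q).2 = 'D_d_u t q.
Proof.
move=> Uq; rewrite FuE; apply: height (smooth_derivable_u sF Uq) _ Uq => p _.
by rewrite tE.
Qed.
Let tv q : U q -> (Fv q).2 = 'D_d_v t q.
Proof.
move=> Uq; rewrite FvE; apply: height (smooth_derivable_v sF Uq) _ Uq => p _.
by rewrite tE.
Qed.
Let tuu q : U q -> (Fuu q).2 = 'D_d_u ('D_d_u t) q.
Proof. by move=> Uq; rewrite FuuE; exact: height (smooth_derivable_u sFu Uq) tu Uq. Qed.
Let tuv q : U q -> (Fuv q).2 = 'D_d_u ('D_d_v t) q.
Proof. by move=> Uq; rewrite FuvE; exact: height (smooth_derivable_u sFv Uq) tv Uq. Qed.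
Let tvv q : U q -> (Fvv q).2 = 'D_d_v ('D_d_v t) q.
Proof. by move=> Uq; rewrite FvvE; exact: height (smooth_derivable_v sFv Uq) tv Uq. Qed.
Let nuu q : U q -> (nU q).2 = 'D_d_u nu q.
Proof.
move=> Uq; rewrite nUE; apply: height (smooth_derivable_u sn Uq) _ Uq => p _.
by rewrite nuE.
Qed.
Let nuv q : U q -> (nV q).2 = 'D_d_v nu q.
Proof.
move=> Uq; rewrite nVE; apply: height (smooth_derivable_v sn Uq) _ Uq => p _.
by rewrite nuE.
Qed.

Let uu_m q : U q -> ip (Fuu q) (m q) = - (lam q - eps * 'D_d_u t q * 'D_d_u t q).
Proof.
by move=> Uq; rewrite FuuE (orth_u sFu sm u_m Uq) dm_u // inner4_horizontal tu // u_u.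
Qed.

Let uv_m q : U q -> ip (Fuv q) (m q) = eps * 'D_d_v t q * 'D_d_u t q.
Proof.
move=> Uq; rewrite FuvE (orth_u sFv sm v_m Uq) dm_u // inner4_horizontal tu // tv //.
by rewrite inner4C conf_uv // sub0r opprK.
Qed.

Let vv_m q : U q -> ip (Fvv q) (m q) = - (lam q - eps * 'D_d_v t q * 'D_d_v t q).
Proof.
by move=> Uq; rewrite FvvE (orth_v sFv sm v_m Uq) dm_v // inner4_horizontal tv // conf_v.
Qed.

Let nU_m q : U q -> ip (nU q) (m q) = eps * nu q * 'D_d_u t q.
Proof.
move=> Uq; rewrite nUE (orth_u sn sm n_m Uq) dm_u // inner4_horizontal tu // n_u //.
by rewrite sub0r opprK nuE.
Qed.

Let nV_m q : U q -> ip (nV q) (m q) = eps * nu q * 'D_d_v t q.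
Proof.
move=> Uq; rewrite nVE (orth_v sn sm n_m Uq) dm_v // inner4_horizontal tv // n_v //.
by rewrite sub0r opprK nuE.
Qed.

(** F_u, F_v, n and m form an orthogonal frame of the ambient space, with squares lam, lam, eps and
    1/kap. This one expansion takes the place of the Gauss and Weingarten formulas. *)
Let frame q : U q -> forall x y, ip x y = ip x (Fu q) * ip y (Fu q) / lam q
  + ip x (Fv q) * ip y (Fv q) / lam q + ip x (n q) * ip y (n q) / eps
  + ip x (m q) * ip y (m q) / kap^-1.
Proof.
move=> Uq; have l0 := lt0r_neq0 (lam_gt0 Uq).
apply: inner4_parseval => //; rewrite ?invr_eq0 ?u_u ?conf_v ?n_n ?m_m ?conf_uv ?u_m ?v_m ?n_m //.
  by rewrite inner4C n_u.
by rewrite inner4C n_v.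
Qed.

Let sL : smooth_on U L. Proof. by rewrite LE; exact: smooth_inner4. Qed.
Let sM : smooth_on U M. Proof. by rewrite ME; exact: smooth_inner4. Qed.
Let sN : smooth_on U N. Proof. by rewrite NE; exact: smooth_inner4. Qed.

Let epsV : eps^-1 = eps.
Proof. by apply: (mulfI eps0); rewrite mulfV // -expr2 eps2. Qed.

(** Third derivatives of F commute, which leaves <F_uu, n_v> - <F_uv, n_u>, to be expanded in the
    frame. The component along m is the curvature term, and the trace turns (L + N) / (2 lam) into
    H. *)
Let codazzi1 q : U q -> 'D_d_v L q - 'D_d_u M q =
  H q * 'D_d_v lam q - kap * eps * nu q * lam q * 'D_d_v t q.
Proof.
move=> Uq; have l0 := lt0r_neq0 (lam_gt0 Uq).
have Lv : 'D_d_v L q = ip ('D_d_v Fuu q) (n q) + ip (Fuu q) (nV q).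
  by rewrite nVE -(dip_v (f := L) sFuu sn _ Uq) // => p _; rewrite LE.
have Mu : 'D_d_u M q = ip ('D_d_u Fuv q) (n q) + ip (Fuv q) (nU q).
  by rewrite nUE -(dip_u (f := M) sFuv sn _ Uq) // => p _; rewrite ME.
have third : 'D_d_v Fuu q = 'D_d_u Fuv q.
  by rewrite FuuE (derive4_swap oU sFu Uq); exact: near_eqD d_u Fvu Uq.
rewrite Lv Mu third (frame Uq (Fuu q) (nV q)) (frame Uq (Fuv q) (nU q)).
rewrite uu_u // uu_v // uu_m // uv_u // uv_v // uv_m // nU_u // nU_v // nU_n // nU_m //.
rewrite nV_u // nV_v // nV_n // nV_m // invrK epsV.
have tr : H q = (L q + N q) / (2 * lam q) by rewrite trace // mulrC mulKf // mulf_neq0 // pnatr_eq0.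
rewrite tr; have e2 := eps2; move: (ip ('D_d_u Fuv q) _) (ip (Fuv q) _) (ip (Fuu q) _) => a b c.
move: ('D_d_u lam q) ('D_d_v lam q) ('D_d_u t q) ('D_d_v t q) => lu lv x y.
apply: (lin_comb (c := kap * (- (nu q) * x * y * x * eps + nu q * x * y * x * eps)) e2).
by field.
Qed.

Let codazzi2 q : U q -> 'D_d_u N q - 'D_d_v M q =
  H q * 'D_d_u lam q - kap * eps * nu q * lam q * 'D_d_u t q.
Proof.
move=> Uq; have l0 := lt0r_neq0 (lam_gt0 Uq).
have Nu : 'D_d_u N q = ip ('D_d_u Fvv q) (n q) + ip (Fvv q) (nU q).
  by rewrite nUE -(dip_u (f := N) sFvv sn _ Uq) // => p _; rewrite NE.
have Mv : 'D_d_v M q = ip ('D_d_v Fuv q) (n q) + ip (Fuv q) (nV q).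
  by rewrite nVE -(dip_v (f := M) sFuv sn _ Uq) // => p _; rewrite ME.
have third : 'D_d_v Fuv q = 'D_d_u Fvv q.
  by rewrite FuvE (derive4_swap oU sFv Uq) FvvE.
rewrite Nu Mv third (frame Uq (Fvv q) (nU q)) (frame Uq (Fuv q) (nV q)).
rewrite vv_u // vv_v // vv_m // uv_u // uv_v // uv_m // nU_u // nU_v // nU_n // nU_m //.
rewrite nV_u // nV_v // nV_n // nV_m // invrK epsV.
have tr : H q = (L q + N q) / (2 * lam q) by rewrite trace // mulrC mulKf // mulf_neq0 // pnatr_eq0.
rewrite tr; move: (ip ('D_d_u Fvv q) _) (ip (Fuv q) _) (ip (Fvv q) _) => a b c.
move: ('D_d_u lam q) ('D_d_v lam q) ('D_d_u t q) ('D_d_v t q) => lu lv x y.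
by field.
Qed.

Let e4 : E4 R := (0, 1).
Let ip_e4 x : ip x e4 = eps * x.2.
Proof. by rewrite /inner4 /inner3 /e4 /= !mxE !mulr0 !add0r mulr1. Qed.
Let e4_ip x : ip e4 x = eps * x.2. Proof. by rewrite inner4C ip_e4. Qed.

(** The vertical vector e4 pairs with F_u, F_v, n and m to eps times t_u, t_v, nu and 0. Second
    derivatives of F then give the Hessian of t, first derivatives of n the gradient of nu, and e4
    itself the norm of dt. *)
Let height_frame q x : U q -> x.2 = ip x (Fu q) * 'D_d_u t q / lam q
  + ip x (Fv q) * 'D_d_v t q / lam q + eps * ip x (n q) * nu q.
Proof.
move=> Uq; apply: (mulfI eps0); rewrite -ip_e4 (frame Uq) !e4_ip tu // tv //.
have -> : (m q).2 = 0 by rewrite mE.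
have -> : (n q).2 = nu q by rewrite nuE.
rewrite epsV; move: (ip x _) (ip x _) (ip x _) => a b c.
move: ('D_d_u t q) ('D_d_v t q) => y z; field.
by rewrite lt0r_neq0 ?lam_gt0 // kap0.
Qed.

Lemma immersion_position_form q : U q ->
  [/\ ip (Fuu q) (m q) = - (lam q - eps * 'D_d_u t q * 'D_d_u t q),
      ip (Fuv q) (m q) = eps * 'D_d_v t q * 'D_d_u t q &
      ip (Fvv q) (m q) = - (lam q - eps * 'D_d_v t q * 'D_d_v t q)].
Proof. by move=> Uq; rewrite uu_m // uv_m // vv_m. Qed.

Lemma immersion_equations :
  surface_equations (fun f => 'D_d_u f) (fun f => 'D_d_v f) eps kap U lam L M N t nu H.
Proof.
have l0 q : U q -> lam q != 0 by move=> Uq; exact: lt0r_neq0 (lam_gt0 Uq).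
split.
- exact: oU.
- by move=> V; exact: derivation_du.
- by move=> V; exact: derivation_dv.
- by move=> V f q; exact: derive_swap.
- by rewrite lamE; exact: smooth_inner4.
- exact: sL.
- exact: sM.
- exact: sN.
- exact: st.
- exact: snu.
- exact: sH.
- exact: lam_gt0.
- exact: trace.
- exact: codazzi1.
- exact: codazzi2.
- move=> q Uq; have := height_frame (Fuu q) Uq; rewrite tuu // uu_u // uu_v //.
  rewrite -[ip _ _]/((fun q => ip (Fuu q) (n q)) q) -LE => ->.
  move: (l0 q Uq) (L q) ('D_d_u lam q) ('D_d_v lam q) ('D_d_u t q) ('D_d_v t q) => h l a b c d.
  by field.
- move=> q Uq; have := height_frame (Fuv q) Uq; rewrite tuv // uv_u // uv_v //.
  rewrite -[ip _ _]/((fun q => ip (Fuv q) (n q)) q) -ME => ->.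
  move: (l0 q Uq) (M q) ('D_d_u lam q) ('D_d_v lam q) ('D_d_u t q) ('D_d_v t q) => h l a b c d.
  by field.
- move=> q Uq; have := height_frame (Fvv q) Uq; rewrite tvv // vv_u // vv_v //.
  rewrite -[ip _ _]/((fun q => ip (Fvv q) (n q)) q) -NE => ->.
  move: (l0 q Uq) (N q) ('D_d_u lam q) ('D_d_v lam q) ('D_d_u t q) ('D_d_v t q) => h l a b c d.
  by field.
- move=> q Uq; have := height_frame (nU q) Uq; rewrite nuu // nU_u // nU_v // nU_n // => ->.
  move: (l0 q Uq) (L q) (M q) ('D_d_u t q) ('D_d_v t q) => h l a b c.
  by field.
- move=> q Uq; have := height_frame (nV q) Uq; rewrite nuv // nV_u // nV_v // nV_n // => ->.
  move: (l0 q Uq) (M q) (N q) ('D_d_u t q) ('D_d_v t q) => h l a b c.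
  by field.
move=> q Uq; have := height_frame e4 Uq; rewrite !e4_ip tu // tv //.
have -> : (n q).2 = nu q by rewrite nuE.
have -> : e4.2 = 1 by [].
move: (l0 q Uq) (nu q) ('D_d_u t q) ('D_d_v t q) => h y a b e.
apply: (mulfI eps0); apply: (lin_comb (c := - lam q) e).
apply: (lin_comb (c := - lam q) eps2).
by field.
Qed.
End Immersion.

(** * The Hopf differentials *)

Section HopfEquation.
Context {R : realType}.
Variables (U : set (R * R)) (Du Dv : (R * R -> R) -> R * R -> R).
Variables (lam L M N t nu H : R * R -> R) (eps kap : R).
Hypothesis eqs : surface_equations Du Dv eps kap U lam L M N t nu H.

(** The curvature terms of the Codazzi equations cancel against those coming from the Laplacian of
    t; this is what fixes the coefficient of t_z^2 in Q. What remains are the real and imaginary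
    parts of 2 Q_zbar. *)
Lemma hopf_equation : exists re im : R * R -> R,
  [/\ smooth_on U re, smooth_on U im,
   forall q, re q = H q * (L q - N q) - kap / 2 * (Du t q ^+ 2 - Dv t q ^+ 2),
   forall q, im q = - 2 * H q * M q + kap * Du t q * Dv t q &
   forall q, U q -> Du re q - Dv im q = 2 * (Du H q * L q + Dv H q * M q) /\
      Dv re q + Du im q = - 2 * (Du H q * M q + Dv H q * N q)].
Proof.
have oU := se_open eqs; have dDu := se_du eqs oU; have dDv := se_dv eqs oU.
have sL := se_L eqs; have sM := se_M eqs; have sN := se_N eqs; have sH := se_H eqs.
have st := se_t eqs; have slam := se_lam eqs.
have stu : smooth_on U (Du t) by exact: der_smooth st.
have stv : smooth_on U (Dv t) by exact: der_smooth st.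
exists (H * (L - N) - cst (kap / 2) * (Du t * Du t - Dv t * Dv t)).
exists (cst (- 2) * (H * M) + cst kap * (Du t * Dv t)).
split; [by smooth_tac|by smooth_tac|by []|by move=> q; rewrite !fctE !mulrA|].
move=> q Uq; derive_tac dDu oU; derive_tac dDv oU; rewrite !fctE.
have l0 := lt0r_neq0 (se_lam0 eqs Uq); have two : (2 : R) != 0 by rewrite pnatr_eq0.
have tr (D : (R * R -> R) -> R * R -> R) : derivation U D ->
    D L q + D N q = 2 * (D lam q * H q + lam q * D H q).
  move=> dD; have : D (L + N) q = D (cst 2 * (lam * H)) q.
    by apply: (der_eq dD) => // p Up; rewrite !fctE (se_trace eqs Up) mulrA.
  by derive_tac dD oU => h; apply: (lin_comb (c := 1) h); rewrite !fctE; ring.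
have lap : Du (Du t) q + Dv (Dv t) q = 2 * eps * lam q * H q * nu q.
  apply: (mulfI two); apply: (mulfI l0).
  apply: (lin_comb (c := 1) (se_hess_uu eqs Uq)); apply: (lin_comb (c := 1) (se_hess_vv eqs Uq)).
  apply: (lin_comb (c := 2 * lam q * eps * nu q) (se_trace eqs Uq)); ring.
have swap := se_swap eqs oU st Uq; have T := se_trace eqs Uq.
split.
  apply: (lin_comb (c := H q) (tr _ dDu)); apply: (lin_comb (c := -2 * H q) (se_codazzi2 eqs Uq)).
  apply: (lin_comb (c := - kap * Du t q) lap); apply: (lin_comb (c := - kap * Dv t q) swap).
  apply: (lin_comb (c := - Du H q) T); by field.
apply: (lin_comb (c := - H q) (tr _ dDv)); apply: (lin_comb (c := 2 * H q) (se_codazzi1 eqs Uq)).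
apply: (lin_comb (c := kap * Dv t q) lap); apply: (lin_comb (c := - kap * Du t q) swap).
apply: (lin_comb (c := Dv H q) T); by field.
Qed.
End HopfEquation.

(** * Complex derivatives and the Cauchy-Riemann equations *)

Section ComplexDerivative.
Context {R : realType}.
Local Open Scope complex_scope.
Implicit Types (U : set (R * R)) (F : R * R -> R[i]).

Lemma normC_le (x y b : R) : `|x| <= b -> `|y| <= b ->
  `|x +i* y : R[i]| <= (2 * b)%:C.
Proof.
move=> xb yb; rewrite normc_def lecR /=.
have b0 : 0 <= b by exact: le_trans xb.
rewrite -[2 * b]ger0_norm ?mulr_ge0 // -sqrtr_sqr; apply: ler_wsqrtr.
have : x ^+ 2 <= b ^+ 2 by rewrite -real_normK ?num_real // lerXn2r ?nnegrE.
have : y ^+ 2 <= b ^+ 2 by rewrite -real_normK ?num_real // lerXn2r ?nnegrE.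
have := sqr_ge0 b; rewrite exprMn => *; lra.
Qed.

Lemma normC_geRe (z : R[i]) : (`|complex.Re z|)%:C <= `|z|.
Proof. by rewrite normc_def lecR -sqrtr_sqr ler_wsqrtr // lerDl sqr_ge0. Qed.

Lemma normC_geIm (z : R[i]) : (`|complex.Im z|)%:C <= `|z|.
Proof. by rewrite normc_def lecR -sqrtr_sqr ler_wsqrtr // lerDr sqr_ge0. Qed.

Lemma complex_derivable_intro (F : R * R -> R[i]) (q : R * R) (l : R[i]) :
  (forall e : R, 0 < e -> exists2 d : R, 0 < d & forall k : R * R,
     `|k.1| < d -> `|k.2| < d ->
     `|F (k + q) - F q - toC k * l| <= e%:C * `|toC k|) ->
  derivable (fun z : cplx => F (complex.Re z, complex.Im z) : cplx) (q.1 +i* q.2) 1.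
Proof.
move=> H; apply/cvg_ex; exists l; apply/cvgrPdist_le => e e0.
(* Over [cplx] the tolerance is a complex number; being positive, it is real. *)
have [eI eR] : complex.Im e = 0 /\ 0 < complex.Re e.
  by move: e0; rewrite ltcE /= => /andP[/eqP].
have [d d0 Hd] := H _ eR.
rewrite near_withinE; apply/nbhs_ballP; exists (d%:C) => /=; first by rewrite ltcR.
move=> h; rewrite -ball_normE /ball_ /= sub0r normrN => hd h0.
case: h hd h0 => a b hd h0.
have ad : `|a| < d by rewrite -ltcR; apply: le_lt_trans hd; exact: (normC_geRe (a +i* b)).
have bd : `|b| < d by rewrite -ltcR; apply: le_lt_trans hd; exact: (normC_geIm (a +i* b)).
have := Hd (a, b) ad bd.
have -> : (a, b) + q = (complex.Re ((a +i* b : R[i]) *: 1 + (q.1 +i* q.2)),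
  complex.Im ((a +i* b : R[i]) *: 1 + (q.1 +i* q.2))).
  by rewrite [_ *: _]mulr1 /=; case: (q).
have -> : e = (complex.Re e)%:C by case: e eI {e0 eR Hd} => x y /= ->.
rewrite /toC /= -!surjective_pairing => hle.
have h1 : `|a +i* b : R[i]| != 0 by rewrite normr_eq0.
rewrite -(ler_pM2r (x := `|a +i* b : R[i]|)); last by rewrite lt0r h1 normr_ge0.
apply: le_trans hle; rewrite -normrM distrC mulrBl.
set X := F _ - F q.
have -> : (a +i* b)^-1 *: X * (a +i* b) = X.
  by rewrite -[_ *: X]/((a +i* b)^-1 * X) mulrAC mulVf ?mul1r.
by rewrite (mulrC l).
Qed.

Lemma CR_holomorphic U (F : R * R -> R[i]) (re im : R * R -> R) : open U ->
  smooth_on U re -> smooth_on U im ->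
  (forall q, U q -> F q = re q +i* im q) ->
  (forall q, U q -> 'D_d_u re q - 'D_d_v im q = 0 /\ 'D_d_v re q + 'D_d_u im q = 0) ->
  holomorphic_on U F.
Proof.
move=> oU sre sim FE CR q Uq.
have [c1 c2] := CR q Uq; pose a := 'D_d_u re q; pose b := 'D_d_u im q.
have imv : 'D_d_v im q = a by apply/esym/eqP; rewrite -subr_eq0 c1.
have rev : 'D_d_v re q = - b by apply/eqP; rewrite -addr_eq0 c2.
apply: (complex_derivable_intro (l := a +i* b)) => e e0.
(* One factor 2 is lost in [normC_le], another in |k.1| + |k.2| <= 2 |k|. *)
have e4 : 0 < e / 4 by rewrite divr_gt0.
have [r0 r00 box] := open_box oU Uq.
have [r1 r10 h1] := C1_estimate oU sre Uq e4.
have [r2 r20 h2] := C1_estimate oU sim Uq e4.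
exists (Num.min r0 (Num.min r1 r2)); first by rewrite !lt_min r00 r10 r20.
move=> k; rewrite !lt_min => /and3P[k10 k11 k12] /and3P[k20 k21 k22].
have B1 := h1 k k11 k21; have B2 := h2 k k12 k22.
rewrite rev in B1; rewrite imv in B2; rewrite (FE _ Uq) (FE _ (box k k10 k20)).
have -> : re (k + q) +i* im (k + q) - (re q +i* im q) - toC k * (a +i* b) =
   (re (k + q) - re q - (k.1 * a + k.2 * - b)) +i* (im (k + q) - im q - (k.1 * b + k.2 * a)).
  apply/eqP; rewrite eq_complex /toC /=; apply/andP; split; apply/eqP; ring.
apply: le_trans (normC_le B1 B2) _.
have n1 := normC_geRe (toC k); have n2 := normC_geIm (toC k).
move: n1 n2; rewrite /toC normc_def /= !lecR => n1 n2.
rewrite -[e%:C * _]/((e%:C) * (_)%:C) -rmorphM /= lecR.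
move: (Num.sqrt _) n1 n2 => s n1 n2.
have -> : 2 * (e / 4 * (`|k.1| + `|k.2|)) = e * ((`|k.1| + `|k.2|) / 2) by field.
by apply: ler_wpM2l; [exact: ltW|lra].
Qed.

Lemma holomorphic_elim U (F : R * R -> R[i]) q : holomorphic_on U F -> U q ->
  exists l : R[i], forall e : R, 0 < e -> exists2 d : R, 0 < d & forall h : R[i],
     h != 0 -> `|h| < d%:C ->
     `|F ((complex.Re h, complex.Im h) + q) - F q - h * l| <= e%:C * `|h|.
Proof.
move=> hF Uq; have /cvg_ex[l hl] := hF q Uq; exists l => e e0.
have eC : 0 < e%:C :> R[i] by rewrite ltcR.
move/cvgrPdist_le : (hl) => /(_ _ eC); rewrite near_withinE => /nbhs_ballP[d /= d0 hd].
have [dI dR] : complex.Im d = 0 /\ 0 < complex.Re d.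
  by move: d0; rewrite ltcE /= => /andP[/eqP].
have dE : d = (complex.Re d)%:C by case: d dI {d0 dR hd} => x y /= ->.
exists (complex.Re d) => // h h0; rewrite -dE => hlt.
have := hd h; rewrite -ball_normE /ball_ /= sub0r normrN => /(_ hlt h0).
case: h h0 hlt => a b h0 hlt; rewrite /toC /=.
have -> : (complex.Re ((a +i* b : R[i]) *: 1 + (q.1 +i* q.2)),
  complex.Im ((a +i* b : R[i]) *: 1 + (q.1 +i* q.2))) = (a, b) + q.
  by rewrite [_ *: _]mulr1 /=; case: (q).
rewrite -!surjective_pairing => hle.
have h1 : 0 < `|a +i* b : R[i]| by rewrite normr_gt0.
move: hle; rewrite -(ler_pM2r h1); apply: le_trans.
rewrite -normrM mulrBl; set X := F _ - F q.
have -> : (a +i* b)^-1 *: X * (a +i* b) = X.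
  by rewrite -[_ *: X]/((a +i* b)^-1 * X) mulrAC mulVf ?mul1r.
by rewrite distrC (mulrC l).
Qed.

Lemma holomorphic_directional (F : R * R -> R[i]) (q w : R * R) (l : R[i]) :
  (forall e : R, 0 < e -> exists2 d : R, 0 < d & forall h : R[i],
     h != 0 -> `|h| < d%:C ->
     `|F ((complex.Re h, complex.Im h) + q) - F q - h * l| <= e%:C * `|h|) ->
  `|toC w| = 1 ->
  is_derive q w (@complex.Re R \o F) (complex.Re (toC w * l)) /\
  is_derive q w (@complex.Im R \o F) (complex.Im (toC w * l)).
Proof.
move=> hF w1.
have E e : 0 < e -> exists2 d : R, 0 < d & forall s : R, s != 0 -> `|s| < d ->
    `|F (s *: w + q) - F q - s%:C * (toC w * l)| <= (e * `|s|)%:C.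
  move=> e0; have [d d0 hd] := hF e e0; exists d => // s s0 sd.
  have ns : `|s%:C * toC w| = `|s|%:C :> R[i].
    by rewrite normrM w1 mulr1 normc_def /= expr0n addr0 sqrtr_sqr.
  have sw : (complex.Re (s%:C * toC w), complex.Im (s%:C * toC w)) = s *: w.
    by rewrite /toC /=; case: (w) => x y /=; congr pair; rewrite /GRing.scale /=; ring.
  have := hd (s%:C * toC w); rewrite ns sw ltcR -mulrA rmorphM; apply => //.
  by rewrite -normr_eq0 ns -[0]/(0%:C) (inj_eq (@complexI R)) normr_eq0.
(* Real and imaginary parts are treated together, as real-linear maps bounded by the modulus. *)
have C (P : R[i] -> R) : (forall x y, P (x - y) = P x - P y) ->
    (forall z, (`|P z|)%:C <= `|z|) -> (forall (s : R) z, P (s%:C * z) = s * P z) ->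
    is_derive q w (P \o F) (P (toC w * l)).
  move=> PB Pn PZ.
  have cv : (fun h : R => h^-1 *: (((P \o F) \o shift q) (h *: w) - (P \o F) q)) @ 0^'
      --> P (toC w * l).
    apply/cvgrPdist_le => e e0; have [d d0 hd] := E e e0.
    rewrite near_withinE; apply/nbhs_ballP; exists d => // s;
      rewrite -ball_normE /ball_ /= sub0r normrN => sd s0.
    have s1 : 0 < `|s| by rewrite normr_gt0.
    rewrite -(ler_pM2r s1) -normrM mulrBl -[_ *: _]/(_ * _) mulrAC mulVf // mul1r.
    rewrite -lecR; apply: le_trans (hd s s0 sd); apply: le_trans (Pn _).
    by rewrite !PB PZ lecR distrC (mulrC _ s).
  by apply: DeriveDef; [apply/cvg_ex; exists (P (toC w * l))|apply/cvg_lim].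
split; apply: C.
- by case=> a b [c d].
- exact: normC_geRe.
- by move=> s [a b] /=; ring.
- by case=> a b [c d].
- exact: normC_geIm.
- by move=> s [a b] /=; ring.
Qed.

Lemma holomorphic_CR U (F : R * R -> R[i]) q : holomorphic_on U F -> U q ->
  exists a b : R, [/\ is_derive q d_u (@complex.Re R \o F) a,
    is_derive q d_u (@complex.Im R \o F) b,
    is_derive q d_v (@complex.Re R \o F) (- b) & is_derive q d_v (@complex.Im R \o F) a].
Proof.
move=> hF Uq; have [l hl] := holomorphic_elim hF Uq.
have [|u1 u2] := holomorphic_directional (w := d_u) hl.
  by rewrite normc_def /= expr1n expr0n addr0 sqrtr1.
have [|v1 v2] := holomorphic_directional (w := d_v) hl.
  by rewrite normc_def /= expr1n expr0n add0r sqrtr1.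
exists (complex.Re l), (complex.Im l); case: l {hl} u1 u2 v1 v2 => a b /= u1 u2 v1 v2; split.
- by apply: is_derive_eq u1 _; ring.
- by apply: is_derive_eq u2 _; ring.
- by apply: is_derive_eq v1 _; ring.
- by apply: is_derive_eq v2 _; ring.
Qed.
End ComplexDerivative.

(** * Frames and mean curvature in a conformal chart *)

Section ChartEquations.
Context {R : realType}.
Variables (eps kap : R).
Hypotheses (eps_pm1 : eps = 1 \/ eps = -1) (kap0 : kap <> 0).
Local Notation ip := (inner4 eps kap).

Definition basis4 (j : 'I_4) : E4 R :=
  if (j < 3)%N then (delta_mx 0 (inord j), 0) else (0, 1).

Lemma coord4_basis i j : coord4 i (basis4 j) = (i == j)%:R.
Proof.
rewrite /coord4 /basis4; case: ifP => i3; case: ifP => j3 /=; rewrite ?mxE //=.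
- by rewrite -!val_eqE /= !inordK.
- by rewrite -val_eqE /=; case: eqP => // ij; move: i3; rewrite ij j3.
- by rewrite -val_eqE /=; case: eqP => // ij; move: i3; rewrite ij j3.
have i4 : i = ord_max by apply: val_inj; apply/eqP; rewrite eqn_leq -ltnS ltn_ord /= leqNgt i3.
have j4 : j = ord_max by apply: val_inj; apply/eqP; rewrite eqn_leq -ltnS ltn_ord /= leqNgt j3.
by rewrite i4 j4 eqxx.
Qed.

Lemma smooth_E4 (U : set (R * R)) (A : R * R -> E4 R) : open U ->
  (forall j, smooth_on U (coord4 j \o A)) -> smooth_on U A.
Proof.
move=> oU sA.
have lin j : linear (fun a : R => a *: basis4 j).
  by move=> a x y; rewrite scalerDl scalerA.
have cont j : continuous (fun a : R => a *: basis4 j) by exact: scalel_continuous.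
have s j := smooth_linear oU (lin j) (cont j) (sA j).
have coordD j (x y : E4 R) : coord4 j (x + y) = coord4 j x + coord4 j y.
  by have := coord4_linear j 1 x y; rewrite !scale1r.
have coordZ j (a : R) (x : E4 R) : coord4 j (a *: x) = a * coord4 j x.
  have c0 : coord4 j (0 : E4 R) = 0.
    by have := coordD j 0 0; rewrite addr0 => /eqP;
      rewrite -subr_eq0 opprD addrA subrr sub0r oppr_eq0 => /eqP.
  by have := coord4_linear j a x 0; rewrite !addr0 c0 addr0.
pose G j := (fun a : R => a *: basis4 j) \o (coord4 j \o A).
apply: (smooth_eq (F := G 0 + G 1 + G 2 + G 3)) => //.
  move=> q _; apply: coord4_inj => j.
  rewrite !fctE /G /= !coordD !coordZ !coord4_basis.
  by case: j => -[|[|[|[|//]]]] j4; rewrite -!val_eqE /= ?mulr1 ?mulr0 ?addr0 ?add0r;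
    congr coord4; apply: val_inj.
apply/smooth_Cle => m; have sG j : Cle m U (G j) by move/smooth_Cle: (s j); apply.
by do ![apply: CleD => //].
Qed.

Lemma smooth_scale (U : set (R * R)) (f : R * R -> R) (A : R * R -> E4 R) : open U ->
  smooth_on U f -> smooth_on U A -> smooth_on U (fun q => f q *: A q).
Proof.
move=> oU sf sA; apply: smooth_E4 => // j.
apply: (smooth_eq (F := f * (coord4 j \o A))) => //.
  move=> q _; rewrite !fctE /=.
  by rewrite /coord4; case: ifP => // _ /=; rewrite !mxE.
by apply: smoothM => //; exact: smooth_coord4.
Qed.

Lemma push_u (F : R * R -> E4 R) : push F (cst d_u) = 'D_d_u F.
Proof. by apply/funext => q; rewrite /push /= scale1r scale0r addr0. Qed.

Lemma push_v (F : R * R -> E4 R) : push F (cst d_v) = 'D_d_v F.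
Proof. by apply/funext => q; rewrite /push /= scale1r scale0r add0r. Qed.

Lemma covD_u (F : R * R -> E4 R) q : covD (cst d_u) F q = 'D_d_u F q.
Proof. by rewrite /covD /= scale1r scale0r addr0. Qed.

Lemma covD_v (F : R * R -> E4 R) q : covD (cst d_v) F q = 'D_d_v F q.
Proof. by rewrite /covD /= scale1r scale0r add0r. Qed.

Section MeanCurvature.
Variables (U : set (R * R)) (F n : R * R -> E4 R) (lam : R * R -> R).
Hypotheses (oU : open U) (sF : smooth_on U F) (sn : smooth_on U n)
  (slam : smooth_on U lam) (lam_gt0 : forall q, U q -> 0 < lam q).
Hypotheses (uu : forall q, U q -> ip ('D_d_u F q) ('D_d_u F q) = lam q)
  (vv : forall q, U q -> ip ('D_d_v F q) ('D_d_v F q) = lam q)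
  (uv : forall q, U q -> ip ('D_d_u F q) ('D_d_v F q) = 0)
  (n_u : forall q, U q -> ip (n q) ('D_d_u F q) = 0)
  (n_v : forall q, U q -> ip (n q) ('D_d_v F q) = 0).

(** [mean_curvature] speaks only about smooth orthonormal frames, so one must be exhibited before H
    can be computed. The exponent omega comes without smoothness, hence the scaling by lam^(-1/2)
    with lam = <F_u, F_u>. *)
Lemma conformal_frame : exists e1 e2 : R * R -> R * R,
  [/\ smooth_on U e1, smooth_on U e2,
   forall q, U q -> [/\ ind_metric eps kap F e1 e1 q = 1, ind_metric eps kap F e2 e2 q = 1 &
     ind_metric eps kap F e1 e2 q = 0] &
   forall q, U q ->
     second_form eps kap F n e1 e1 q = ip ('D_d_u ('D_d_u F) q) (n q) / lam q /\
     second_form eps kap F n e2 e2 q = ip ('D_d_v ('D_d_v F) q) (n q) / lam q].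
Proof.
have [f [sf ff]] : exists f : R * R -> R, smooth_on U f /\ forall q, U q -> f q * f q = (lam q)^-1.
  exists (finv (Num.sqrt \o lam)); split.
    apply: smoothV => //; last exact: smooth_sqrt.
    by move=> q Uq; rewrite /= gt_eqF // sqrtr_gt0 lam_gt0.
  by move=> q Uq; rewrite /finv /= -invfM -expr2 sqr_sqrtr // ltW // lam_gt0.
have s0 := smooth_cst U (0 : R).
exists (fun q => (f q, 0)), (fun q => (0, f q)).
have p1 : push F (fun q => (f q, 0)) = fun q => f q *: 'D_d_u F q.
  by apply/funext => q; rewrite /push /= scale0r addr0.
have p2 : push F (fun q => (0, f q)) = fun q => f q *: 'D_d_v F q.
  by apply/funext => q; rewrite /push /= scale0r add0r.
have ipZ a b x y : ip (a *: x) (b *: y) = a * b * ip x y.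
  by rewrite inner4Zl inner4C inner4Zl inner4C mulrA.
have l0 q : U q -> lam q != 0 by move=> /lam_gt0/lt0r_neq0.
split.
- exact: smooth_pair.
- exact: smooth_pair.
- move=> q Uq; rewrite /ind_metric p1 p2; split.
  + by rewrite ipZ uu // ff // mulVf ?l0.
  + by rewrite ipZ vv // ff // mulVf ?l0.
  + by rewrite ipZ uv // mulr0.
move=> q Uq.
(* The scaling factor need not be differentiated: f A and A are both orthogonal to n, so <D(f A), n>
   = -f <A, D n> = f <D A, n>. *)
have key w (A : R * R -> E4 R) : smooth_on U A -> derivable (fun p => f p *: A p) q w ->
    derivable A q w -> derivable n q w -> (forall p, U p -> ip (n p) (A p) = 0) ->
    f q * ip ('D_w (fun p => f p *: A p) q) (n q) = ip ('D_w A q) (n q) / lam q.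
  move=> sA dfA dA dn nA.
  have near0 (g : R * R -> R) : (forall p, U p -> g p = 0) -> 'D_w g q = 0.
    move=> g0; rewrite -(derive_cst (0 : R) q w); apply: near_eq_derive.
    by near do apply: g0; exact: open_nbhs_nbhs.
  have h1 : ip ('D_w (fun p => f p *: A p) q) (n q) + f q * ip (A q) ('D_w n q) = 0.
    rewrite -inner4Zl -(derive_inner4 eps kap dfA dn); apply: near0 => p Up.
    by rewrite inner4Zl inner4C nA // mulr0.
  have h2 : ip ('D_w A q) (n q) + ip (A q) ('D_w n q) = 0.
    by rewrite -(derive_inner4 eps kap dA dn); apply: near0 => p Up; rewrite inner4C nA.
  have scalar (a b c d : R) : a + d * c = 0 -> b + c = 0 -> d * a = b * (d * d).
    by move=> /eqP; rewrite addr_eq0 => /eqP -> /eqP; rewrite addr_eq0 => /eqP ->; ring.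
  by rewrite -ff //; exact: scalar h1 h2.
have su := smooth_du sF; have sv := smooth_dv sF.
have c1 (G : R * R -> E4 R) : covD (fun q => (f q, 0)) G q = f q *: 'D_d_u G q.
  by rewrite /covD /= scale0r addr0.
have c2 (G : R * R -> E4 R) : covD (fun q => (0, f q)) G q = f q *: 'D_d_v G q.
  by rewrite /covD /= scale0r add0r.
split.
  rewrite /second_form p1 c1 inner4Zl; apply: (key d_u ('D_d_u F) su) => //.
  - exact: (smooth_derivable_u (smooth_scale oU sf su) Uq).
  - exact: (smooth_derivable_u su Uq).
  - exact: (smooth_derivable_u sn Uq).
rewrite /second_form p2 c2 inner4Zl; apply: (key d_v ('D_d_v F) sv) => //.
- exact: (smooth_derivable_v (smooth_scale oU sf sv) Uq).
- exact: (smooth_derivable_v sv Uq).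
- exact: (smooth_derivable_v sn Uq).
Unshelve. all: by end_near. Qed.
End MeanCurvature.
End ChartEquations.

(* Opaque names for iterated derivatives keep unification from unfolding them. *)
Lemma abbreviate (T : Type) (x : T) : exists y, y = x.
Proof. by exists x. Qed.

(** * Holomorphy of Q and the kernel of the second form *)

Section HolomorphicQ.
Context {R : realType}.
Variables (eps kap : R) (S : riemannSurface R) (X n1 : S -> E4 R) (H : S -> R).
Hypotheses (eps_pm1 : eps = 1 \/ eps = -1) (kap0 : kap <> 0).
Hypotheses (conformal_X : conformal_immersion eps kap X)
  (unit_normal_n1 : unit_normal eps kap X n1)
  (mean_curvature_H : mean_curvature eps kap X n1 H).
Local Notation ip := (inner4 eps kap).
Local Notation Du := (fun f : R * R -> R => 'D_d_u f).
Local Notation Dv := (fun f : R * R -> R => 'D_d_v f).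

(** H is given only through its values on orthonormal frames. The conformal frame yields H = (L + N)
    / (2 lam), from which the smoothness of H follows. *)
Lemma chart_surface c : atlas c -> exists lam L M N t nu : R * R -> R,
  [/\ surface_equations Du Dv eps kap (img c) lam L M N t nu (H \o from_plane c),
    forall q, lam q = ip ('D_d_u (X \o from_plane c) q) ('D_d_u (X \o from_plane c) q) &
    forall q, img c q -> Qcoef eps kap X n1 H c q =
      Complex (H (from_plane c q) * (L q - N q) - kap / 2 * ('D_d_u t q ^+ 2 - 'D_d_v t q ^+ 2))
        (- 2 * H (from_plane c q) * M q + kap * 'D_d_u t q * 'D_d_v t q)].
Proof.
move=> ac; case: conformal_X => sX XM conf; case: unit_normal_n1 => sn nX nn nT.
have k0 : kap != 0 by apply/eqP.
pose U := img c; pose F : R * R -> E4 R := X \o from_plane c.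
pose n : R * R -> E4 R := n1 \o from_plane c.
have oU : open U by exact: open_img.
have sF : smooth_on U F by exact: sX.
have snc : smooth_on U n by exact: sn.
have [Fu FuE] := abbreviate ('D_d_u F).
have [Fv FvE] := abbreviate ('D_d_v F).
have [Fuu FuuE] := abbreviate ('D_d_u Fu).
have [Fuv FuvE] := abbreviate ('D_d_u Fv).
have [Fvv FvvE] := abbreviate ('D_d_v Fv).
have FuuQ q : 'D_d_u ('D_d_u F) q = Fuu q.
  rewrite FuuE FuE; exact: erefl.
have FvvQ q : 'D_d_v ('D_d_v F) q = Fvv q.
  rewrite FvvE FvE; exact: erefl.
have FuvQ q : 'D_d_u ('D_d_v F) q = Fuv q.
  rewrite FuvE FvE; exact: erefl.
have FuQ q : 'D_d_u F q = Fu q.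
  rewrite FuE; exact: erefl.
have FvQ q : 'D_d_v F q = Fv q.
  rewrite FvE; exact: erefl.
have [lam lamE] := abbreviate (fun q => ip (Fu q) (Fu q)).
have sFu : smooth_on U Fu by rewrite FuE; exact: smooth_du.
have sFv : smooth_on U Fv by rewrite FvE; exact: smooth_dv.
have slam : smooth_on U lam by rewrite lamE; exact: smooth_inner4.
have gr q : U q -> [/\ 0 < lam q, ip (Fv q) (Fv q) = lam q & ip (Fu q) (Fv q) = 0].
  move=> Uq; have [omega ho] := conf c ac; have := ho q Uq.
  rewrite /ind_metric push_u push_v -/F FuQ FvQ lamE => -[-> -> ->].
  by rewrite expR_gt0.
have lam_gt0 q : U q -> 0 < lam q by case/gr.
have vv q : U q -> ip (Fv q) (Fv q) = lam q by case/gr.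
have uv q : U q -> ip (Fu q) (Fv q) = 0 by case/gr.
have n_u q : U q -> ip (n q) (Fu q) = 0.
  by move=> Uq; have := nT c ac q Uq (cst d_u); rewrite push_u -/F FuQ.
have n_v q : U q -> ip (n q) (Fv q) = 0.
  by move=> Uq; have := nT c ac q Uq (cst d_v); rewrite push_v -/F FvQ.
have [L LE] := abbreviate (fun q => ip (Fuu q) (n q)).
have [M ME] := abbreviate (fun q => ip (Fuv q) (n q)).
have [N NE] := abbreviate (fun q => ip (Fvv q) (n q)).
have sFuu : smooth_on U Fuu by rewrite FuuE; exact: smooth_du.
have sFvv : smooth_on U Fvv by rewrite FvvE; exact: smooth_dv.
have sL : smooth_on U L by rewrite LE; exact: smooth_inner4.
have sN : smooth_on U N by rewrite NE; exact: smooth_inner4.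
have l0 q : U q -> lam q != 0 by move=> /lam_gt0/lt0r_neq0.
have Hc q : U q -> (cst 2^-1 * (L + N) * finv lam) q = (H \o from_plane c) q.
  move=> Uq; rewrite !fctE /finv.
  have h1 p : U p -> ip ('D_d_u F p) ('D_d_u F p) = lam p by move=> _; rewrite FuQ lamE.
  have h2 p : U p -> ip ('D_d_v F p) ('D_d_v F p) = lam p by rewrite FvQ; exact: vv.
  have h3 p : U p -> ip ('D_d_u F p) ('D_d_v F p) = 0 by rewrite FuQ FvQ; exact: uv.
  have h4 p : U p -> ip (n p) ('D_d_u F p) = 0 by rewrite FuQ; exact: n_u.
  have h5 p : U p -> ip (n p) ('D_d_v F p) = 0 by rewrite FvQ; exact: n_v.
  have [e1 [e2 [se1 se2 orth sff]]] := conformal_frame oU sF snc slam lam_gt0 h1 h2 h3 h4 h5.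
  have [f1 f2] := sff q Uq.
  apply: etrans (esym (mean_curvature_H ac se1 se2 orth Uq)).
  rewrite -mulrA mulrDl LE NE; congr (_ * (_ + _)).
    by apply: etrans (esym f1); rewrite FuuQ.
  by apply: etrans (esym f2); rewrite FvvQ.
have sH : smooth_on U (H \o from_plane c).
  apply: smooth_eq Hc _ => //; apply: smoothM => //; last exact: smoothV.
  by apply: smoothM => //; [exact: smooth_cst|exact: smoothD].
have trace q : U q -> L q + N q = 2 * lam q * (H \o from_plane c) q.
  move=> Uq; rewrite -Hc // !fctE /finv; move: (l0 q Uq) => h.
  by field.
have [t tE] := abbreviate (fun q => (F q).2).
have [nu nuE] := abbreviate (fun q => (n q).2).
have [m mE] := abbreviate (fun q => horizontal (F q)).
have sph q : U q -> inner3 kap (F q).1 (F q).1 = Num.sg kap * Defs.radius kap ^+ 2.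
  by move=> _; have [] := XM (from_plane c q).
have nm q : U q -> ip (n q) (m q) = 0 by move=> _; rewrite mE; exact: nX.
have nn' q : U q -> ip (n q) (n q) = eps by move=> _; exact: nn.
exists lam, L, M, N, t, nu; split.
- exact: (immersion_equations eps_pm1 k0 oU sF snc FuE FvE FuuE FuvE FvvE erefl erefl mE
    lamE LE ME NE tE nuE sph lam_gt0 vv uv nm nn' n_u n_v trace sH).
- by move=> q; rewrite FuQ lamE.
move=> q Uq.
have [m1 m2 m3] := immersion_position_form k0 oU sF FuE FvE FuuE FuvE FvvE mE lamE tE sph vv uv Uq.
have n2m x : ip x ((n2 kap X \o from_plane c) q) = (Defs.radius kap)^-1 * ip x (m q).
  have -> : (n2 kap X \o from_plane c) q = (Defs.radius kap)^-1 *: m q.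
    by rewrite mE /n2 /horizontal /=; congr pair; rewrite scaler0.
  by rewrite inner4C inner4Zl inner4C.
rewrite /Qcoef /hopf.
have sf1 (k : R * R -> E4 R) : second_form eps kap F k (cst d_u) (cst d_u) q = ip (Fuu q) (k q).
  by rewrite /second_form push_u covD_u FuuQ.
have sf2 (k : R * R -> E4 R) : second_form eps kap F k (cst d_u) (cst d_v) q = ip (Fuv q) (k q).
  by rewrite /second_form push_v covD_u FuvQ.
have sf3 (k : R * R -> E4 R) : second_form eps kap F k (cst d_v) (cst d_v) q = ip (Fvv q) (k q).
  by rewrite /second_form push_v covD_v FvvQ.
rewrite !sf1 !sf2 !sf3 !n2m m1 m2 m3.
have Lq : ip (Fuu q) ((n1 \o from_plane c) q) = L q by rewrite LE.
have Mq : ip (Fuv q) ((n1 \o from_plane c) q) = M q by rewrite ME.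
have Nq : ip (Fvv q) ((n1 \o from_plane c) q) = N q by rewrite NE.
rewrite Lq Mq Nq; have r2 : Num.sg kap * (Defs.radius kap)^-1 ^+ 2 = kap.
  by rewrite exprVn radius_sqr invrK -numEsg.
have e2 : eps ^+ 2 = 1 by case: eps_pm1 => ->; rewrite ?sqrrN expr1n.
move: (Num.sg kap) ((Defs.radius kap)^-1) r2 => sg r r2.
move: ('D_d_u t q) ('D_d_v t q) (L q) (M q) (N q) (lam q) (H (from_plane c q)) => x y l m' n' la h.
apply/eqP; rewrite eq_complex /=; apply/andP; split; apply/eqP.
  apply: (lin_comb (c := - (eps ^+ 2) * 2^-1 * (x ^+ 2 - y ^+ 2)) r2).
  apply: (lin_comb (c := - kap * 2^-1 * (x ^+ 2 - y ^+ 2)) e2); by field.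
apply: (lin_comb (c := eps ^+ 2 * x * y) r2).
by apply: (lin_comb (c := kap * x * y) e2); field.
Qed.

Let hopf_pair c (ac : atlas c) : exists lam L M N t nu re im : R * R -> R,
  [/\ surface_equations Du Dv eps kap (img c) lam L M N t nu (H \o from_plane c),
    forall q, lam q = ip ('D_d_u (X \o from_plane c) q) ('D_d_u (X \o from_plane c) q),
    smooth_on (img c) re /\ smooth_on (img c) im,
    forall q, img c q -> Qcoef eps kap X n1 H c q = Complex (re q) (im q) &
    forall q, img c q ->
      'D_d_u re q - 'D_d_v im q = 2 * ('D_d_u (H \o from_plane c) q * L q + 'D_d_v (H \o
        from_plane c) q * M q) /\
      'D_d_v re q + 'D_d_u im q = - 2 * ('D_d_u (H \o from_plane c) q * M q + 'D_d_v (H \o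
        from_plane c) q * N q)].
Proof.
have [lam [L [M [N [t [nu [eqs lamE QE]]]]]]] := chart_surface ac.
have [re [im [sre sim reE imE CR]]] := hopf_equation eqs.
exists lam, L, M, N, t, nu, re, im; split=> //.
by move=> q Uq; rewrite QE // reE imE.
Qed.

Lemma constant_H_holomorphic : constant_function H -> Q_holomorphic eps kap X n1 H.
Proof.
case=> a Ha c ac.
have [lam [L [M [N [t [nu [re [im [eqs _ [sre sim] QE CR]]]]]]]]] := hopf_pair ac.
have D0 w q : 'D_w (H \o from_plane c) q = 0.
  have -> : H \o from_plane c = cst a by apply/funext => p; exact: Ha.
  exact: derive_cst.
apply: (CR_holomorphic (open_img (c := c)) sre sim QE) => q Uq.
by have [-> ->] := CR q Uq; rewrite !D0 !mul0r addr0 !mulr0.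
Qed.

Lemma holomorphic_kernel c : Q_holomorphic eps kap X n1 H -> atlas c ->
  exists lam L M N t nu : R * R -> R,
  [/\ surface_equations Du Dv eps kap (img c) lam L M N t nu (H \o from_plane c),
    forall q, lam q = ip ('D_d_u (X \o from_plane c) q) ('D_d_u (X \o from_plane c) q),
    forall q, img c q ->
      'D_d_u (H \o from_plane c) q * L q + 'D_d_v (H \o from_plane c) q * M q = 0 &
    forall q, img c q ->
      'D_d_u (H \o from_plane c) q * M q + 'D_d_v (H \o from_plane c) q * N q = 0].
Proof.
move=> hQ ac.
have [lam [L [M [N [t [nu [re [im [eqs lamE [sre sim] QE CR]]]]]]]]] := hopf_pair ac.
have K q : img c q -> 'D_d_u re q - 'D_d_v im q = 0 /\ 'D_d_v re q + 'D_d_u im q = 0.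
  move=> Uq; have [a [b [u1 u2 v1 v2]]] := holomorphic_CR (hQ c ac) Uq.
  have oU := open_img (c := c).
  have nb (P : R[i] -> R) (f : R * R -> R) :
      (forall p, img c p -> P (Qcoef eps kap X n1 H c p) = f p) ->
      \near q, (P \o Qcoef eps kap X n1 H c) q = f q.
    by move=> Pf; near do apply: Pf; exact: open_nbhs_nbhs.
  have nre := nb (@complex.Re R) re (fun p Up => congr1 (@complex.Re R) (QE p Up)).
  have nim := nb (@complex.Im R) im (fun p Up => congr1 (@complex.Im R) (QE p Up)).
  rewrite -!(near_eq_derive _ nre) -!(near_eq_derive _ nim).
  by rewrite !derive_val subrr addNr.
have two : (2 : R) != 0 by rewrite pnatr_eq0.
exists lam, L, M, N, t, nu; split=> // q Uq; have [k1 k2] := K q Uq; have [c1 c2] := CR q Uq.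
  by apply: (mulfI two); rewrite -c1 k1 mulr0.
have m2 : - (2 : R) != 0 by rewrite oppr_eq0.
by apply: (mulfI m2); rewrite -c2 k2 mulr0.
Unshelve. all: by end_near. Qed.
End HolomorphicQ.

(** * Charts and the global argument *)

Section Charts.
Context {R : realType}.
Variable S : riemannSurface R.

Lemma is_derive_pair (V : normedModType R) (f g : V -> R) (q w : V) (a b : R) :
  is_derive q w f a -> is_derive q w g b -> is_derive q w (fun p => (f p, g p)) (a, b).
Proof.
move=> [df fa] [dg gb].
have cv : (fun h : R => h^-1 *: (((fun p => (f p, g p)) \o shift q) (h *: w) - (f q,
  g q))) @ 0^' --> (a, b).
  have -> : (fun h : R => h^-1 *: (((fun p => (f p, g p)) \o shift q) (h *: w) - (f q, g q))) =
    (fun h : R => (h^-1 *: ((f \o shift q) (h *: w) - f q),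
      h^-1 *: ((g \o shift q) (h *: w) - g q))).
    by [].
  rewrite -fa -gb; apply: (@cvg_pair _ _ _ _ (nbhs ('D_w f q)) (nbhs ('D_w g q))).
    exact: df.
  exact: dg.
by apply: DeriveDef; [apply/cvg_ex; exists (a, b)|apply/cvg_lim].
Qed.

Lemma open_overlap (c d : @chart R S) : open (overlap c d).
Proof.
rewrite openE => q [cq dq].
have oi : open_nbhs q (img c) by split; [exact: open_img|].
have od : nbhs (from_plane c q) (dom d).
  by apply: open_nbhs_nbhs; split; [exact: open_dom|].
near=> p; split; first by near: p; exact: open_nbhs_nbhs.
by near: p; exact: (from_plane_cont cq od).
Unshelve. all: by end_near. Qed.

Lemma transition_derive (c d : @chart R S) (q : R * R) : atlas c -> atlas d -> overlap c d q ->
  exists a b : R, is_derive q d_u (transition c d) (a, b) /\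
    is_derive q d_v (transition c d) (- b, a).
Proof.
move=> ac ad oq; have [hcd _] := atlas_compatible ac ad.
have [a [b [u1 u2 v1 v2]]] := holomorphic_CR (U := overlap c d) hcd oq.
have E : transition c d = fun p => ((@complex.Re R \o (toC \o transition c d)) p,
    (@complex.Im R \o (toC \o transition c d)) p).
  by apply/funext => p; rewrite /toC /=; case: (transition c d p).
exists a, b; rewrite {1 2}E; split; exact: is_derive_pair.
Qed.

Lemma derive_chart_change (f : S -> R) (c d : @chart R S) (q : R * R) (a b : R) (w : R * R) :
  overlap c d q -> smooth_on (img d) (f \o from_plane d) ->
  is_derive q w (transition c d) (a, b) ->
  'D_w (f \o from_plane c) q = a * 'D_d_u (f \o from_plane d) (transition c d q)
     + b * 'D_d_v (f \o from_plane d) (transition c d q).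
Proof.
move=> oq sf [dT Tab].
have iT : img d (transition c d q) by apply: to_plane_img; case: oq.
have [_ E] := is_derive_comp (open_img (c := d)) sf iT dT.
rewrite Tab /= in E.
have oo : open_nbhs q (overlap c d) by split; [exact: open_overlap|].
rewrite -E; apply: near_eq_derive; near=> p.
have [_ dp] : overlap c d p by near: p; exact: open_nbhs_nbhs.
by rewrite /transition /= to_planeK.
Unshelve. all: by end_near. Qed.

Lemma zero_gradient_constant (U : set (R * R)) (f : R * R -> R) (k q : R * R) :
  open U -> smooth_on U f -> (forall x : R, 0 <= x <= 1 -> U (x *: k + q)) ->
  (forall p, U p -> 'D_d_u f p = 0 /\ 'D_d_v f p = 0) -> f (k + q) = f q.
Proof.
move=> oU sf sU Df.
have D (x : R) : 0 <= x <= 1 -> is_derive x 1 (fun h : R => f (h *: k + q)) 0.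
  move=> x01; have h := smooth_line oU sf (sU x x01); have [fu fv] := Df _ (sU x x01).
  by apply: is_derive_eq h _; rewrite fu fv !mulr0 addr0.
have cont : {within `[0, 1], continuous (fun h : R => f (h *: k + q))}.
  apply: derivable_within_continuous => x; rewrite in_itv => x01.
  by have h := D x x01; exact: ex_derive.
have [x|c _] := MVT (df := cst 0) (@ltr01 R) _ cont.
  by rewrite in_itv => /andP[x0 x1]; apply: D; rewrite !ltW.
by rewrite mul0r scale1r scale0r add0r => /eqP; rewrite subr_eq0 => /eqP.
Qed.

(** The box is star-shaped about its centre, as required for arguments along segments in a chart. *)
Lemma chart_box (c : @chart R S) (x : S) : dom c x -> exists2 B : set (R * R),
  [/\ open B, B `<=` img c & B (to_plane c x)] &
  (forall k, B (k + to_plane c x) -> forall s : R, 0 <= s <= 1 -> B (s *: k + to_plane c x)).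
Proof.
move=> dx; pose q := to_plane c x.
have [r r0 box] := open_box (open_img (c := c)) (to_plane_img dx).
exists [set p | `|(p - q).1| < r /\ `|(p - q).2| < r]; last first.
  move=> k /=; rewrite -/q !addrK => -[k1 k2] s s01 /=; rewrite -/q !addrK.
  have small (y : R) : `|y| < r -> `|s * y| < r.
    case/andP: s01 => s0 s1 yr; rewrite normrM (ger0_norm s0).
    by apply: le_lt_trans yr; rewrite ler_piMl.
  by split; [exact: (small k.1 k1)|exact: (small k.2 k2)].
split.
- have -> : [set p | `|(p - q).1| < r /\ `|(p - q).2| < r] = ball q r.
    apply/seteqP; split=> p; rewrite -ball_normE /ball_ /= -normrN opprB prod_normE gt_max.
      by case=> -> ->.
    by move/andP.
  exact: ball_open.
- by move=> p [p1 p2]; rewrite -(subrK q p); exact: box.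
- by rewrite /= -/q !subrr normr0.
Qed.
End Charts.

(** * The critical set of H on the surface *)

Section Global.
Context {R : realType}.
Variables (eps kap : R) (S : riemannSurface R) (X n1 : S -> E4 R) (H : S -> R).
Hypotheses (eps_pm1 : eps = 1 \/ eps = -1) (kap0 : kap <> 0).
Hypotheses (conformal_X : conformal_immersion eps kap X)
  (unit_normal_n1 : unit_normal eps kap X n1)
  (mean_curvature_H : mean_curvature eps kap X n1 H)
  (hQ : Q_holomorphic eps kap X n1 H).
Local Notation ip := (inner4 eps kap).

Let kernel c (ac : atlas c) := holomorphic_kernel eps_pm1 kap0 conformal_X
  unit_normal_n1 mean_curvature_H hQ ac.

Lemma smooth_H : smooth H.
Proof. by move=> c ac; have [? [? [? [? [? [? [eqs _ _ _]]]]]]] := kernel ac; exact: se_H eqs. Qed.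

(** [critical_point] quantifies over all charts around x; the chain rule transfers the condition
    from a single one. *)
Lemma critical_at_chart c x : atlas c -> dom c x ->
  'D_d_u (H \o from_plane c) (to_plane c x) = 0 ->
  'D_d_v (H \o from_plane c) (to_plane c x) = 0 -> critical_point H x.
Proof.
move=> ac dx hu hv d ad ddx.
have oq : overlap d c (to_plane d x) by split; [exact: to_plane_img|rewrite /= to_planeK].
have [a [b [Tu Tv]]] := transition_derive ad ac oq.
have Tx : transition d c (to_plane d x) = to_plane c x by rewrite /transition /= to_planeK.
rewrite (derive_chart_change oq (smooth_H ac) Tu) (derive_chart_change oq (smooth_H ac) Tv).
by rewrite Tx hu hv !mulr0 addr0.
Qed.

Lemma open_critical : open [set x | critical_point H x].
Proof.
rewrite openE => x crx; have [c ac dx] := atlas_cover x.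
have [B [oB Bc Bx] segB] := chart_box dx.
have [lam [L [M [N [t [nu [eqs _ k1 k2]]]]]]] := kernel ac.
have eqB := surface_equations_sub oB Bc eqs.
have e2 : eps ^+ 2 = 1 by case: eps_pm1 => ->; rewrite ?sqrrN expr1n.
have k0 : kap != 0 by apply/eqP.
have [hu hv] := crx c ac dx.
have nx : nbhs x (dom c `&` to_plane c @^-1` B).
  apply: filterI; first by apply: open_nbhs_nbhs; split; [exact: open_dom|].
  by apply: (to_plane_cont dx); apply: open_nbhs_nbhs.
apply: filterS nx => y [dy By].
have yq : (to_plane c y - to_plane c x) + to_plane c x = to_plane c y by rewrite subrK.
have := critical_persists e2 k0 eqB (fun p Bp => k1 p (Bc p Bp)) (fun p Bp => k2 p (Bc p Bp))
  (q := to_plane c x) (k := to_plane c y - to_plane c x).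
rewrite yq !fctE hu hv !mulr0 addr0 => /(_ _ erefl) Sy.
have /Sy/eqP : forall s : R, 0 <= s <= 1 -> B (s *: (to_plane c y - to_plane c x) + to_plane c x).
  by apply: segB; rewrite yq.
rewrite -!expr2 paddr_eq0 ?sqr_ge0 // !sqrf_eq0 => /andP[/eqP yu /eqP yv].
exact: (critical_at_chart ac dy).
Qed.

Lemma open_regular : open [set x | ~ critical_point H x].
Proof.
rewrite openE => x ncr.
have [c [ac [dx Sx]]] : exists c, atlas c /\ (dom c x /\
    ('D_d_u (H \o from_plane c) * 'D_d_u (H \o from_plane c) +
     'D_d_v (H \o from_plane c) * 'D_d_v (H \o from_plane c)) (to_plane c x) != 0).
  apply: contrapT => nex; apply: ncr => c ac dx.
  have : ('D_d_u (H \o from_plane c) * 'D_d_u (H \o from_plane c) +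
     'D_d_v (H \o from_plane c) * 'D_d_v (H \o from_plane c)) (to_plane c x) = 0.
    by apply/eqP; apply: contraT => n0; case: nex; exists c.
  rewrite !fctE -!expr2 => /eqP; rewrite paddr_eq0 ?sqr_ge0 // !sqrf_eq0.
  by move=> /andP[/eqP ? /eqP ?].
have oc := open_img (c := c); have sH := smooth_H ac.
have sHu := smooth_du sH; have sHv := smooth_dv sH.
have sS : smooth_on (img c) ('D_d_u (H \o from_plane c) * 'D_d_u (H \o from_plane c) +
    'D_d_v (H \o from_plane c) * 'D_d_v (H \o from_plane c)).
  by apply: smoothD => //; apply: smoothM.
have oV := open_neq0 oc sS.
have nx : nbhs x (dom c `&` to_plane c @^-1` [set q | img c q /\
    ('D_d_u (H \o from_plane c) * 'D_d_u (H \o from_plane c) +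
    'D_d_v (H \o from_plane c) * 'D_d_v (H \o from_plane c)) q != 0]).
  apply: filterI; first by apply: open_nbhs_nbhs; split; [exact: open_dom|].
  apply: (to_plane_cont dx); apply: open_nbhs_nbhs; split=> //; split=> //.
  exact: to_plane_img.
apply: filterS nx => y [dy [_ Sy]] cry; have [yu yv] := cry c ac dy.
by move: Sy; rewrite !fctE yu yv mulr0 addr0 eqxx.
Qed.

Lemma critical_dichotomy :
  (forall x, critical_point H x) \/ (forall x, ~ critical_point H x).
Proof.
have [[x crx]|ncr] := pselect (exists x, critical_point H x); last first.
  by right=> x crx; apply: ncr; exists x.
left=> y; have : [set x | critical_point H x] = [set: S].
  apply: carrier_connected.
  - by exists x.
  - by exists [set x | critical_point H x]; [exact: open_critical|rewrite setTI].
  exists [set x | critical_point H x]; last by rewrite setTI.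
  rewrite -[X in closed X]setCK; apply: open_closedC; exact: open_regular.
by move/seteqP => [_ /(_ y I)].
Qed.

Lemma critical_constant : (forall x, critical_point H x) -> constant_function H.
Proof.
move=> cr; have loc x : nbhs x [set y | H y = H x].
  have [c ac dx] := atlas_cover x.
  have [B [oB Bc Bx] segB] := chart_box dx.
  have nx : nbhs x (dom c `&` to_plane c @^-1` B).
    apply: filterI; first by apply: open_nbhs_nbhs; split; [exact: open_dom|].
    by apply: (to_plane_cont dx); apply: open_nbhs_nbhs.
  apply: filterS nx => y [dy By] /=.
  have yq : (to_plane c y - to_plane c x) + to_plane c x = to_plane c y by rewrite subrK.
  have D p : B p -> 'D_d_u (H \o from_plane c) p = 0 /\ 'D_d_v (H \o from_plane c) p = 0.
    move=> Bp; have ip_ : img c p by exact: Bc.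
    by have := cr (from_plane c p) c ac (from_plane_dom ip_); rewrite from_planeK.
  have sHB := smooth_sub Bc (smooth_H ac).
  have := zero_gradient_constant (q := to_plane c x) (k := to_plane c y - to_plane c x) oB sHB _ D.
  rewrite yq /= !to_planeK //; apply; apply: segB; by rewrite yq.
(* A [riemannSurface] may be empty, and then any value serves as the constant. *)
have [[x0 _]|e] := pselect (exists x : S, True); last first.
  by exists 0 => x; case: e; exists x.
exists (H x0) => y; have : [set x | H x = H x0] = [set: S].
  apply: carrier_connected.
  - by exists x0.
  - exists [set x | H x = H x0]; last by rewrite setTI.
    by rewrite openE => x hx; apply: filterS (loc x) => z /= ->.
  exists [set x | H x = H x0]; last by rewrite setTI.
  rewrite -[X in closed X]setCK; apply: open_closedC.
  by rewrite openE => x hx; apply: filterS (loc x) => z /= ->.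
by move/seteqP => [_ /(_ y I)].
Qed.

(** H attains its maximum, which is an interior maximum along both coordinate lines of any chart. *)
Lemma compact_critical (x0 : S) : compact [set: S] -> exists x, critical_point H x.
Proof.
move=> cS; have cH : continuous H.
  move=> x; have [c ac dx] := atlas_cover x.
  have nx : \forall y \near x, (H \o from_plane c \o to_plane c) y = H y.
    have dn : nbhs x (dom c) by apply: open_nbhs_nbhs; split; [exact: open_dom|].
    by apply: filterS dn => y dy /=; rewrite to_planeK.
  have cc : (H \o from_plane c \o to_plane c) @ x --> (H \o from_plane c \o to_plane c) x.
    apply: continuous_comp; first exact: (to_plane_cont dx).
    exact: (smooth_continuous (smooth_H ac) (to_plane_img dx)).
  have Hx : (H \o from_plane c \o to_plane c) x = H x by rewrite /= to_planeK.
  by rewrite Hx in cc; apply: cvg_trans cc; exact: near_eq_cvg.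
have [||x _ xmax] := @compact_EVT_max S R H [set: S] _ cS; first by exists x0.
  exact: continuous_subspaceT.
exists x => c ac dx; set q := to_plane c x.
have [r r0 box] := open_box (open_img (c := c)) (to_plane_img dx).
have sH := smooth_H ac.
have max w : (w = d_u \/ w = d_v) -> (forall p, img c p -> derivable (H \o from_plane c) p w) ->
    'D_w (H \o from_plane c) q = 0.
  move=> wE dH; have inb (s : R) : s \in `](-r), r[%R -> img c (s *: w + q).
    rewrite in_itv /= -ltr_norml => sr; apply: box; case: wE => ->;
    by rewrite /= /GRing.scale /= ?mulr1 ?mulr0 ?normr0.
  have := @derive1_at_max R (fun h : R => (H \o from_plane c) (h *: w + q)) (- r) r 0.
  case=> //.
  - by rewrite ge0_cp // ltW.
  - by move=> s /inb/dH/line_derive D; exact: ex_derive.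
  - by rewrite in_itv /= oppr_lt0 r0.
  - move=> s _; rewrite scale0r add0r /= /q (to_planeK dx).
    by apply: xmax; rewrite inE.
  by move=> _; rewrite derive_line.
split; apply: max; [by left| |by right|].
  by move=> p; exact: smooth_derivable_u.
by move=> p; exact: smooth_derivable_v.
Qed.
End Global.

(** * The gradient as a vector field on the surface *)

Section GradientField.
Context {R : realType}.
Variables (eps kap : R) (S : riemannSurface R) (X : S -> E4 R) (f : S -> R).
Hypothesis conformal_X : conformal_immersion eps kap X.
Hypotheses (sf : smooth f) (regular : forall x, ~ critical_point f x).
Local Notation ip := (inner4 eps kap).

Let lam (c : @chart R S) q := ip ('D_d_u (X \o from_plane c) q) ('D_d_u (X \o from_plane c) q).

Let conformal c q : atlas c -> img c q -> [/\ 0 < lam c q,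
  ip ('D_d_v (X \o from_plane c) q) ('D_d_v (X \o from_plane c) q) = lam c q &
  ip ('D_d_u (X \o from_plane c) q) ('D_d_v (X \o from_plane c) q) = 0].
Proof.
move=> ac cq; have [_ _ conf] := conformal_X.
have [omega ho] := conf c ac; have := ho q cq.
rewrite /ind_metric push_u push_v => -[h1 h2 h3]; split.
- by apply: (eq_ind_r (fun x => 0 < x) _ h1); exact: expR_gt0.
- exact: etrans h2 (esym h1).
- exact: h3.
Qed.

Lemma chart_change4 (c d : @chart R S) (q w : R * R) (a b : R) : atlas d -> overlap c d q ->
  derivable (X \o from_plane c) q w -> is_derive q w (transition c d) (a, b) ->
  'D_w (X \o from_plane c) q = a *: 'D_d_u (X \o from_plane d) (transition c d q)
    + b *: 'D_d_v (X \o from_plane d) (transition c d q).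
Proof.
move=> ad oq Xc T; have [sX _ _] := conformal_X; apply: coord4_inj => j.
have iT : img d (transition c d q) by apply: to_plane_img; case: oq.
have sXj : smooth_on (img d) ((coord4 j \o X) \o from_plane d).
  by apply: smooth_coord4; [exact: open_img|exact: sX].
have [_ e1] := derive_coord4 j Xc.
have [_ e2] := derive_coord4 j (smooth_derivable_u (sX d ad) iT).
have [_ e3] := derive_coord4 j (smooth_derivable_v (sX d ad) iT).
have coordD (x y : E4 R) : coord4 j (x + y) = coord4 j x + coord4 j y.
  by have := coord4_linear j 1 x y; rewrite !scale1r.
have coordZ (r : R) (x : E4 R) : coord4 j (r *: x) = r * coord4 j x.
  by rewrite /coord4; case: ifP => // _ /=; rewrite !mxE.
apply: etrans (esym e1) _; apply: etrans (derive_chart_change oq sXj T) _.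
apply: etrans (esym (coordD _ _)); apply: (f_equal2 +%R).
  by apply: etrans (esym (coordZ _ _)); apply: (f_equal2 *%R); [|exact: e2].
by apply: etrans (esym (coordZ _ _)); apply: (f_equal2 *%R); [|exact: e3].
Qed.

(** The gradient is taken in the metric induced by X. A change of conformal coordinates has Jacobian
    rows (a, b) and (-b, a), and lam scales by a^2 + b^2, which is nonzero because lam is positive;
    this is exactly the transformation law of f_u / lam and f_v / lam. *)
Lemma gradient_field : admits_vector_field_without_singularities S.
Proof.
pose xi (c : @chart R S) (q : R * R) : R * R :=
  ('D_d_u (f \o from_plane c) q / lam c q, 'D_d_v (f \o from_plane c) q / lam c q).
exists xi; split; last first.
  move=> x sing; apply: (regular (x := x)) => c ac dx.
  have [l0 _ _] := conformal ac (to_plane_img dx).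
  have := sing c ac dx; rewrite /xi => -[/eqP + /eqP].
  by rewrite !mulf_eq0 invr_eq0 !(gt_eqF l0) !orbF => /eqP -> /eqP ->.
split.
  move=> c ac; have [sX _ _] := conformal_X; have oc := open_img (c := c).
  have sl : smooth_on (img c) (finv (lam c)).
    apply: smoothV => //; first by move=> q /(conformal ac)[/lt0r_neq0].
    by apply: smooth_inner4 => //; apply: smooth_du; exact: sX.
  have su := smoothM oc (smooth_du (sf ac)) sl.
  have sv := smoothM oc (smooth_dv (sf ac)) sl.
  exact: (smooth_pair oc su sv).
move=> c d ac ad q oq; have [cq dq] := oq.
have [a [b [Tu Tv]]] := transition_derive ac ad oq.
have fu := derive_chart_change oq (sf ad) Tu; have fv := derive_chart_change oq (sf ad) Tv.
have iT : img d (transition c d q) by exact: to_plane_img.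
have [sX _ _] := conformal_X.
have Xu := chart_change4 ad oq (smooth_derivable_u (sX c ac) cq) Tu.
have [l0 l1 l2] := conformal ad iT.
have [lc0 _ _] := conformal ac cq.
have lamc : lam c q = (a ^+ 2 + b ^+ 2) * lam d (transition c d q).
  rewrite [LHS]/lam Xu; move: l1 l2; rewrite /lam.
  move: ('D_d_u (X \o from_plane d) _) ('D_d_v (X \o from_plane d) _) => A B BB AB.
  rewrite inner4Dl !inner4Zl ![ip _ (_ + _)]inner4C !inner4Dl !inner4Zl BB AB.
  by rewrite (inner4C eps kap B A) AB; ring.
have ab0 : a ^+ 2 + b ^+ 2 != 0.
  by apply: contraTneq lc0 => ab; rewrite lamc ab mul0r ltxx.
have [_ Tu'] := Tu; have [_ Tv'] := Tv; rewrite Tu' Tv' /xi fu fv lamc.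
move: (lt0r_neq0 l0); move: (lam d _) ('D_d_u (f \o from_plane d) _) ('D_d_v (f \o from_plane d) _).
move=> l x y l00; rewrite /= /GRing.scale /=; congr pair; rewrite /= /GRing.scale /=; field.
  by rewrite ab0 l00.
by rewrite ab0 l00.
Qed.
End GradientField.

Unset Implicit Arguments.

Theorem theorem7 (R : realType) (eps kappa : R)
    (eps_pm1 : eps = 1 \/ eps = -1) (kappa_neq0 : kappa <> 0)
    (S : riemannSurface R) (X n1 : S -> E4 R) (H : S -> R)
    (conformal_X : conformal_immersion eps kappa X)
    (unit_normal_n1 : unit_normal eps kappa X n1)
    (mean_curvature_H : mean_curvature eps kappa X n1 H) :
  (constant_function H -> Q_holomorphic eps kappa X n1 H) /\
  ((compact [set: S] \/
    ~ admits_function_without_critical_points S \/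
    ~ admits_vector_field_without_singularities S) ->
   Q_holomorphic eps kappa X n1 H -> constant_function H).
Proof.
split; first exact: constant_H_holomorphic.
move=> hS hQ.
have sH := smooth_H eps_pm1 kappa_neq0 conformal_X unit_normal_n1 mean_curvature_H hQ.
have const := critical_constant eps_pm1 kappa_neq0 conformal_X unit_normal_n1 mean_curvature_H hQ.
have [/const //|regular] := critical_dichotomy eps_pm1 kappa_neq0 conformal_X
  unit_normal_n1 mean_curvature_H hQ.
(* The compact case needs a point for the maximum to be attained; on the empty surface H is
   trivially constant. *)
have [[x0 _]|e] := pselect (exists x : S, True); last first.
  by exists 0 => x; case: e; exists x.
case: hS => [cS|[nf|nv]].
- have [x /regular//] := compact_critical eps_pm1 kappa_neq0 conformal_X unit_normal_n1
    mean_curvature_H hQ x0 cS.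
- by case: nf; exists H.
- by case: nv; exact: gradient_field conformal_X sH regular.
Qed.
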